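(* Let $0<\alpha<n$, $1<p<n/\alpha$, $1/q=1/p-\alpha/n$ and $w\in A_{p,q}$. Assume that $\theta$ satisfies the $\mathcal D_\kappa$ condition with $0\le\kappa<p/q$. Then the fractional integral operator $I_\alpha$ is bounded from $\mathcal M^{p,\theta}(w^p,w^q)$ into $\mathcal M^{q,\theta^{q/p}}(w^q)$; that is, there is a constant $C>0$ such that $\|I_\alpha f\|_{\mathcal M^{q,\theta^{q/p}}(w^q)}\le C\|f\|_{\mathcal M^{p,\theta}(w^p,w^q)}$ for all $f\in\mathcal M^{p,\theta}(w^p,w^q)$.
   Context: The fractional integral operator (Riesz potential) on $\mathbb R^n$ is $I_\alpha f(x)=\frac1{\gamma(\alpha)}\int_{\mathbb R^n}\frac{f(y)}{|x-y|^{n-\alpha}}\,dy$, with $\gamma(\alpha)=\pi^{n/2}2^\alpha\Gamma(\alpha/2)/\Gamma((n-\alpha)/2)$. A weight is a non-negative locally integrable function $w$ on $\mathbb R^n$; $w(E)=\int_E w(x)\,dx$ for measurable $E$. In particular $w^q(E)=\int_E w(x)^q\,dx$. A weight $w$ is in $A_{p,q}$ ($1<p,q<\infty$) if there is $C>0$ such that for all balls $B\subset\mathbb R^n$, $\left(\frac1{|B|}\int_B w(x)^q\,dx\right)^{1/q}\left(\frac1{|B|}\int_B w(x)^{-p'}\,dx\right)^{1/p'}\le C$, where $1/p+1/p'=1$. For $0\le\kappa<1$, $\theta$ satisfies the $\mathcal D_\kappa$ condition if $\theta$ is a positive increasing (in the wide sense; constants such as $\theta\equiv1$ are admitted) function on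 $(0,+\infty)$ and there is a constant $C>0$ such that $\frac{\theta(\xi)}{\xi^\kappa}\le C\,\frac{\theta(\xi')}{(\xi')^\kappa}$ for all $0<\xi'<\xi<+\infty$. For $1\le p<\infty$ and weights $u,v$, $\mathcal M^{p,\theta}(v,u)$ is the space of all $f\in L^p_{loc}(v)$ with $\|f\|_{\mathcal M^{p,\theta}(v,u)}:=\sup_B\left(\frac1{\theta(u(B))}\int_B|f(x)|^pv(x)\,dx\right)^{1/p}<\infty$, the supremum being over all balls $B\subset\mathbb R^n$. Write $\mathcal M^{p,\theta}(v)=\mathcal M^{p,\theta}(v,v)$. For $\gamma>0$, $\theta^{\gamma}(\xi):=[\theta(\xi)]^{\gamma}$. *)

(* Defs.v *)
From HB Require Import structures.
From mathcomp Require Import all_boot all_order all_algebra.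
From mathcomp Require Import all_classical all_reals all_analysis measurable_realfun.

Set Implicit Arguments.
Unset Strict Implicit.
Unset Printing Implicit Defensive.

Import Order.TTheory GRing.Theory Num.Theory.
Import numFieldNormedType.Exports.

Local Open Scope classical_set_scope.
Local Open Scope ring_scope.

(* The Borel sigma-algebra of 'rV[R]_n, generated by the coordinate maps, and
   the n-fold product of the one-dimensional Lebesgue measure on it. *)
Definition rV_display : measure_display -> measure_display.
Proof. exact. Qed.

Section borel_rV.
Variables (R : realType) (n : nat).

Definition rV_coord (i : 'I_n) (x : 'rV[R]_n) : measurableTypeR R := x ord0 i.

Let rV_set0 : g_sigma_preimage rV_coord set0.
Proof. exact: sigma_algebra0. Qed.

Let rV_setC A : g_sigma_preimage rV_coord A -> g_sigma_preimage rV_coord (~` A).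
Proof. exact: sigma_algebraC. Qed.

Let rV_bigcup (F : _^nat) : (forall i, g_sigma_preimage rV_coord (F i)) ->
  g_sigma_preimage rV_coord (\bigcup_i F i).
Proof. exact: sigma_algebra_bigcup. Qed.

HB.instance Definition _ :=
  @isMeasurable.Build (rV_display default_measure_display)
    'rV[R]_n (g_sigma_preimage rV_coord) rV_set0 rV_setC rV_bigcup.

Lemma measurable_rV_coord (i : 'I_n) :
  measurable_fun [set: 'rV[R]_n] (rV_coord i).
Proof.
move=> _ Y mY; rewrite setTI; apply: sub_sigma_algebra => /=.
rewrite -bigcup_seq/=; exists i => /=; first by rewrite mem_index_enum.
by exists Y => //; rewrite setTI.
Qed.

Lemma measurable_fun_rVP d (T : measurableType d) (f : T -> 'rV[R]_n) :
  (forall i, measurable_fun [set: T] (fun x => rV_coord i (f x))) ->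
  measurable_fun [set: T] f.
Proof.
move=> mf.
suff: g_sigma_preimage (fun i => rV_coord i \o f) `<=` measurable.
  rewrite g_sigma_preimage_comp => pS _ A mA.
  by apply: pS; exists A.
apply: smallest_sub; first exact: sigma_algebra_measurable.
rewrite -bigcup_seq; apply: bigcup_sub => i _.
by move=> A [B mB <-]; exact: mf.
Qed.

End borel_rV.

Section borel_measure.
Context {R : realType}.

Definition rV_cons n (z : measurableTypeR R * 'rV[R]_n) : 'rV[R]_n.+1 :=
  row_mx (\row_(_ < 1) z.1) z.2.

Definition rV_uncons n (x : 'rV[R]_n.+1) : measurableTypeR R * 'rV[R]_n :=
  (x ord0 ord0, \row_i x ord0 (lift ord0 i)).

Lemma rV_consK n : cancel (@rV_cons n) (@rV_uncons n).
Proof.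
move=> [a v]; rewrite /rV_cons /rV_uncons; congr pair.
  by rewrite mxE; case: splitP => j //= _; rewrite mxE.
apply/rowP => i; rewrite mxE [LHS]mxE; case: splitP => j /=.
  by case: j => -[].
by rewrite /bump leq0n => -[ij]; congr (v _ _); exact: val_inj.
Qed.

Lemma rV_unconsK n : cancel (@rV_uncons n) (@rV_cons n).
Proof.
move=> x; apply/rowP => i; rewrite /rV_cons /rV_uncons mxE.
case: splitP => j ij; rewrite mxE; congr (x _ _); apply/val_inj => //=.
by rewrite ij; case: j {ij} => -[].
Qed.

Lemma measurable_rV_cons n : measurable_fun setT (@rV_cons n).
Proof.
apply: measurable_fun_rVP => i; rewrite /rV_coord /rV_cons.
rewrite -[i]/(i : 'I_(1 + n)).
under eq_fun do rewrite mxE.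
case: splitP => j ij.
  under eq_fun do rewrite mxE.
  exact: measurable_fst.
exact: (measurableT_comp (@measurable_rV_coord R n j) measurable_snd).
Qed.

Lemma measurable_rV_uncons n : measurable_fun setT (@rV_uncons n).
Proof.
apply/measurable_fun_pairP; split.
  exact: (@measurable_rV_coord R n.+1 ord0).
apply: measurable_fun_rVP => i; rewrite /rV_coord /=.
under eq_fun do rewrite mxE.
exact: (@measurable_rV_coord R n.+1 (lift ord0 i)).
Qed.


Section cons_measure.
Variables (n : nat) (m : {sigma_finite_measure set 'rV[R]_n -> \bar R}).
Local Open Scope ereal_scope.

Definition rV_cons_measure : set 'rV[R]_n.+1 -> \bar R :=
  pushforward (@lebesgue_measure R \x m) (@rV_cons n).

Let rV_cons_measure0 : rV_cons_measure set0 = 0.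
Proof. by rewrite /rV_cons_measure /pushforward preimage_set0 measure0. Qed.

Let rV_cons_measure_ge0 A : 0 <= rV_cons_measure A.
Proof. by rewrite /rV_cons_measure /pushforward measure_ge0. Qed.

Let rV_cons_measure_sigma_additive : semi_sigma_additive rV_cons_measure.
Proof.
move=> F mF tF mUF; rewrite /rV_cons_measure /pushforward preimage_bigcup.
apply: measure_semi_sigma_additive.
- by move=> k; rewrite -[X in measurable X]setTI; exact: measurable_rV_cons.
- apply/trivIsetP => /= i j _ _ ij; rewrite -preimage_setI.
  by move/trivIsetP : tF => /(_ _ _ _ _ ij) ->//; rewrite preimage_set0.
- by rewrite -preimage_bigcup -[X in measurable X]setTI;
    exact: measurable_rV_cons.
Qed.

HB.instance Definition _ := isMeasure.Build _ _ _ rV_cons_measure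
  rV_cons_measure0 rV_cons_measure_ge0 rV_cons_measure_sigma_additive.

Let rV_cons_measure_sigma_finite : sigma_finite setT rV_cons_measure.
Proof.
have /sigma_finiteP[F [TF ndF Foo]] := sigma_finiteT (@lebesgue_measure R).
have /sigma_finiteP[G [TG ndG Goo]] := sigma_finiteT m.
exists (fun k => @rV_uncons n @^-1` (F k `*` G k)).
  rewrite -preimage_bigcup (_ : \bigcup_k _ = setT) ?preimage_setT//.
  apply/seteqP; split => // -[x y] _.
  have [[i _ Fix] [j _ Gjy]] : (\bigcup_k F k) x /\ (\bigcup_k G k) y.
    by rewrite -TF -TG.
  exists (maxn i j) => //; split => /=.
  - by move: x Fix; exact/subsetPset/ndF/leq_maxl.
  - by move: y Gjy; exact/subsetPset/ndG/leq_maxr.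
move=> k; have [mFk Fk] := Foo k; have [mGk Gk] := Goo k.
split.
  rewrite -[X in measurable X]setTI; apply: measurable_rV_uncons => //.
  exact: measurableX.
rewrite /rV_cons_measure /pushforward -comp_preimage.
rewrite (_ : _ \o _ = id); last by apply/funext => z; exact: rV_consK.
by rewrite preimage_id product_measure1E// lte_mul_pinfty// ge0_fin_numE.
Qed.

HB.instance Definition _ := Measure_isSigmaFinite.Build _ _ _ rV_cons_measure
  rV_cons_measure_sigma_finite.

End cons_measure.

Fixpoint rV_borel_measure n : {sigma_finite_measure set 'rV[R]_n -> \bar R} :=
  if n is k.+1 then rV_cons_measure (rV_borel_measure k)
  else \d_(0 : 'rV[R]_0).

End borel_measure.

(* R^n with the Lebesgue measurable sets (not just the Borel ones): the
   Caratheodory sigma-algebra of the outer measure induced by the Borel product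
   measure, i.e., its completion. The topology is the usual one, inherited from
   'rV[R]_n. *)
Definition euclid (R : realType) (n : nat) : Type :=
  caratheodory_type (rV_borel_measure (R := R) n)^*%mu.

Section euclid.
Context {R : realType} {n : nat}.

HB.instance Definition _ := Measurable.on (euclid R n).
HB.instance Definition _ := Topological.on (euclid R n).

Definition leb : set (euclid R n) -> \bar R :=
  @completed_measure_extension _ _ _ (rV_borel_measure (R := R) n).

HB.instance Definition _ := Measure.on leb.

Definition eucl_dist (x y : 'rV[R]_n) : R :=
  Num.sqrt (\sum_(i < n) (x ord0 i - y ord0 i) ^+ 2).

(* The library's [ball] on 'rV[R]_n is that of the sup norm. *)
Definition eball (x : euclid R n) (r : R) : set (euclid R n) :=
  [set y | eucl_dist x y < r].

End euclid.

Definition Gamma_fun {R : realType} (s : R) : R :=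
  \int[@lebesgue_measure R]_(t in `]0, +oo[) (t `^ (s - 1) * expR (- t)).

Definition riesz_const {R : realType} (n : nat) (a : R) : R :=
  pi `^ (n%:R / 2) * 2 `^ a * Gamma_fun (a / 2) / Gamma_fun ((n%:R - a) / 2).

Section morrey.
Context {R : realType} {n : nat}.
Implicit Types (w u v : euclid R n -> R) (f : euclid R n -> \bar R).
Implicit Types (theta : R -> R) (a p q kappa : R).
Local Open Scope ereal_scope.

(* Extended-valued: where the integral does not converge absolutely the value
   is infinite, or that of the integral of a function with infinite positive
   and negative parts, which is -oo. Finiteness of a norm of [riesz a f] thus
   contains the almost everywhere absolute convergence of the integral. *)
Definition riesz a f (x : euclid R n) : \bar R :=
  (riesz_const n a)^-1%:E *
  \int[leb]_y (f y * ((eucl_dist x y `^ (n%:R - a))^-1)%:E).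

Definition weight w : Prop :=
  [/\ measurable_fun [set: euclid R n] w,
      (forall x, (0 <= w x)%R)
    & forall K : set (euclid R n), compact K ->
        \int[leb]_(x in K) (w x)%:E < +oo].

Definition wmeas w (E : set (euclid R n)) : \bar R :=
  \int[leb]_(x in E) (w x)%:E.

Definition wpow w p : euclid R n -> R := fun x => (w x `^ p)%R.

Definition conj_exp p : R := (1 - p^-1)^-1%R.

(* [w ^- p'] is computed in \bar R, so that it is +oo where w vanishes (the real
   power [0 `^ (- p')] of the library is 0). *)
Definition Apq p q w : Prop :=
  weight w /\
  exists2 C : R, (0 < C)%R & forall (x : euclid R n) (r : R), (0 < r)%R ->
    ((leb (eball x r))^-1 *
       \int[leb]_(y in eball x r) (w y `^ q)%:E) `^ q^-1 *
    ((leb (eball x r))^-1 *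
       \int[leb]_(y in eball x r) ((w y `^ conj_exp p)%:E)^-1) `^ (conj_exp p)^-1
    <= C%:E.

Definition Dkappa kappa theta : Prop :=
  [/\ (forall xi : R, 0 < xi -> 0 < theta xi)%R,
      (forall xi1 xi2 : R, 0 < xi1 -> xi1 <= xi2 -> theta xi1 <= theta xi2)%R
    & exists2 C : R, (0 < C)%R & forall xi1 xi2 : R, (0 < xi1)%R -> (xi1 < xi2)%R ->
        (theta xi2 / xi2 `^ kappa <= C * (theta xi1 / xi1 `^ kappa))%R].

Definition Lp_loc p v f : Prop :=
  measurable_fun [set: euclid R n] f /\
  forall K : set (euclid R n), compact K ->
    \int[leb]_(x in K) (`|f x| `^ p * (v x)%:E) < +oo.

(* [fine] is harmless: u is a weight, so that u has finite mass on balls. *)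
Definition morrey_norm p theta v u f : \bar R :=
  ereal_sup [set N | exists (x : euclid R n) (r : R), (0 < r)%R /\
    N = ((theta (fine (wmeas u (eball x r))))^-1%:E *
         \int[leb]_(y in eball x r) (`|f y| `^ p * (v y)%:E)) `^ p^-1].

Definition morrey p theta v u f : Prop :=
  Lp_loc p v f /\ morrey_norm p theta v u f < +oo.

End morrey.

(* Main.v *)
Require Import Defs.
From HB Require Import structures.
From mathcomp Require Import all_boot all_order all_algebra.
From mathcomp Require Import all_classical all_reals all_analysis measurable_realfun.
From mathcomp Require Import ring lra.

(** The argument runs for a family of balls on a measure space whose volumes grow
    like a power of the radius ([ball_space]), and Euclidean space is put in at
    the end. Let [u = w ^ q], [s = w ^ (- p')], [lam = 1 / q], [mu = 1 / p'], so
    that [lam + mu = 1 - a / n]. For a ball [B] of radius [r], the [A_{p,q}]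
    condition bounds [u(B) ^ lam * s(B) ^ mu] from above by a multiple of
    [r ^ (n - a)], and Hoelder's inequality bounds it from below
    ([balanced_weights]). This symmetric relation is all that is used of the
    weight. It makes both densities doubling, and, since an annulus contains a
    ball of comparable size, reverse doubling ([balanced_doubling],
    [doubling_reverse]).

    Up to a constant, [|x - y| ^ (a - n)] is the limit of the finite sums over
    the radii [r_k = 2 ^ k * rho] of [r_k ^ (a - n)] times the indicator of the
    ball of radius [r_k] about [x]. So it is enough to estimate the dyadic
    potentials, the sums over [k] of [r_k ^ (a - n)] times the mass of [h] in
    these balls, with a constant independent of the range of [k].

    They are bounded from [L^p(s)] to [L^q(u)], as maps [F |-> T (F s)], by
    duality. Paired with [g u], where [g] is in [L^q'(u)], the term at the scale
    [r] is at most a multiple of the integral over [z] of [r ^ (a - 2 * n)] times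
    the masses of [F s] and of [g u] in the ball of radius [2 * r] about [z]. The
    relation between the densities divides one of the two masses by
    [s(B) ^ mu] and the other by [u(B) ^ lam]. Young's inequality with the
    exponents [p * (1 + eta)] and [q' * (1 + eta)], [eta = a / n], which are
    conjugate because [1 / p + 1 / q' = 1 + eta], separates the two factors
    ([bilinear_estimate]). It remains to sum over all scales the integral of the
    power [p * (1 + eta)] of [s(B) ^ (- mu)] times the mass of [F s]
    ([carleson_embedding]): only points where [F] is at least half its average
    matter, and at such a point the sum over the scales is one of terms
    [min (c * v_k ^ eta) (d * v_k ^ (- mu))], where the masses [v_k] grow
    geometrically, so that its largest term dominates ([sum_peak]).

    For a function [h] in the Morrey space and a ball of radius [r], the scales
    below [r] see only the restriction of [h] to the doubled ball, to which the
    previous bound applies ([near_bound]). The scales above [r] are bounded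
    pointwise by terms [theta(v_k) ^ (1 / p) * v_k ^ (- lam)], where [v_k] is the
    mass of the [k]-th dilate of the ball for [u]; the [D_kappa] condition with
    [kappa < p / q] and reverse doubling make them decay geometrically
    ([far_bound]). Monotone convergence leads from the finite sums to the kernel
    ([kernel_morrey_bound]).

    Finally, since [w ^ (- p')] is infinite at the zeros of [w], an [A_{p,q}]
    weight vanishes almost everywhere, and then the norm of the potential is
    zero, or it is positive almost everywhere ([weight_dichotomy]), and then it
    may be replaced by one without zeros. *)

Set Implicit Arguments.
Unset Strict Implicit.
Unset Printing Implicit Defensive.

Import Order.TTheory GRing.Theory Num.Theory.
Import numFieldNormedType.Exports.

Local Open Scope classical_set_scope.
Local Open Scope ring_scope.

(** * Powers, Young's inequality and geometric sums *)

Section real_powers.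
Context {R : realType}.
Implicit Types (x y c d p q r : R).

Lemma gt0_expR x : 0 < x -> exists l, x = expR l.
Proof. by move=> x0; exists (ln x); rewrite lnK. Qed.

Lemma powR_expR l p : expR l `^ p = expR (p * l).
Proof. by rewrite /powR gt_eqF ?expR_gt0// expRK. Qed.

Lemma powRDg x p q : 0 < x -> x `^ (p + q) = x `^ p * x `^ q.
Proof. by move=> x0; rewrite powRD// (gt_eqF x0) implybT. Qed.

Lemma powR_invK x p : 0 <= x -> p != 0 -> (x `^ p) `^ p^-1 = x.
Proof. by move=> x0 p0; rewrite -powRrM mulfV// powRr1. Qed.

Lemma powRV_K x p : 0 <= x -> p != 0 -> (x `^ p^-1) `^ p = x.
Proof. by move=> x0 p0; rewrite -powRrM mulVf// powRr1. Qed.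

Lemma powR_le_lnonneg x y p : 0 <= p -> 0 <= x -> x <= y -> x `^ p <= y `^ p.
Proof.
by move=> p0 x0 xy; apply: ge0_ler_powR => //; rewrite nnegrE// (le_trans x0).
Qed.

Lemma powR_le_lneg x y p : p <= 0 -> 0 < x -> x <= y -> y `^ p <= x `^ p.
Proof.
move=> p0 x0 xy; have y0 := lt_le_trans x0 xy.
have [r -> r0] : exists2 r, p = - r & 0 <= r.
  by exists (- p); rewrite ?opprK// oppr_ge0.
rewrite !powRN lef_pV2 ?posrE ?powR_gt0//.
exact: powR_le_lnonneg r0 (ltW x0) xy.
Qed.

Lemma powR1x p : 1 `^ p = 1 :> R.
Proof. by rewrite powR1. Qed.

Lemma powR_lt1 x p : 0 < x -> x < 1 -> 0 < p -> x `^ p < 1.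
Proof.
move=> x0 x1 p0; rewrite -[ltRHS](powR1x p).
by apply: gt0_ltr_powR => //; rewrite nnegrE ltW.
Qed.

(** Young's inequality with a free scale [l]. The coefficients [1 / s] and
    [1 / t] are dropped, being at most one. *)
Lemma young_scaled (s t x y l : R) : 1 < s -> 1 < t -> s^-1 + t^-1 = 1 ->
  0 <= x -> 0 <= y -> 0 < l -> x * y <= l `^ s * x `^ s + l `^ (- t) * y `^ t.
Proof.
move=> s1 t1 st x0 y0 l0; have s0 : 0 < s by lra. have t0 : 0 < t by lra.
have := @conjugate_powR R (l * x) (l^-1 * y) s t.
have lx0 : 0 <= l * x by rewrite mulr_ge0// ltW.
have ly0 : 0 <= l^-1 * y by rewrite mulr_ge0 ?invr_ge0// ltW.
move=> /(_ lx0 ly0 s0 t0 st).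
rewrite mulrACA mulfV ?gt_eqF// mul1r => /le_trans; apply.
have l0' := ltW l0.
rewrite !powRM ?invr_ge0// -powR_inv1// -powRrM mulN1r.
apply: lerD; rewrite ler_pdivrMr// ler_peMr//; try exact: ltW.
all: by rewrite mulr_ge0 ?powR_ge0.
Qed.

(** For the best scale both terms of Young's inequality equal the product. The
    scale depends on [P] and [Q] alone, so that it can be used in every term of
    a sum of which only the two total powers are known. *)
Lemma young_optimal (s t P Q : R) : 1 < s -> 1 < t -> s^-1 + t^-1 = 1 ->
  0 < P -> 0 < Q ->
  exists2 l : R, 0 < l & l `^ s * P `^ s + l `^ (- t) * Q `^ t = 2 * (P * Q).
Proof.
move=> s1 t1 st P0 Q0; have s0 : 0 < s by lra. have t0 : 0 < t by lra.
exists (Q `^ s^-1 * P `^ (- t^-1)); first by rewrite mulr_gt0 ?powR_gt0.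
rewrite !powRM ?powR_ge0//.
rewrite -!powRrM mulVf ?gt_eqF// powRr1 ?ltW// -mulrA -powRDg//.
rewrite mulrAC -powRDg//.
have -> : - t^-1 * - t = 1 by rewrite mulrNN mulVf ?gt_eqF.
have -> : - t^-1 * s + s = 1.
  have -> : t^-1 = 1 - s^-1 by lra.
  by field; rewrite gt_eqF.
have -> : s^-1 * - t + t = 1.
  have -> : s^-1 = 1 - t^-1 by lra.
  by field; rewrite gt_eqF.
by rewrite !powRr1 ?ltW//; lra.
Qed.

End real_powers.

Section geometric_sums.
Context {R : realType}.
Implicit Types (y v : nat -> R) (rho : R).

Let sum_low y rho (M : nat) : 0 < rho -> rho < 1 -> (forall k, 0 < y k) ->
  (forall k, y k <= rho * y k.+1) ->
  \sum_(k < M.+1) (if y k <= 1 then y k else 0) <= Num.min 1 (y M) / (1 - rho).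
Proof.
move=> rho0 rho1 y0 yS; have r1 : 0 < 1 - rho by lra.
elim: M => [|M IH].
  rewrite big_ord_recr big_ord0/= add0r; case: (leP (y 0%N) 1) => y1.
    by rewrite ler_pdivlMr//; have := y0 0%N; nra.
  by rewrite divr_ge0// ltW.
rewrite big_ord_recr/=; case: (leP (y M.+1) 1) => y1.
  have : \sum_(k < M.+1) (if y k <= 1 then y k else 0) <= y M / (1 - rho).
    by apply: (le_trans IH); rewrite ler_pM2r ?invr_gt0// ge_min lexx orbT.
  have : y M / (1 - rho) <= rho * y M.+1 / (1 - rho).
    by rewrite ler_pM2r ?invr_gt0.
  have -> : y M.+1 / (1 - rho) = rho * y M.+1 / (1 - rho) + y M.+1.
    by field; rewrite gt_eqF.
  lra.
rewrite addr0; apply: (le_trans IH).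
by rewrite ler_pM2r ?invr_gt0// ge_min lexx.
Qed.

Let sum_high y rho (M : nat) : 0 < rho -> rho < 1 -> (forall k, 0 < y k) ->
  (forall k, y k <= rho * y k.+1) ->
  \sum_(k < M) (if y k <= 1 then 0 else (y k)^-1) <=
    (Num.max 1 (y 0%N))^-1 / (1 - rho).
Proof.
move=> rho0 rho1; have r1 : 0 < 1 - rho by lra.
elim: M y => [|M IH] y y0 yS.
  by rewrite big_ord0 divr_ge0 ?invr_ge0 ?le_max ?ler01// ltW.
rewrite big_ord_recl/=.
have := IH (fun k => y k.+1) (fun k => y0 k.+1) (fun k => yS k.+1).
under [X in _ -> _ + X <= _]eq_bigr do rewrite /bump/= add1n.
set S := \sum_(k < M) _ => IHS; case: (leP (y 0%N) 1) => y1.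
  rewrite add0r; apply: (le_trans IHS).
  by rewrite ler_pM2r ?invr_gt0// lef_pV2 ?posrE ?ltr01 ?lt_max ?ltr01// le_max lexx.
have y10 := y0 1%N; have y00 := y0 0%N.
have : S <= (y 1%N)^-1 / (1 - rho).
  apply: (le_trans IHS); rewrite ler_pM2r ?invr_gt0// lef_pV2 ?posrE//.
    by rewrite le_max lexx orbT.
  by rewrite lt_max ltr01.
have : (y 1%N)^-1 / (1 - rho) <= rho / y 0%N / (1 - rho).
  rewrite ler_pM2r ?invr_gt0// ler_pdivlMr// mulrC ler_pdivrMr//.
have -> : (y 0%N)^-1 / (1 - rho) = (y 0%N)^-1 + rho / y 0%N / (1 - rho).
  by field; rewrite !gt_eqF.
lra.
Qed.

(** Each term is at most [delta `^ g] times the one before, so the first term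
    dominates. *)
Lemma sum_geometric_inv v (g delta : R) (M : nat) : 0 < delta -> delta < 1 ->
  0 < g -> (forall k, 0 < v k) -> (forall k, v k <= delta * v k.+1) ->
  \sum_(k < M) v k `^ (- g) <= (1 - delta `^ g)^-1 * v 0%N `^ (- g).
Proof.
move=> d0 d1 g0 v0 vS.
have r1 : 0 < 1 - delta `^ g.
  by rewrite subr_gt0 powR_lt1.
elim: M v v0 vS => [|M IH] v v0 vS.
  by rewrite big_ord0 mulr_ge0 ?powR_ge0// invr_ge0 ltW.
rewrite big_ord_recl/=.
have := IH (fun k => v k.+1) (fun k => v0 k.+1) (fun k => vS k.+1).
under [X in _ -> _ + X <= _]eq_bigr do rewrite /bump/= add1n.
set S := \sum_(k < M) _ => IHS.
have : v 1%N `^ (- g) <= delta `^ g * v 0%N `^ (- g).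
  have /(powR_le_lnonneg (ltW g0) (ltW (v0 0%N))) := vS 0%N.
  rewrite powRM; [|exact: ltW|exact: ltW] => h; rewrite !powRN.
  by rewrite ler_pdivlMr ?powR_gt0// mulrC ler_pdivrMr ?powR_gt0.
rewrite -(ler_pM2l (x := (1 - delta `^ g)^-1)) ?invr_gt0// => h.
have -> : (1 - delta `^ g)^-1 * v 0%N `^ (- g) =
    v 0%N `^ (- g) + (1 - delta `^ g)^-1 * (delta `^ g * v 0%N `^ (- g)).
  by field; rewrite gt_eqF.
by rewrite lerD2l (le_trans IHS).
Qed.

(** As [v] grows geometrically, the terms below the crossing point of the two
    powers increase geometrically and those above decrease geometrically: the
    sum is comparable to the common value of the powers at the crossing,
    whatever the number of terms. *)
Lemma sum_peak (al be delta : R) : 0 < al -> 0 < be -> 0 < delta -> delta < 1 ->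
  exists2 C : R, 0 < C & forall (c d : R) v (M : nat), 0 < c -> 0 < d ->
    (forall k, 0 < v k) -> (forall k, v k <= delta * v k.+1) ->
    \sum_(k < M) Num.min (c * v k `^ al) (d * v k `^ (- be)) <=
      C * (c `^ (be / (al + be)) * d `^ (al / (al + be))).
Proof.
move=> al0 be0 d0 d1; pose g := Num.min al be.
have g0 : 0 < g by rewrite lt_min al0.
pose rho := delta `^ g; have rho0 : 0 < rho by exact: powR_gt0.
have rho1 : rho < 1 by exact: powR_lt1.
have r1 : 0 < 1 - rho by lra.
exists (2 / (1 - rho)); first by rewrite divr_gt0.
move=> c d v M c0 dd0 v0 vS.
have ab0 : 0 < al + be by lra.
(* the crossing point: [c * t `^ al = d * t `^ (- be)] *)
pose t := (d / c) `^ (al + be)^-1; have t0 : 0 < t by rewrite powR_gt0// divr_gt0.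
pose m := c `^ (be / (al + be)) * d `^ (al / (al + be)).
have m0 : 0 < m by rewrite mulr_gt0 ?powR_gt0.
have e1 : c * t `^ al = m.
  rewrite /m /t; have [a ->] := gt0_expR c0; have [b ->] := gt0_expR dd0.
  rewrite -expRN -expRD !powR_expR -!expRD; congr expR.
  by field; rewrite gt_eqF.
have e2 : d * t `^ (- be) = m.
  rewrite /m /t; have [a ->] := gt0_expR c0; have [b ->] := gt0_expR dd0.
  rewrite -expRN -expRD !powR_expR -!expRD; congr expR.
  by field; rewrite gt_eqF.
pose y k := (v k / t) `^ g.
have y0 k : 0 < y k by rewrite powR_gt0// divr_gt0.
have yS k : y k <= rho * y k.+1.
  rewrite /y /rho -powRM; [|exact: ltW|by rewrite divr_ge0// ltW].
  apply: powR_le_lnonneg; [exact: ltW|by rewrite divr_ge0// ltW|].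
  by rewrite mulrA ler_pM2r ?invr_gt0// vS.
have vE k : v k = t * (v k / t) by rewrite mulrC divfK// gt_eqF.
have vt0 k : 0 < v k / t by rewrite divr_gt0.
have term k : Num.min (c * v k `^ al) (d * v k `^ (- be)) <=
    m * ((if y k <= 1 then y k else 0) + (if y k <= 1 then 0 else (y k)^-1)).
  have -> : c * v k `^ al = m * (v k / t) `^ al.
    by rewrite {1}vE powRM; [rewrite mulrA e1|exact: ltW|exact: ltW].
  have -> : d * v k `^ (- be) = m * (v k / t) `^ (- be).
    by rewrite {1}vE powRM; [rewrite mulrA e2|exact: ltW|exact: ltW].
  rewrite -minr_pMr; last exact: ltW.
  rewrite ler_pM2l//.
  have le1 : (y k <= 1) = (v k / t <= 1).
    apply/idP/idP => h; last first.
      rewrite /y -[leRHS](powR1x g).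
      by apply: powR_le_lnonneg; [exact: ltW|exact: ltW|].
    rewrite leNgt; apply/negP => h1; move: h; apply/negP; rewrite -ltNge.
    rewrite /y -[ltLHS](powR1x g).
    by apply: gt0_ltr_powR; rewrite ?nnegrE// ltW.
  rewrite le1; case: (leP (v k / t) 1) => h.
    rewrite addr0 ge_min; apply/orP; left; apply: ger_powR.
      by rewrite vt0.
    by rewrite ge_min lexx.
  rewrite add0r ge_min; apply/orP; right; rewrite /y -powRN.
  apply: ler_powR; first exact: ltW.
  by rewrite lerN2 ge_min lexx orbT.
apply: (le_trans (y := \sum_(k < M) m * ((if y k <= 1 then y k else 0) +
    (if y k <= 1 then 0 else (y k)^-1)))).
  by apply: ler_sum => k _; exact: term.
rewrite -mulr_sumr big_split/= -/m mulrC ler_pM2r//.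
case: M => [|M].
  by rewrite !big_ord0 addr0 divr_ge0// ltW.
have -> : 2 / (1 - rho) = 1 / (1 - rho) + 1 / (1 - rho) by field; rewrite gt_eqF.
apply: lerD.
  apply: (le_trans (sum_low _ rho0 rho1 y0 yS)).
  by rewrite ler_pM2r ?invr_gt0// ge_min lexx.
apply: (le_trans (sum_high _ rho0 rho1 y0 yS)).
rewrite ler_pM2r ?invr_gt0// -[leRHS]invr1.
by rewrite lef_pV2 ?posrE ?ltr01// ?le_max ?lexx// lt_max ltr01.
Qed.

End geometric_sums.

(** * Euclidean distance and the volume of balls *)

Section euclidean_distance.
Context {R : realType} {n : nat}.
Implicit Types (x y z : 'rV[R]_n) (r : R).

Lemma eucl_dist_ge0 x y : 0 <= eucl_dist x y.
Proof. exact: sqrtr_ge0. Qed.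

Lemma eucl_distC x y : eucl_dist x y = eucl_dist y x.
Proof.
by congr Num.sqrt; apply: eq_bigr => i _; rewrite -sqrrN opprB.
Qed.

Lemma eucl_distxx x : eucl_dist x x = 0.
Proof.
by rewrite /eucl_dist big1 ?sqrtr0// => i _; rewrite subrr expr0n.
Qed.

Let sum_sqr_ge0 (u : 'I_n -> R) : 0 <= \sum_(i < n) u i ^+ 2.
Proof. by apply: sumr_ge0 => i _; exact: sqr_ge0. Qed.

Lemma coord_le_eucl_dist x y i : `|x ord0 i - y ord0 i| <= eucl_dist x y.
Proof.
rewrite -sqrtr_sqr ler_sqrt// (bigD1 i)//= lerDl.
by apply: sumr_ge0 => j _; exact: sqr_ge0.
Qed.

Lemma eucl_dist_le_coord x y r : 0 <= r ->
  (forall i, `|x ord0 i - y ord0 i| <= r) -> eucl_dist x y <= n%:R * r.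
Proof.
move=> r0 xyr.
rewrite -[leRHS]ger0_norm ?mulr_ge0// -sqrtr_sqr ler_sqrt ?sqr_ge0//.
apply: (@le_trans _ _ (\sum_(i < n) r ^+ 2)).
  by apply: ler_sum => i _; rewrite -real_normK ?num_real// lerXn2r ?nnegrE.
rewrite sumr_const card_ord -[leLHS]mulr_natl exprMn ler_wpM2r ?sqr_ge0//.
by rewrite -natrX ler_nat; case: (n) => // m; rewrite leq_pmulr.
Qed.

(* The Cauchy-Schwarz inequality, as a sum of perfect squares. *)
Let sum_mul_le (u v : 'I_n -> R) : \sum_(i < n) u i * v i <=
  Num.sqrt (\sum_(i < n) u i ^+ 2) * Num.sqrt (\sum_(i < n) v i ^+ 2).
Proof.
set U := \sum_(i < n) u i ^+ 2; set V := \sum_(i < n) v i ^+ 2.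
have U0 : 0 <= U by exact: sum_sqr_ge0.
have V0 : 0 <= V by exact: sum_sqr_ge0.
have zero (f : 'I_n -> R) : \sum_(i < n) f i ^+ 2 = 0 -> forall i, f i = 0.
  move=> /eqP; rewrite psumr_eq0; last by move=> i _; exact: sqr_ge0.
  by move=> /allP f0 i; have /= := f0 i (mem_index_enum i); rewrite sqrf_eq0 => /eqP.
have [U00|Un0] := eqVneq U 0.
  rewrite big1 ?mulr_ge0 ?sqrtr_ge0// => i _; by rewrite (zero _ U00) mul0r.
have [V00|Vn0] := eqVneq V 0.
  rewrite big1 ?mulr_ge0 ?sqrtr_ge0// => i _; by rewrite (zero _ V00) mulr0.
set a := Num.sqrt U; set b := Num.sqrt V.
have a0 : 0 < a by rewrite sqrtr_gt0 lt_neqAle eq_sym Un0.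
have b0 : 0 < b by rewrite sqrtr_gt0 lt_neqAle eq_sym Vn0.
have UE : U = a ^+ 2 by rewrite sqr_sqrtr.
have VE : V = b ^+ 2 by rewrite sqr_sqrtr.
have -> : a * b = \sum_(i < n) (b / a * u i ^+ 2 + a / b * v i ^+ 2) / 2.
  rewrite -mulr_suml big_split/= -!mulr_sumr -/U -/V UE VE.
  by field; rewrite !gt_eqF.
apply: ler_sum => i _; rewrite -subr_ge0.
have -> : (b / a * u i ^+ 2 + a / b * v i ^+ 2) / 2 - u i * v i =
    (b * u i - a * v i) ^+ 2 / (2 * a * b) by field; rewrite !gt_eqF.
by rewrite divr_ge0 ?sqr_ge0// !mulr_ge0// ltW.
Qed.

Lemma eucl_dist_triangle y x z : eucl_dist x z <= eucl_dist x y + eucl_dist y z.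
Proof.
pose u i := x ord0 i - y ord0 i; pose v i := y ord0 i - z ord0 i.
rewrite -[leRHS]ger0_norm ?addr_ge0 ?eucl_dist_ge0// -sqrtr_sqr.
rewrite ler_sqrt ?sqr_ge0// sqrrD !sqr_sqrtr ?sum_sqr_ge0//.
have -> : \sum_(i < n) (x ord0 i - z ord0 i) ^+ 2 =
    \sum_(i < n) u i ^+ 2 + (\sum_(i < n) u i * v i) *+ 2 +
    \sum_(i < n) v i ^+ 2.
  rewrite -sumrMnl -!big_split/=; apply: eq_bigr => i _.
  by rewrite -sqrrD /u /v addrA subrK.
by rewrite lerD2r lerD2l lerMn2r sum_mul_le.
Qed.

End euclidean_distance.

Section ball_inclusions.
Context {R : realType} {n : nat}.
Implicit Types (x y z : euclid R n) (r s : R).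

Lemma eballC x y r : (eball x r) y = (eball y r) x.
Proof. by rewrite /eball/= eucl_distC. Qed.

Lemma sub_eball x y r s : eucl_dist x y + r <= s -> eball y r `<=` eball x s.
Proof.
move=> h z; rewrite /eball/= => zr.
by rewrite (le_lt_trans (eucl_dist_triangle y x z))// (lt_le_trans _ h)// ltrD2l.
Qed.

End ball_inclusions.

Section euclid_measure.
Context {R : realType} {n : nat}.
Local Notation E := (euclid R n).

Lemma leb_sigma_finite : sigma_finite [set: E] (@leb R n).
Proof. exact/completed_measure_extension_sigma_finite/sigma_finiteT. Qed.

HB.instance Definition _ := Measure_isSigmaFinite.Build _ _ _ (@leb R n)
  leb_sigma_finite.

Lemma borel_measurable (A : set 'rV[R]_n) :
  measurable A -> measurable (A : set E).
Proof. exact: caratheodory_measurable_mu_ext. Qed.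

Lemma leb_borel (A : set 'rV[R]_n) :
  measurable A -> leb (A : set E) = rV_borel_measure n A.
Proof. exact: measurable_mu_extE. Qed.

Lemma measurable_euclid_coord (i : 'I_n) :
  measurable_fun [set: E] (fun x : E => (x : 'rV[R]_n) ord0 i : R).
Proof.
move=> _ Y mY; rewrite setTI; apply: borel_measurable.
by have := @measurable_rV_coord R n i measurableT _ mY; rewrite setTI.
Qed.

Lemma measurable_eucl_dist d (T : measurableType d) (f g : T -> E) :
  measurable_fun setT f -> measurable_fun setT g ->
  measurable_fun setT (fun t => eucl_dist (f t) (g t)).
Proof.
move=> mf mg; apply: (@measurableT_comp _ _ _ _ _ _ (@Num.sqrt R)).
  apply: continuous_measurable_fun; exact: sqrt_continuous.
apply: measurable_sum => i; apply: measurable_funX; apply: measurable_funB.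
  exact: (measurableT_comp (measurable_euclid_coord i) mf).
exact: (measurableT_comp (measurable_euclid_coord i) mg).
Qed.

Lemma measurable_eball (x : E) (r : R) : measurable (eball x r).
Proof.
rewrite (_ : eball x r =
    setT `&` (fun y => eucl_dist x y) @^-1` `]-oo, r[%classic); last first.
  by rewrite setTI; apply/seteqP; split => y /=; rewrite in_itv.
by apply: measurable_eucl_dist.
Qed.

Lemma measurable_eball_rel (r : R) :
  measurable [set z : E * E | eball z.1 r z.2].
Proof.
rewrite (_ : mkset _ = setT `&`
    (fun z : E * E => eucl_dist z.1 z.2) @^-1` `]-oo, r[%classic); last first.
  by rewrite setTI; apply/seteqP; split => y /=; rewrite in_itv.
by apply: measurable_eucl_dist.
Qed.

End euclid_measure.

Section ball_volume.
Context {R : realType}.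

Definition cube n (x : 'rV[R]_n) (r : R) : set 'rV[R]_n :=
  [set y | forall i, `|x ord0 i - y ord0 i| < r].

Lemma measurable_cube n (x : 'rV[R]_n) (r : R) : measurable (cube x r).
Proof.
rewrite (_ : cube x r = \bigcap_(i in [set: 'I_n])
    (setT `&` @rV_coord R n i @^-1` [set t | `|x ord0 i - t| < r])); last first.
  apply/seteqP; split => [y h i _|y h i]; first by split => //; exact: h.
  by have [] := h i I.
apply: fin_bigcap_measurable; first exact: finite_finset.
move=> i _; apply: measurable_rV_coord => //.
have -> : [set t | `|x ord0 i - t| < r] = ball (x ord0 i) r by [].
exact: measurable_ball.
Qed.

(** A cube is a product of intervals, which [rV_cons] splits off one by one. *)
Lemma borel_measure_cube n (x : 'rV[R]_n) (r : R) : 0 < r ->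
  rV_borel_measure n (cube x r) = ((2 * r) ^+ n)%:E.
Proof.
move=> r0; elim: n x => [|n IH] x /=.
  by rewrite diracE mem_set// => -[].
rewrite /rV_cons_measure /pushforward.
have -> : @rV_cons R n @^-1` cube x r =
  ball (x ord0 ord0) r `*` cube (\row_i x ord0 (lift ord0 i)) r.
  apply/seteqP; split => [[a v] h|[a v] [/= h0 h1] i]/=; rewrite /rV_cons.
    split => [|i]/=; rewrite ?/ball/=.
      by have := h ord0; rewrite /rV_cons/= mxE; case: splitP => j //= _; rewrite mxE.
    have := h (lift ord0 i); rewrite /rV_cons/= !mxE; case: splitP => j /=.
      by case: j => -[].
    by rewrite /bump leq0n => -[ij]; rewrite (_ : i = j)//; exact: val_inj.
  rewrite -[i]/(i : 'I_(1 + n)) mxE; case: splitP => j ij.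
    rewrite mxE (_ : i = ord0)//; apply: val_inj; rewrite /= ij; by case: j {ij} => -[].
  have := h1 j; rewrite mxE (_ : lift ord0 j = i)//.
  by apply: val_inj; rewrite /= ij.
rewrite product_measure1E//=; last 2 first.
  exact: measurable_ball.
  exact: measurable_cube.
rewrite IH lebesgue_measure_ball; last exact: ltW.
by rewrite -EFinM exprS mulr_natl.
Qed.

(** The sup-norm cubes inscribed in a ball and circumscribed about it give the
    volume up to a constant. *)
Lemma leb_eball_ge n (x : euclid R n) (r : R) : (0 < n)%N -> 0 < r ->
  ((n%:R^-1 ^+ n * r ^+ n)%:E <= leb (eball x r))%E.
Proof.
move=> n0 r0; have n0' : 0 < n%:R :> R by rewrite ltr0n.
have rn0 : 0 < r / n%:R / 2 by rewrite !divr_gt0.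
rewrite -exprMn mulrC (_ : r / n%:R = 2 * (r / n%:R / 2)); last by field; rewrite gt_eqF.
rewrite -(borel_measure_cube x rn0).
rewrite -leb_borel; last exact: measurable_cube.
apply: le_measure; rewrite ?inE.
- apply: borel_measurable; exact: measurable_cube.
- exact: measurable_eball.
move=> y xy; apply: (@le_lt_trans _ _ (n%:R * (r / n%:R / 2))).
  apply: eucl_dist_le_coord; first exact: ltW.
  by move=> i; apply/ltW/xy.
have -> : n%:R * (r / n%:R / 2) = r / 2 by field; rewrite gt_eqF.
by move: (r0 : 0 < r); lra.
Qed.

Lemma leb_eball_le n (x : euclid R n) (r : R) : 0 < r ->
  (leb (eball x r) <= (2 ^+ n * r ^+ n)%:E)%E.
Proof.
move=> r0; rewrite -exprMn -(borel_measure_cube x r0).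
rewrite -leb_borel; last exact: measurable_cube.
apply: le_measure; rewrite ?inE; first exact: measurable_eball.
  apply: borel_measurable; exact: measurable_cube.
by move=> y xy i; apply: le_lt_trans xy; exact: coord_le_eucl_dist.
Qed.

End ball_volume.

(** * Families of balls and densities on them *)

Section hoelder_integral.
Context d {T : measurableType d} {R : realType}.
Variable m : {measure set T -> \bar R}.
Local Open Scope ereal_scope.

(** Hoelder's inequality in the form in which the exponents are the weights of
    a geometric mean. *)
Lemma hoelder_geometric (D : set T) (X Y : T -> R) (al be : R) :
  measurable D -> measurable_fun setT X -> measurable_fun setT Y ->
  (forall x, 0 <= X x)%R -> (forall x, 0 <= Y x)%R ->
  (0 < al)%R -> (0 < be)%R -> (al + be = 1)%R ->
  \int[m]_(x in D) (X x `^ al * Y x `^ be)%:E <=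
    (\int[m]_(x in D) (X x)%:E) `^ al * (\int[m]_(x in D) (Y x)%:E) `^ be.
Proof.
move=> mD mX mY X0 Y0 al0 be0 ab.
have mpow (Z : T -> R) (c : R) : measurable_fun setT Z ->
    measurable_fun setT (fun x => (Z x `^ c * \1_D x)%R).
  move=> mZ; apply: measurable_funM; last exact: measurable_indic.
  exact: (measurableT_comp (measurable_powR c)).
have := @hoelder _ _ _ m _ _ al^-1 be^-1 (mpow X al mX) (mpow Y be mY).
rewrite !invr_gt0 !invrK => /(_ al0 be0 ab).
rewrite Lnorm1 unlock !invrK.
have E1 (Z : T -> R) (c : R) : (0 < c)%R -> (forall x, 0 <= Z x)%R ->
    \int[m]_x `|(Z x `^ c * \1_D x)%R%:E| `^ c^-1 = \int[m]_(x in D) (Z x)%:E.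
  move=> c0 Z0; rewrite [RHS]integral_mkcond; apply: eq_integral => x _.
  rewrite patchE indicE; case: ifPn => xD; last first.
    by rewrite mulr0 abse0 poweR0r// invr_eq0 gt_eqF.
  by rewrite mulr1 gee0_abs ?lee_fin ?powR_ge0// poweR_EFin powR_invK// gt_eqF.
move=> h; rewrite -(E1 X al al0 X0) -(E1 Y be be0 Y0); apply: le_trans h.
rewrite integral_mkcond le_eqVlt; apply/orP; left; apply/eqP.
apply: eq_integral => x _; rewrite patchE /= indicE; case: ifPn => xD; last first.
  by rewrite mulr0 mul0r normr0.
by rewrite !mulr1 ger0_norm// mulr_ge0 ?powR_ge0.
Qed.

End hoelder_integral.

Section nonneg_measurable.
Context d {T : measurableType d} {R : realType}.
Implicit Types (f g : T -> R).

Definition nonneg_measurable f :=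
  measurable_fun [set: T] f /\ (forall x, 0 <= f x).

Lemma nonneg_measurableM f g : nonneg_measurable f -> nonneg_measurable g ->
  nonneg_measurable (fun x => f x * g x).
Proof.
move=> [mf f0] [mg g0]; split; first exact: measurable_funM.
by move=> x; rewrite mulr_ge0.
Qed.

Lemma nonneg_measurable_powR f (c : R) : nonneg_measurable f ->
  nonneg_measurable (fun x => f x `^ c).
Proof.
move=> [mf f0]; split; first exact: (measurableT_comp (measurable_powR c)).
by move=> x; exact: powR_ge0.
Qed.

Lemma nonneg_measurable_cst (c : R) : 0 <= c ->
  nonneg_measurable (fun _ : T => c).
Proof. by move=> c0; split. Qed.

Lemma nonneg_measurable_indic (D : set T) : measurable D ->
  nonneg_measurable (\1_D : T -> R).
Proof. by move=> mD; split; [exact: measurable_indic|]. Qed.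

Lemma nonneg_measurable_EFin f (D : set T) : nonneg_measurable f ->
  measurable_fun D (fun x => (f x)%:E).
Proof. by move=> [mf _]; apply/measurable_EFinP; exact: measurable_funTS. Qed.

End nonneg_measurable.

(** The properties of Euclidean balls on which the estimates rest. The ball that
    [ball_annulus] places in the annulus of radii [r] and [2 * r] is what turns
    doubling into reverse doubling. *)
Record ball_space d (T : measurableType d) (R : realType)
    (m : {sigma_finite_measure set T -> \bar R}) (dim : R)
    (B : T -> R -> set T) : Prop := BallSpace {
  ball_sym : forall x y r, B x r y -> B y r x ;
  ball_tri : forall x y r s, B x r y -> B y s `<=` B x (r + s) ;
  ball_mono : forall x r s, r <= s -> B x r `<=` B x s ;
  ball_annulus : forall x r, 0 < r -> exists y, [/\ B y (r / 2) `<=` B x (2 * r),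
    B x r `&` B y (r / 2) = set0 & B x (2 * r) `<=` B y (4 * r)] ;
  ball_measurable_rel : forall r, measurable [set z : T * T | B z.1 r z.2] ;
  ball_volume : exists2 c : R, 0 < c & forall x r, 0 < r ->
    ((c^-1 * r `^ dim)%:E <= m (B x r) <= (c * r `^ dim)%:E)%E }.

HB.lock Definition ball_int d (T : measurableType d) (R : realType)
    (m : {sigma_finite_measure set T -> \bar R}) (B : T -> R -> set T)
    (h : T -> R) (x : T) (r : R) : \bar R :=
  (\int[m]_(y in B x r) (h y)%:E)%E.

HB.lock Definition ball_mass d (T : measurableType d) (R : realType)
    (m : {sigma_finite_measure set T -> \bar R}) (B : T -> R -> set T)
    (h : T -> R) (x : T) (r : R) : R := fine (ball_int m B h x r).

Section ball_integrals.
Context d (T : measurableType d) (R : realType)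
  (m : {sigma_finite_measure set T -> \bar R}) (dim : R) (B : T -> R -> set T).
Hypothesis bs : ball_space m dim B.
Implicit Types (h f g : T -> R) (x y z : T) (r : R).
Local Open Scope ereal_scope.

Lemma measurable_ball_space x r : measurable (B x r).
Proof.
rewrite (_ : B x r = xsection [set z : T * T | B z.1 r z.2] x).
  by apply: measurable_xsection; exact: ball_measurable_rel bs r.
by apply/seteqP; split => y; rewrite /xsection/= inE.
Qed.

Local Notation ball_int := (ball_int m B).
Local Notation ball_mass := (ball_mass m B).

Lemma ball_int_ge0 h x r : nonneg_measurable h -> 0 <= ball_int h x r.
Proof.
by move=> [_ h0]; rewrite ball_int.unlock integral_ge0// => y _; rewrite lee_fin.
Qed.

Lemma ball_mass_ge0 h x r : nonneg_measurable h -> (0 <= ball_mass h x r)%R.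
Proof. by move=> hh; rewrite ball_mass.unlock fine_ge0// ball_int_ge0. Qed.

Lemma le_ball_int h x y r s : nonneg_measurable h ->
  B x r `<=` B y s -> ball_int h x r <= ball_int h y s.
Proof.
move=> hh xy; rewrite !ball_int.unlock; apply: ge0_subset_integral => //;
  try exact: measurable_ball_space.
  exact: nonneg_measurable_EFin.
by move=> z _; rewrite lee_fin; exact: hh.2.
Qed.

Lemma ball_intE h x r : ball_int h x r =
  \int[m]_y (h y * \1_[set z : T * T | B z.1 r z.2] (x, y))%:E.
Proof.
rewrite ball_int.unlock integral_mkcond; apply: eq_integral => y _.
rewrite patchE indicE; case: ifPn => [|/negP]; rewrite inE => xy.
  by rewrite mem_set// mulr1.
by rewrite memNset// mulr0.
Qed.

Let joint h r := fun z : T * T =>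
  (h z.2 * \1_[set z : T * T | B z.1 r z.2] z)%:E.

Let measurable_joint h r : nonneg_measurable h ->
  measurable_fun setT (joint h r).
Proof.
move=> [mh h0]; apply/measurable_EFinP; apply: measurable_funM.
  exact: (measurableT_comp mh).
by apply: measurable_indic; exact: ball_measurable_rel bs r.
Qed.

Let joint_ge0 h r (z : T * T) : nonneg_measurable h -> 0 <= joint h r z.
Proof. by move=> [mh h0]; rewrite lee_fin mulr_ge0. Qed.

Lemma measurable_ball_int h r : nonneg_measurable h ->
  measurable_fun setT (ball_int h ^~ r).
Proof.
move=> hh; rewrite (_ : ball_int h ^~ r = fubini_F m (joint h r)).
  apply: measurable_fun_fubini_tonelli_F; first exact: measurable_joint.
  by move=> z; exact: joint_ge0.
by apply/funext => x; rewrite ball_intE.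
Qed.

Lemma nonneg_measurable_ball_mass h r : nonneg_measurable h ->
  nonneg_measurable (ball_mass h ^~ r).
Proof.
move=> hh; split; last by move=> x; exact: ball_mass_ge0.
rewrite (_ : ball_mass h ^~ r = fine \o (ball_int h ^~ r)); last first.
  by apply/funext => x; rewrite ball_mass.unlock.
exact: (measurableT_comp (@fine_measurable R setT measurableT)
  (measurable_ball_int r hh)).
Qed.

(** The relation that [z] lies in the ball about [x] is symmetric, so averaging
    over balls is a self-adjoint operation. *)
Lemma ball_int_tonelli f g r : nonneg_measurable f -> nonneg_measurable g ->
  \int[m]_x ((f x)%:E * ball_int g x r) =
  \int[m]_z ((g z)%:E * ball_int f z r).
Proof.
move=> hf hg.
pose F := fun z : T * T => (f z.1)%:E * joint g r z.
have mF : measurable_fun setT F.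
  apply: emeasurable_funM; last exact: measurable_joint.
  by apply/measurable_EFinP; exact: (measurableT_comp hf.1).
have F0 (z : T * T) : 0 <= F z by rewrite mule_ge0 ?joint_ge0// lee_fin; exact: hf.2.
transitivity (\int[m]_x \int[m]_y F (x, y)).
  apply: eq_integral => x _; rewrite ball_intE -ge0_integralZl//.
  - exact: (measurableT_comp (measurable_joint r hg) (measurable_pair1 x)).
  - by move=> y _; exact: joint_ge0.
  - by rewrite lee_fin; exact: hf.2.
rewrite fubini_tonelli//; apply: eq_integral => y _.
rewrite ball_intE -ge0_integralZl//.
- apply: eq_integral => x _; rewrite /F /joint/= -!EFinM; congr EFin.
  rewrite !indicE mulrCA; congr (_ * (_ * _))%R.
  congr (nat_of_bool _)%:R; by apply/idP/idP; rewrite !inE/=; exact: (ball_sym bs).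
- exact: (measurableT_comp (measurable_joint r hf) (measurable_pair1 y)).
- by move=> x _; exact: joint_ge0.
- by rewrite lee_fin; exact: hg.2.
Qed.

Definition locally_integrable h :=
  nonneg_measurable h /\ forall x r, ball_int h x r < +oo.

Lemma ball_massE h x r : locally_integrable h ->
  (ball_mass h x r)%:E = ball_int h x r.
Proof.
by move=> [hh hoo]; rewrite ball_mass.unlock fineK// ge0_fin_numE ?ball_int_ge0.
Qed.

Lemma le_ball_mass h x y r s : locally_integrable h ->
  B x r `<=` B y s -> (ball_mass h x r <= ball_mass h y s)%R.
Proof.
by move=> hh xy; rewrite -lee_fin !ball_massE//; apply: le_ball_int hh.1 xy.
Qed.

Lemma ball_mass_disjoint h x y z r s t : locally_integrable h ->
  B x r `<=` B z t -> B y s `<=` B z t -> B x r `&` B y s = set0 ->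
  (ball_mass h x r + ball_mass h y s <= ball_mass h z t)%R.
Proof.
move=> hh xz yz xy; rewrite -lee_fin EFinD !ball_massE// !ball_int.unlock.
have mB := measurable_ball_space.
rewrite -ge0_integral_setU//.
- apply: ge0_subset_integral => //; first exact: measurableU.
  + exact: nonneg_measurable_EFin hh.1.
  + by move=> w _; rewrite lee_fin; exact: hh.1.2.
  + by rewrite subUset.
- exact: nonneg_measurable_EFin hh.1.
- by move=> w _; rewrite lee_fin; exact: hh.1.2.
- by apply/disj_setPS; rewrite xy.
Qed.

Local Open Scope ring_scope.

(** For [u = w `^ q], [s = w `^ (- p')], [lam = q^-1] and [mu = p'^-1] the upper
    bound is the [A_{p,q}] condition and the lower one is Hoelder's inequality
    for [1 = u `^ lam * s `^ mu]. The relation is symmetric in the two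
    densities, and the whole theory below uses weights through it alone. *)
Definition balanced (u s : T -> R) (lam mu : R) :=
  exists2 C : R, 0 < C & forall x r, 0 < r ->
    C^-1 * r `^ (dim * (lam + mu)) <=
      ball_mass u x r `^ lam * ball_mass s x r `^ mu /\
    ball_mass u x r `^ lam * ball_mass s x r `^ mu <=
      C * r `^ (dim * (lam + mu)).

Lemma balanced_sym u s lam mu : balanced u s lam mu -> balanced s u mu lam.
Proof.
move=> [C C0 h]; exists C => // x r r0.
by rewrite addrC [_ `^ mu * _]mulrC; exact: h.
Qed.

Lemma balanced_gt0 u s lam mu x r : balanced u s lam mu -> 0 < lam ->
  locally_integrable u -> 0 < r -> 0 < ball_mass u x r.
Proof.
move=> [C C0 h] lam0 lu r0; rewrite lt_neqAle (ball_mass_ge0 _ _ lu.1) andbT.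
apply/eqP => u0; have [+ _] := h x r r0.
rewrite -u0 powR0 ?gt_eqF// mul0r leNgt mulr_gt0// ?invr_gt0//.
exact: powR_gt0.
Qed.

Definition doubling (u : T -> R) (D : R) := forall x r, 0 < r ->
  ball_mass u x (2 * r) <= D * ball_mass u x r.

Definition reverse_doubling (u : T -> R) (delta : R) := forall x r, 0 < r ->
  ball_mass u x r <= delta * ball_mass u x (2 * r).

(** Passing from [r] to [2 * r], the product of the two powers grows by a
    bounded factor; as the mass of [s] can only increase, that of [u] grows by a
    bounded factor too. *)
Lemma balanced_doubling u s lam mu : balanced u s lam mu ->
  0 < lam -> 0 < mu -> locally_integrable u -> locally_integrable s ->
  exists2 D : R, 1 <= D & doubling u D.
Proof.
move=> bal lam0 mu0 lu ls; have [C C0 h] := bal.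
pose N := dim * (lam + mu).
exists (Num.max 1 ((C * C * 2 `^ N) `^ lam^-1)); first by rewrite le_max lexx.
move=> x r r0; have r20 : 0 < 2 * r by rewrite mulr_gt0.
have u1 := balanced_gt0 x bal lam0 lu r0.
have u2 := balanced_gt0 x bal lam0 lu r20.
have s1 := balanced_gt0 x (balanced_sym bal) mu0 ls r0.
have s12 : ball_mass s x r <= ball_mass s x (2 * r).
  by apply: le_ball_mass => //; apply: (ball_mono bs); lra.
have [h1 _] := h x r r0; have [_ h2] := h x _ r20.
have key : ball_mass u x (2 * r) `^ lam <=
    (C * C * 2 `^ N) * ball_mass u x r `^ lam.
  have sm0 : 0 < ball_mass s x r `^ mu by exact: powR_gt0.
  rewrite -(ler_pM2r sm0).
  apply: (@le_trans _ _ (ball_mass u x (2 * r) `^ lam * ball_mass s x (2 * r) `^ mu)).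
    rewrite ler_pM2l ?powR_gt0//.
    apply: powR_le_lnonneg.
    exact: ltW.
    exact: ltW.
    exact: s12.
  apply: (le_trans h2); rewrite -/N powRM//; last exact: ltW.
  have h1' : r `^ N <= C * (ball_mass u x r `^ lam * ball_mass s x r `^ mu).
    by rewrite -ler_pdivrMl.
  apply: (@le_trans _ _ (C * (2 `^ N *
      (C * (ball_mass u x r `^ lam * ball_mass s x r `^ mu))))).
    by rewrite ler_pM2l// ler_pM2l ?powR_gt0.
  rewrite le_eqVlt; apply/orP; left; apply/eqP.
  by ring.
have := powR_le_lnonneg (p := lam^-1) _ _ key.
rewrite powR_invK ?gt_eqF//; last exact: ltW.
rewrite invr_ge0 (ltW lam0) powR_ge0 => /(_ isT isT) /le_trans; apply.
rewrite powRM ?powR_ge0// ?powR_invK ?gt_eqF//; last 2 first.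
  exact: ltW.
  by rewrite !mulr_ge0 ?powR_ge0// ltW.
by rewrite ler_pM2r// le_max lexx orbT.
Qed.

(** The ball of radius [2 * r] contains, besides the ball of radius [r], a
    disjoint ball of radius [r / 2], which carries a fixed proportion of the
    mass by doubling. *)
Lemma doubling_reverse u D : locally_integrable u -> 1 <= D -> doubling u D ->
  (forall x r, 0 < r -> 0 < ball_mass u x r) ->
  exists delta : R, [/\ 0 < delta, delta < 1 & reverse_doubling u delta].
Proof.
move=> lu D1 dbl u0; have D0 : 0 < D by lra.
have D3 : 1 <= D ^+ 3 by rewrite exprn_ege1.
exists (1 - (2 * D ^+ 3)^-1); split.
- by rewrite subr_gt0 invf_lt1; lra.
- by rewrite gtrDl oppr_lt0 invr_gt0; lra.
move=> x r r0; have [y [yx xy0 xy]] := ball_annulus bs x r0.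
have r2 : 0 < r / 2 by lra.
have := ball_mass_disjoint lu _ yx xy0.
have xx : B x r `<=` B x (2 * r) by apply: (ball_mono bs); lra.
move=> /(_ xx).
suff : ball_mass u x (2 * r) / (2 * D ^+ 3) <= ball_mass u y (r / 2) by lra.
rewrite ler_pdivrMr; last lra.
apply: (le_trans (le_ball_mass lu xy)).
have e4 : 4 * r = 2 * (2 * (2 * (r / 2))) by field.
have d1 := dbl y _ r2.
have r20 : 0 < 2 * (r / 2) by lra.
have d2 := dbl y _ r20.
have r40 : 0 < 2 * (2 * (r / 2)) by lra.
have d3 := dbl y _ r40.
have v0 := u0 y _ r2.
rewrite e4; apply: (le_trans d3).
apply: (@le_trans _ _ (D * (D * (D * ball_mass u y (r / 2))))).
  rewrite ler_pM2l//; apply: (le_trans d2); rewrite ler_pM2l//.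
rewrite (_ : D * (D * (D * _)) = ball_mass u y (r / 2) * D ^+ 3); last by ring.
rewrite ler_pM2l//; lra.
Qed.

Local Open Scope ereal_scope.

Lemma le_ball_int_fun f g x r : nonneg_measurable f -> nonneg_measurable g ->
  (forall y, B x r y -> f y <= g y)%R -> ball_int f x r <= ball_int g x r.
Proof.
move=> hf hg fg; rewrite !ball_int.unlock; apply: ge0_le_integral.
- exact: measurable_ball_space.
- by move=> y _; rewrite lee_fin; exact: hf.2.
- exact: nonneg_measurable_EFin.
- exact: nonneg_measurable_EFin.
- by move=> y xy; rewrite lee_fin; exact: fg.
Qed.

Lemma ball_intZ f x r (c : R) : nonneg_measurable f -> (0 <= c)%R ->
  ball_int (fun y => c * f y)%R x r = c%:E * ball_int f x r.
Proof.
move=> hf c0; rewrite !ball_int.unlock -ge0_integralZl//.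
- exact: measurable_ball_space.
- exact: nonneg_measurable_EFin.
- by move=> y _; rewrite lee_fin; exact: hf.2.
Qed.

Lemma ball_int_add f g x r : nonneg_measurable f -> nonneg_measurable g ->
  ball_int (fun y => f y + g y)%R x r = ball_int f x r + ball_int g x r.
Proof.
move=> hf hg; rewrite !ball_int.unlock -ge0_integralD//.
- exact: measurable_ball_space.
- by move=> y _; rewrite lee_fin; exact: hf.2.
- exact: nonneg_measurable_EFin.
- by move=> y _; rewrite lee_fin; exact: hg.2.
- exact: nonneg_measurable_EFin.
Qed.

Lemma ball_int1 x r : ball_int (fun=> 1%R) x r = m (B x r).
Proof.
rewrite ball_int.unlock integral_cst ?mul1e//; exact: measurable_ball_space.
Qed.

End ball_integrals.

(** * A Carleson embedding *)

Section embedding.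
Context d (T : measurableType d) (R : realType)
  (m : {sigma_finite_measure set T -> \bar R}) (dim : R) (B : T -> R -> set T).
Hypothesis bs : ball_space m dim B.
Implicit Types (F s : T -> R) (x y z : T) (r : R).
Local Notation ball_int := (ball_int m B).
Local Notation ball_mass := (ball_mass m B).
Local Notation locally_integrable := (locally_integrable m B).

Lemma ball_int_le_Lp F s (p P : R) x r : 1 < p -> 0 < P ->
  nonneg_measurable F -> locally_integrable s ->
  (\int[m]_y (F y `^ p * s y)%:E <= (P `^ p)%:E)%E ->
  (ball_int (fun y => F y * s y)%R x r <=
    (P * ball_mass s x r `^ (1 - p^-1))%:E)%E.
Proof.
move=> p1 P0 hF ls FP; have p0 : 0 < p by lra.
have q0 : 0 < 1 - p^-1 by rewrite subr_gt0 invf_lt1//.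
have hFp := nonneg_measurable_powR p hF.
have hX := nonneg_measurableM hFp ls.1.
have mB := measurable_ball_space bs x r.
rewrite EFinM -poweR_EFin ball_massE// !ball_int.unlock.
rewrite (eq_integral (fun y => ((F y `^ p * s y) `^ p^-1 * s y `^ (1 - p^-1))%:E)); last first.
  move=> y _; congr EFin.
  have F0 := hF.2 y; have s0 := ls.1.2 y.
  rewrite powRM ?powR_ge0// powR_invK ?gt_eqF// -mulrA.
  have [->|sn0] := eqVneq (s y) 0; first by rewrite powR0 ?gt_eqF ?invr_gt0// mul0r.
  rewrite -powRDg; last by rewrite lt_neqAle eq_sym sn0.
  by rewrite subrKC powRr1.
have pV0 : 0 < p^-1 by rewrite invr_gt0.
have e1 : p^-1 + (1 - p^-1) = 1 by rewrite subrKC.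
have H := hoelder_geometric m mB hX.1 ls.1.1 hX.2 ls.1.2 pV0 q0 e1.
apply: (le_trans H).
apply: lee_wpmul2r; first exact: poweR_ge0.
rewrite -[leRHS](_ : ((P `^ p)%:E `^ p^-1)%E = _); last first.
  by rewrite poweR_EFin powR_invK ?gt_eqF// ltW.
apply: gt0_ler_poweR.
- by rewrite invr_ge0 ltW.
- rewrite in_itv/= leey andbT; apply: integral_ge0 => y _.
  by rewrite lee_fin; exact: hX.2.
- by rewrite in_itv/= leey andbT lee_fin powR_ge0.
apply: le_trans FP; apply: ge0_subset_integral => //.
  exact: nonneg_measurable_EFin.
by move=> y _; rewrite lee_fin; exact: hX.2.
Qed.

Lemma Lp_locally_integrable F s (p P : R) : 1 < p -> 0 < P ->
  nonneg_measurable F -> locally_integrable s ->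
  (\int[m]_y (F y `^ p * s y)%:E <= (P `^ p)%:E)%E ->
  locally_integrable (fun y => F y * s y).
Proof.
move=> p1 P0 hF ls FP; split; first exact: nonneg_measurableM hF ls.1.
by move=> x r; rewrite (le_lt_trans (ball_int_le_Lp x r p1 P0 hF ls FP))// ltry.
Qed.

(** Here [A / S] is the average of [F] over a ball of mass [S], and [v] the mass
    of a neighbouring ball. Where [F] is at least half the average, a power of
    the average is bounded in two ways, by [F] itself and by the [L^p] bound
    [A <= P * S `^ be]; the minimum of the two is what can be summed over the
    scales. *)
Let weight_le (S v A F P D be eta st : R) : 0 < S -> 0 < v -> 0 <= A -> 0 <= F ->
  0 < P -> 1 <= D -> 0 < be -> 0 < eta -> 1 < st -> be * st = st - 1 - eta ->
  S <= D * v -> v <= D * S -> be <= 1 ->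
  A <= P * S `^ be -> A <= 2 * F * S ->
  S `^ (- (be * st)) * A `^ (st - 1) <= D `^ (eta + 1) *
    Num.min ((2 * F) `^ (st - 1) * v `^ eta) (P `^ (st - 1) * v `^ (- be)).
Proof.
move=> S0 v0 A0 F0 P0 D1 be0 eta0 st1 bst Sv vS be1 AP AF.
have D0 : 0 < D by lra. have st0 : 0 <= st - 1 by lra.
rewrite minr_pMr; last exact: powR_ge0.
rewrite le_min; apply/andP; split.
  have h : A `^ (st - 1) <= (2 * F) `^ (st - 1) * S `^ (st - 1).
    rewrite -powRM ?mulr_ge0//; last exact: ltW.
    exact: powR_le_lnonneg.
  apply: (le_trans (ler_wpM2l (powR_ge0 _ _) h)).
  rewrite mulrCA -powRDg// bst (_ : - (st - 1 - eta) + (st - 1) = eta); last by ring.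
  rewrite [leRHS]mulrCA ler_wpM2l ?powR_ge0//.
  apply: (@le_trans _ _ ((D * v) `^ eta)).
    by apply: powR_le_lnonneg => //; exact: ltW.
  rewrite powRM; [|exact: ltW|exact: ltW].
  apply: ler_wpM2r; first exact: powR_ge0.
  by apply: ler_powR => //; lra.
have h : A `^ (st - 1) <= P `^ (st - 1) * S `^ (be * (st - 1)).
  rewrite powRrM -powRM ?powR_ge0//; last exact: ltW.
  exact: powR_le_lnonneg.
apply: (le_trans (ler_wpM2l (powR_ge0 _ _) h)).
rewrite mulrCA -powRDg// (_ : - (be * st) + be * (st - 1) = - be); last by ring.
rewrite [leRHS]mulrCA ler_wpM2l ?powR_ge0//.
apply: (@le_trans _ _ ((v / D) `^ (- be))).
  apply: powR_le_lneg; first by rewrite oppr_le0 ltW.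
  - by rewrite divr_gt0.
  - by rewrite ler_pdivrMr// mulrC.
rewrite powRM; [|exact: ltW|by rewrite invr_ge0 ltW].
rewrite mulrC; apply: ler_wpM2r; first exact: powR_ge0.
rewrite -powR_inv1; last exact: ltW.
by rewrite -powRrM mulN1r opprK; apply: ler_powR => //; lra.
Qed.

Section fixed_density.
Context (s : T -> R) (D delta p eta : R).
Hypotheses (ls : locally_integrable s) (D1 : 1 <= D)
  (dbl : doubling m B s D) (s_gt0 : forall x r, 0 < r -> 0 < ball_mass s x r)
  (p1 : 1 < p) (eta0 : 0 < eta).
Local Notation st := (p * (1 + eta)).

(** As a function of the mass of the ball, hence of [r], the minimum of an
    increasing and a decreasing power. *)
Definition peak F (P : R) r x : R :=
  Num.min ((2 * F x) `^ (st - 1) * ball_mass s x r `^ eta)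
          (P `^ (st - 1) * ball_mass s x r `^ (- (1 - p^-1))).

Lemma nonneg_measurable_peak F P r : nonneg_measurable F ->
  nonneg_measurable (peak F P r).
Proof.
move=> hF.
have hv := nonneg_measurable_ball_mass bs r ls.1.
have h1 : nonneg_measurable
    (fun x => (2 * F x) `^ (st - 1) * ball_mass s x r `^ eta).
  apply: nonneg_measurableM; apply: nonneg_measurable_powR => //.
  by apply: nonneg_measurableM => //; exact: nonneg_measurable_cst.
have h2 : nonneg_measurable
    (fun x => P `^ (st - 1) * ball_mass s x r `^ (- (1 - p^-1))).
  apply: nonneg_measurableM; last exact: nonneg_measurable_powR.
  exact: nonneg_measurable_cst (powR_ge0 _ _).
split; first exact: measurable_minr h1.1 h2.1.
by move=> x; rewrite /peak le_min h1.2 h2.2.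
Qed.

(** At most half of the integral of [F] over the ball comes from the points
    where [F] is below half its average; that part is absorbed into the left
    hand side, and at the other points [weight_le] applies. *)
Lemma average_le_peak F (P : R) z r : 0 < P -> nonneg_measurable F -> 0 < r ->
  (\int[m]_y (F y `^ p * s y)%:E <= (P `^ p)%:E)%E ->
  (((ball_mass s z r `^ (- (1 - p^-1)) *
     ball_mass (fun y => F y * s y) z r) `^ st)%:E <=
   (2 * D `^ (eta + 1))%:E *
     ball_int (fun y => F y * s y * peak F P r y)%R z r)%E.
Proof.
move=> P0 hF r0 FP.
have lF := Lp_locally_integrable p1 P0 hF ls FP.
have hpk := nonneg_measurable_peak P r hF.
have hFp := nonneg_measurableM lF.1 hpk.
have p0 : 0 < p := lt_trans ltr01 p1.
set be := 1 - p^-1.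
have pV1 : p^-1 < 1 by rewrite invf_lt1.
have pV0 : 0 < p^-1 by rewrite invr_gt0.
have be0 : 0 < be by rewrite /be; lra.
have be1 : be <= 1 by rewrite /be; lra.
have st1 : 1 < st by rewrite -[ltLHS]mulr1 ltr_pM ?ler01// ltrDl.
have bst : be * st = st - 1 - eta by rewrite /be; field; rewrite gt_eqF.
have S0 := s_gt0 z r0; set S := ball_mass s z r in S0 *.
have A0 := ball_mass_ge0 m B z r lF.1.
have AP : ball_mass (fun y => F y * s y) z r <= P * S `^ be.
  by rewrite -lee_fin ball_massE//; exact: ball_int_le_Lp.
set A := ball_mass _ z r in A0 AP *.
pose W := S `^ (- (be * st)) * A `^ (st - 1).
have W0 : 0 <= W by rewrite mulr_ge0 ?powR_ge0.
have WA : (S `^ (- be) * A) `^ st = W * A.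
  rewrite powRM ?powR_ge0// -powRrM mulNr -mulrA; congr (_ * _).
  by rewrite [RHS]mulrC mulr_powRB1// (lt_trans ltr01 st1).
have D0 : 0 < D := lt_le_trans ltr01 D1.
have Dp : 0 <= D `^ (eta + 1) by exact: powR_ge0.
have key y : B z r y -> W * (F y * s y) <=
    W * (A / (2 * S)) * s y + D `^ (eta + 1) * (F y * s y * peak F P r y).
  move=> zy; have Fy := hF.2 y; have sy := ls.1.2 y; have pky := hpk.2 y.
  (* below half the average the first summand suffices, above it the second *)
  have [FA|FA] := leP (F y) (A / (2 * S)).
    rewrite -mulrA; apply: (@le_trans _ _ (W * (A / (2 * S) * s y))).
      by apply: ler_wpM2l => //; exact: ler_wpM2r.
    by rewrite lerDl mulr_ge0// mulr_ge0// mulr_ge0.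
  apply: (@le_trans _ _ (D `^ (eta + 1) * (F y * s y * peak F P r y))); last first.
    by rewrite lerDr mulr_ge0// mulr_ge0// divr_ge0// mulr_ge0// ltW.
  rewrite [leRHS](_ : _ = D `^ (eta + 1) * peak F P r y * (F y * s y)); last first.
    by move: (peak F P r y) (D `^ _) => a b; ring.
  apply: ler_wpM2r; first exact: mulr_ge0.
  have yz := ball_sym bs zy.
  have r2 : r + r = 2 * r by ring.
  apply: weight_le => //.
  - exact: s_gt0.
  - apply: (le_trans _ (dbl y r0)); apply: (le_ball_mass bs ls).
    by rewrite -r2; exact: (ball_tri bs).
  - apply: (le_trans _ (dbl z r0)); apply: (le_ball_mass bs ls).
    by rewrite -r2; exact: (ball_tri bs).
  - have : A / (2 * S) * (2 * S) <= F y * (2 * S).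
      by apply: ler_wpM2r; [rewrite mulr_ge0// ltW|exact: ltW].
    rewrite divfK ?gt_eqF ?mulr_gt0//.
    by move/le_trans; apply; rewrite mulrA [F y * 2]mulrC.
rewrite WA.
have hc (c : R) : 0 <= c -> nonneg_measurable (fun _ : T => c).
  by move=> c0; exact: nonneg_measurable_cst.
have c1 : 0 <= W * (A / (2 * S)) by rewrite mulr_ge0// divr_ge0// mulr_ge0// ltW.
have h1 := nonneg_measurableM (hc _ W0) lF.1.
have h2 := nonneg_measurableM (hc _ c1) ls.1.
have h3 := nonneg_measurableM (hc _ Dp) hFp.
have h23 : nonneg_measurable (fun y => W * (A / (2 * S)) * s y +
    D `^ (eta + 1) * (F y * s y * peak F P r y)).
  split; first exact: measurable_funD h2.1 h3.1.
  by move=> y; rewrite addr_ge0// ?h2.2 ?h3.2.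
have := le_ball_int_fun bs h1 h23 key.
rewrite (ball_int_add bs _ _ h2 h3) (ball_intZ bs _ _ lF.1)// (ball_intZ bs _ _ ls.1)//.
rewrite (ball_intZ bs _ _ hFp)// -(ball_massE z r lF) -(ball_massE z r ls).
rewrite -/A -/S -!EFinM.
rewrite (_ : W * (A / (2 * S)) * S = W * A / 2); last by field; rewrite gt_eqF.
have := ball_int_ge0 m B z r hFp.
move: (ball_int (fun y => F y * s y * peak F P r y) z r) => [X| |]//=.
  by rewrite -!EFinM -EFinD !lee_fin; lra.
move=> _ _; rewrite gt0_muley ?leey// lte_fin mulr_gt0//.
exact: powR_gt0.
Qed.

Hypotheses (delta0 : 0 < delta) (delta1 : delta < 1)
  (rev : reverse_doubling m B s delta).

(** At a fixed point the masses of the balls of radii [2 ^+ k * rho] grow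
    geometrically by reverse doubling, so that [sum_peak] applies; the exponents
    are such that the peak is a multiple of [F x `^ (p - 1)]. *)
Lemma sum_peak_le : exists2 C : R, 0 < C &
  forall F (P rho : R) (M : nat) x, nonneg_measurable F -> 0 < P -> 0 < rho ->
    \sum_(k < M) F x * s x * peak F P (2 ^+ k * rho) x <=
    C * P `^ (p * eta) * (F x `^ p * s x).
Proof.
have p0 : 0 < p := lt_trans ltr01 p1.
have be0 : 0 < 1 - p^-1 by rewrite subr_gt0 invf_lt1.
have [C C0 hC] := sum_peak eta0 be0 delta0 delta1.
exists (C * 2 `^ (p - 1)); first by rewrite mulr_gt0 ?powR_gt0.
move=> F P rho M x hF P0 rho0.
have s0 := ls.1.2 x.
have [F0|Fn0] := eqVneq (F x) 0.
  rewrite F0 powR0 ?gt_eqF// mul0r mulr0 big1// => k _.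
  by rewrite !mul0r.
have F0 : 0 < F x by rewrite lt_neqAle eq_sym Fn0 hF.2.
pose v k := ball_mass s x (2 ^+ k * rho).
have v0 k : 0 < v k by apply: s_gt0; rewrite mulr_gt0// exprn_gt0.
have vS k : v k <= delta * v k.+1.
  have := rev x (_ : 0 < 2 ^+ k * rho).
  by rewrite mulrA -exprS; apply; rewrite mulr_gt0// exprn_gt0.
have c0 : 0 < (2 * F x) `^ (st - 1) by rewrite powR_gt0// mulr_gt0.
have d0 : 0 < P `^ (st - 1) by rewrite powR_gt0.
have := hC _ _ v M c0 d0 v0 vS.
rewrite -mulr_sumr => h.
have e0 : eta + (1 - p^-1) != 0 by rewrite gt_eqF// addr_gt0.
have cancel (a b c : R) : a != 0 -> c * a * (b / a) = c * b.
  by move=> a0; field.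
have st1E : st - 1 = p * (eta + (1 - p^-1)) by field; rewrite gt_eqF.
have e1 : (st - 1) * ((1 - p^-1) / (eta + (1 - p^-1))) = p - 1.
  by rewrite st1E cancel//; field; rewrite gt_eqF.
have e2 : (st - 1) * (eta / (eta + (1 - p^-1))) = p * eta.
  by rewrite st1E cancel.
move: h; rewrite -!powRrM e1 e2 [(2 * F x) `^ (p - 1)]powRM//; last exact: ltW.
move=> h.
apply: (le_trans (ler_wpM2l _ h)); first by rewrite mulr_ge0// ltW.
rewrite -(mulr_powRB1 (ltW F0) p0).
rewrite le_eqVlt; apply/orP; left; apply/eqP.
by move: (F x) (s x) (2 `^ (p - 1)) (F x `^ (p - 1)) (P `^ (p * eta)) => a b c e f; ring.
Qed.

(** The exponent [p * (1 + eta)] exceeds [p], which makes the powers of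
    averages summable over all scales at once: after [average_le_peak] and an
    exchange of integrals, the sum over the scales is carried out pointwise by
    [sum_peak_le], without a maximal function. *)
Lemma carleson_embedding : exists2 C : R, 0 < C &
  forall F (P rho : R) (M : nat), nonneg_measurable F -> 0 < P -> 0 < rho ->
    (\int[m]_y (F y `^ p * s y)%:E <= (P `^ p)%:E)%E ->
    (\sum_(k < M) (((2 ^+ k * rho) `^ (- dim))%:E *
      \int[m]_z ((ball_mass s z (2 ^+ k * rho) `^ (- (1 - p^-1)) *
        ball_mass (fun y => F y * s y) z (2 ^+ k * rho)) `^ st)%:E)
    <= (C * P `^ st)%:E)%E.
Proof.
have [c c0 vol] := ball_volume bs.
have [C C0 hC] := sum_peak_le.
pose K := 2 * D `^ (eta + 1) * c.
have D0 : 0 < D := lt_le_trans ltr01 D1.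
have K0 : 0 < K by rewrite !mulr_gt0// powR_gt0.
exists (K * C); first exact: mulr_gt0.
move=> F P rho M hF P0 rho0 FP.
have lF := Lp_locally_integrable p1 P0 hF ls FP.
pose G k := fun y => F y * s y * peak F P (2 ^+ k * rho) y.
have hG k : nonneg_measurable (G k).
  by apply: nonneg_measurableM; [exact: lF.1|exact: nonneg_measurable_peak].
have G0 k x : (0 <= (G k x)%:E)%E by rewrite lee_fin; exact: (hG k).2.
have mG k : measurable_fun setT (fun x => (G k x)%:E).
  exact: nonneg_measurable_EFin.
have term r : 0 < r -> ((r `^ (- dim))%:E *
      \int[m]_z ((ball_mass s z r `^ (- (1 - p^-1)) *
        ball_mass (fun y => F y * s y) z r) `^ st)%:E
    <= K%:E * \int[m]_x (F x * s x * peak F P r x)%:E)%E.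
  move=> r0; pose g y := F y * s y * peak F P r y.
  have hg : nonneg_measurable g.
    by apply: nonneg_measurableM; [exact: lF.1|exact: nonneg_measurable_peak].
  have mg : measurable_fun setT (fun x => (g x)%:E) by exact: nonneg_measurable_EFin.
  have g0 x : (0 <= (g x)%:E)%E by rewrite lee_fin; exact: hg.2.
  have hS := nonneg_measurable_ball_mass bs r ls.1.
  have hA := nonneg_measurable_ball_mass bs r lF.1.
  have hSA := nonneg_measurable_powR st
    (nonneg_measurableM (nonneg_measurable_powR (- (1 - p^-1)) hS) hA).
  have D20 : 0 <= 2 * D `^ (eta + 1) by rewrite mulr_ge0// powR_ge0.
  have mgi := measurable_ball_int bs r hg.
  have gi0 x : (0 <= ball_int g x r)%E by exact: ball_int_ge0.
  apply: (@le_trans _ _ ((r `^ (- dim))%:E *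
      ((2 * D `^ (eta + 1))%:E * \int[m]_z ball_int g z r))%E).
    apply: lee_wpmul2l; first by rewrite lee_fin powR_ge0.
    rewrite -ge0_integralZl//; apply: ge0_le_integral => //.
    - by move=> z _; rewrite lee_fin; exact: hSA.2.
    - exact: nonneg_measurable_EFin hSA.
    - exact: measurable_funeM.
    - by move=> z _; exact: average_le_peak.
  have tonelli : (\int[m]_z ball_int g z r <= (c * r `^ dim)%:E * \int[m]_x (g x)%:E)%E.
    have h1 : nonneg_measurable (fun _ : T => 1 : R) by exact: nonneg_measurable_cst.
    have := ball_int_tonelli bs r h1 hg.
    under eq_integral do rewrite mul1e.
    move=> ->; rewrite -ge0_integralZl//; last by rewrite lee_fin mulr_ge0 ?powR_ge0// ltW.
    apply: ge0_le_integral => //.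
    - by move=> z _; rewrite mule_ge0// ball_int_ge0.
    - by apply: emeasurable_funM => //; exact: (measurable_ball_int bs r h1).
    - exact: measurable_funeM.
    - move=> z _; rewrite (ball_int1 bs) muleC; apply: lee_wpmul2r => //.
      by have /andP[] := vol z r r0.
  apply: (@le_trans _ _ ((r `^ (- dim))%:E * ((2 * D `^ (eta + 1))%:E *
      ((c * r `^ dim)%:E * \int[m]_x (g x)%:E)))%E).
    apply: lee_wpmul2l; first by rewrite lee_fin powR_ge0.
    by apply: lee_wpmul2l => //; rewrite lee_fin.
  rewrite !muleA -!EFinM powRN; apply: lee_wpmul2r; first exact: integral_ge0.
  rewrite lee_fin /K; have rd0 : 0 < r `^ dim by exact: powR_gt0.
  move: (r `^ dim) (D `^ (eta + 1)) rd0 => a b a0.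
  by rewrite [leLHS](_ : _ = 2 * b * c)//; field; rewrite gt_eqF.
apply: (@le_trans _ _ (\sum_(k < M) (K%:E * \int[m]_x (G k x)%:E))%E).
  by apply: lee_sum => k _; apply: term; rewrite mulr_gt0// exprn_gt0.
rewrite -ge0_sume_distrr; last by move=> k _; exact: integral_ge0.
rewrite -(@ge0_integral_sum _ _ _ m setT measurableT _ (fun (k : 'I_M) x => (G k x)%:E)).
- rewrite (_ : (K * C * _)%:E = K%:E * (C * P `^ st)%:E)%E; last by rewrite -EFinM mulrA.
  apply: lee_wpmul2l; first by rewrite lee_fin ltW.
  have hFp := nonneg_measurableM (nonneg_measurable_powR p hF) ls.1.
  have Fp0 x : (0 <= (F x `^ p * s x)%:E)%E by rewrite lee_fin; exact: hFp.2.
  have mFp : measurable_fun setT (fun x => (F x `^ p * s x)%:E).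
    exact: nonneg_measurable_EFin hFp.
  have CP0 : 0 <= C * P `^ (p * eta) by rewrite mulr_ge0 ?powR_ge0// ltW.
  apply: (@le_trans _ _ ((C * P `^ (p * eta))%:E * \int[m]_x (F x `^ p * s x)%:E)%E).
    rewrite -ge0_integralZl//; apply: ge0_le_integral => //.
    + by move=> x _; apply: sume_ge0 => k _; exact: G0.
    + by apply: emeasurable_sum => k; exact: mG.
    + exact: measurable_funeM.
    + by move=> x _; rewrite sumEFin -EFinM lee_fin; exact: hC.
  apply: (@le_trans _ _ ((C * P `^ (p * eta))%:E * (P `^ p)%:E)%E).
    by apply: lee_wpmul2l => //; rewrite lee_fin.
  rewrite -EFinM lee_fin -mulrA -powRDg//.
  by rewrite (_ : p * eta + p = st)//; ring.
- by move=> k; exact: mG.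
- by move=> k x _; exact: G0.
Qed.

End fixed_density.
End embedding.

(** * The strong-type estimate for dyadic potentials *)

Section strong_type.
Context d (T : measurableType d) (R : realType)
  (m : {sigma_finite_measure set T -> \bar R}) (dim : R) (B : T -> R -> set T).
Hypothesis bs : ball_space m dim B.
Implicit Types (F g h : T -> R) (x y z : T) (r : R).
Local Notation ball_int := (ball_int m B).
Local Notation ball_mass := (ball_mass m B).
Local Notation locally_integrable := (locally_integrable m B).

(** Up to constants, the convolution of [h] with the part of the kernel
    [|x - y| ^ (- N)] between the distances [rho] and [2 ^ M * rho], together
    with a bounded part below [rho]. *)
Definition dyadic_potential (N : R) h (rho : R) (M : nat) x : R :=
  \sum_(k < M) (2 ^+ k * rho) `^ (- N) * ball_mass h x (2 ^+ k * rho).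

Lemma nonneg_measurable_dyadic_potential N h rho M : nonneg_measurable h ->
  nonneg_measurable (dyadic_potential N h rho M).
Proof.
move=> hh; split.
  apply: measurable_sum => k; apply: measurable_funM => //.
  exact: (nonneg_measurable_ball_mass bs _ hh).1.
move=> x; apply: sumr_ge0 => k _; rewrite mulr_ge0 ?powR_ge0//.
exact: ball_mass_ge0.
Qed.

(** Averaging the mass over the ball itself turns it into masses of balls with
    a free centre. *)
Lemma ball_mass_le_average : exists2 c : R, 0 < c & forall h x r,
  locally_integrable h -> 0 < r ->
  ((ball_mass h x r)%:E <= (c * r `^ (- dim))%:E *
    ball_int (ball_mass h ^~ (2 * r)%R) x r)%E.
Proof.
have [c c0 vol] := ball_volume bs; exists c => // h x r lh r0.
have hA := nonneg_measurable_ball_mass bs (2 * r) lh.1.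
have M0 : 0 <= ball_mass h x r by apply: ball_mass_ge0; exact: lh.1.
have hM : nonneg_measurable (fun _ : T => ball_mass h x r * 1).
  by apply: nonneg_measurable_cst; rewrite mulr1.
have h1 : nonneg_measurable (fun _ : T => 1 : R) by exact: nonneg_measurable_cst.
have le y : B x r y -> ball_mass h x r * 1 <= ball_mass h y (2 * r).
  move=> xy; rewrite mulr1; apply: (le_ball_mass bs lh).
  rewrite (_ : 2 * r = r + r); last by ring.
  by apply: (ball_tri bs); exact: (ball_sym bs).
have := le_ball_int_fun bs hM hA le.
rewrite (ball_intZ bs x r h1 M0) (ball_int1 bs) => H.
have /andP[v1 _] := vol x r r0.
have rd0 : 0 < r `^ dim by exact: powR_gt0.
apply: (@le_trans _ _ ((c * r `^ (- dim))%:E *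
   ((ball_mass h x r)%:E * (c^-1 * r `^ dim)%:E))%E).
  rewrite -!EFinM lee_fin powRN; move: (r `^ dim) rd0 => b b0.
  by rewrite [leRHS](_ : _ = ball_mass h x r)//; field; rewrite !gt_eqF.
apply: lee_wpmul2l; first by rewrite lee_fin mulr_ge0 ?powR_ge0// ltW.
by apply: le_trans H; apply: lee_wpmul2l; rewrite ?lee_fin.
Qed.

(* [p' = (1 - lam)^-1] is conjugate to the exponent [lam^-1] of the target. *)
Context (u s : T -> R) (lam mu p p' : R).
Hypotheses (lu : locally_integrable u) (ls : locally_integrable s)
  (bal : balanced m dim B u s lam mu).
Hypotheses (p1 : 1 < p) (p'1 : 1 < p') (muE : mu = 1 - p^-1)
  (lamE : lam = 1 - p'^-1) (lammu : lam + mu < 1).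
Local Notation eta := (1 - lam - mu).
Local Notation N := (dim * (lam + mu)).

Let p0 : 0 < p. Proof. exact: lt_trans ltr01 p1. Qed.
Let p'0 : 0 < p'. Proof. exact: lt_trans ltr01 p'1. Qed.
Let mu0 : 0 < mu. Proof. by rewrite muE subr_gt0 invf_lt1. Qed.
Let lam0 : 0 < lam. Proof. by rewrite lamE subr_gt0 invf_lt1. Qed.
Let eta0 : 0 < eta. Proof. by have h := lammu; lra. Qed.

(* Both densities are doubling and reverse doubling, so that the embedding holds
   for either of them. *)
Let embedding (v v' : T -> R) (e e' t : R) : balanced m dim B v' v e' e ->
  locally_integrable v -> locally_integrable v' -> 0 < e -> 0 < e' -> 1 < t ->
  e = 1 - t^-1 ->
  exists2 C : R, 0 < C &
  forall F (P rho : R) (M : nat), nonneg_measurable F -> 0 < P -> 0 < rho ->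
    (\int[m]_y (F y `^ t * v y)%:E <= (P `^ t)%:E)%E ->
    (\sum_(k < M) (((2 ^+ k * rho) `^ (- dim))%:E *
      \int[m]_z ((ball_mass v z (2 ^+ k * rho) `^ (- e) *
        ball_mass (fun y => F y * v y) z (2 ^+ k * rho)) `^ (t * (1 + eta)))%:E)
    <= (C * P `^ (t * (1 + eta)))%:E)%E.
Proof.
move=> b lv lv' e0 e'0 t1 ->.
have bv := balanced_sym b.
have [D D1 dbl] := balanced_doubling bs bv e0 e'0 lv lv'.
have v0 x r : 0 < r -> 0 < ball_mass v x r by move=> r0; exact: balanced_gt0 bv _ _ _.
have [delta [d0 d1 rev]] := doubling_reverse bs lv D1 dbl v0.
exact: (carleson_embedding bs lv D1 dbl v0 t1 eta0 d0 d1 rev).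
Qed.

Local Notation st := (p * (1 + eta)).
Local Notation tt := (p' * (1 + eta)).

Let st1 : 1 < st.
Proof. by rewrite -[ltLHS]mulr1 ltr_pM ?ler01// ltrDl. Qed.
Let tt1 : 1 < tt.
Proof. by rewrite -[ltLHS]mulr1 ltr_pM ?ler01// ltrDl. Qed.
Let st_conj : st^-1 + tt^-1 = 1.
Proof.
have e : p^-1 + p'^-1 = 1 + eta by rewrite muE lamE; ring.
have e0 : 1 + eta != 0 by rewrite gt_eqF// addr_gt0.
by rewrite !invfM -mulrDl e mulfV.
Qed.

(** At a scale [r], averaging over the centre bounds the pairing by the integral
    over [z] of the product of the masses of [F * s] and [g * u] in the ball of
    radius [2 * r] about [z]. Balance distributes the power of [r] over the two
    masses as [ball_mass s ^ (- mu)] and [ball_mass u ^ (- lam)], and Young's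
    inequality separates the factors. Its exponents [p * (1 + eta)] and
    [p' * (1 + eta)] are conjugate since [p^-1 + p'^-1 = 1 + eta], and they are
    those of the embedding, which then sums the scales for [s] and for [u]. *)
Lemma bilinear_estimate : exists2 C : R, 0 < C &
  forall F g (P Q rho : R) (M : nat), nonneg_measurable F ->
    nonneg_measurable g -> 0 < P -> 0 < Q -> 0 < rho ->
    (\int[m]_y (F y `^ p * s y)%:E <= (P `^ p)%:E)%E ->
    (\int[m]_y (g y `^ p' * u y)%:E <= (Q `^ p')%:E)%E ->
    (\int[m]_x (g x * u x *
       dyadic_potential N (fun y => F y * s y) rho M x)%:E <= (C * P * Q)%:E)%E.
Proof.
have [c c0 avg] := ball_mass_le_average.
have [C1 C10 emb_s] := embedding bal ls lu mu0 lam0 p1 muE.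
have [C2 C20 emb_u] := embedding (balanced_sym bal) lu ls lam0 mu0 p'1 lamE.
have [C C0 hbal] := bal.
pose K := c * 2 `^ dim * 2 `^ N * C.
have K0 : 0 < K by rewrite !mulr_gt0// powR_gt0.
pose C' := C1 + C2; have C'0 : 0 < C' by rewrite addr_gt0.
exists (K * C' * 2); first by rewrite !mulr_gt0.
move=> F g P Q rho M hF hg P0 Q0 rho0 FP gQ.
have lFs := Lp_locally_integrable bs p1 P0 hF ls FP.
have lgu := Lp_locally_integrable bs p'1 Q0 hg lu gQ.
set h := fun y => F y * s y in lFs *; set k := fun y => g y * u y in lgu *.
(* one scale [l] for all radii, as in [young_optimal] *)
have [l l0 lE] := young_optimal st1 tt1 st_conj P0 Q0.
pose X r z := (ball_mass s z r `^ (- mu) * ball_mass h z r) `^ st.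
pose Y r z := (ball_mass u z r `^ (- lam) * ball_mass k z r) `^ tt.
have hX r : nonneg_measurable (X r).
  apply/nonneg_measurable_powR/nonneg_measurableM.
    exact/nonneg_measurable_powR/(nonneg_measurable_ball_mass bs r ls.1).
  exact: (nonneg_measurable_ball_mass bs r lFs.1).
have hY r : nonneg_measurable (Y r).
  apply/nonneg_measurable_powR/nonneg_measurableM.
    exact/nonneg_measurable_powR/(nonneg_measurable_ball_mass bs r lu.1).
  exact: (nonneg_measurable_ball_mass bs r lgu.1).
have mX r : measurable_fun setT (fun z => (X r z)%:E).
  exact: nonneg_measurable_EFin.
have mY r : measurable_fun setT (fun z => (Y r z)%:E).
  exact: nonneg_measurable_EFin.
have X0 r z : (0 <= (X r z)%:E)%E by rewrite lee_fin; exact: (hX r).2.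
have Y0 r z : (0 <= (Y r z)%:E)%E by rewrite lee_fin; exact: (hY r).2.
have one r : 0 < r ->
  (\int[m]_x (k x * (r `^ (- N) * ball_mass h x r))%:E <=
   (K * l `^ st)%:E * (((2 * r) `^ (- dim))%:E * \int[m]_z (X (2 * r) z)%:E) +
   (K * l `^ (- tt))%:E * (((2 * r) `^ (- dim))%:E * \int[m]_z (Y (2 * r) z)%:E))%E.
  move=> r0; have r20 : 0 < 2 * r by rewrite mulr_gt0.
  pose A := ball_mass h ^~ (2 * r); pose Bk := ball_mass k ^~ (2 * r).
  have hA : nonneg_measurable A := nonneg_measurable_ball_mass bs (2 * r) lFs.1.
  have hB : nonneg_measurable Bk := nonneg_measurable_ball_mass bs (2 * r) lgu.1.
  have rN0 : 0 <= r `^ (- N) by exact: powR_ge0.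
  have rd0 : 0 <= c * r `^ (- dim) by rewrite mulr_ge0 ?powR_ge0// ltW.
  have hh := nonneg_measurable_ball_mass bs r lFs.1.
  have hrN : nonneg_measurable (fun _ : T => r `^ (- N)).
    exact: nonneg_measurable_cst.
  have hkh := nonneg_measurableM lgu.1 (nonneg_measurableM hrN hh).
  have hAB := nonneg_measurableM hA hB.
  have mI := measurable_ball_int bs r hA.
  have mI' := measurable_ball_int bs r lgu.1.
  have I0 x : (0 <= ball_int A x r)%E by exact: ball_int_ge0.
  have I0' x : (0 <= ball_int k x r)%E by apply: ball_int_ge0; exact: lgu.1.
  have mk : measurable_fun setT (fun x => (k x)%:E).
    exact: nonneg_measurable_EFin lgu.1.
  have mA : measurable_fun setT (fun x => (A x)%:E).
    exact: nonneg_measurable_EFin hA.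
  have k0 x : (0 <= (k x)%:E)%E by rewrite lee_fin; exact: lgu.1.2.
  have A0 x : (0 <= (A x)%:E)%E by rewrite lee_fin; exact: hA.2.
  have mAB : measurable_fun setT (fun x => (A x * Bk x)%:E).
    exact: nonneg_measurable_EFin hAB.
  pose w := c * r `^ (- dim) * r `^ (- N).
  have w0 : 0 <= w by rewrite mulr_ge0.
  apply: (@le_trans _ _ (w%:E * \int[m]_x ((k x)%:E * ball_int A x r))%E).
    rewrite -ge0_integralZl//; last 2 first.
      exact: emeasurable_funM.
      by move=> x _; exact: mule_ge0.
    apply: ge0_le_integral => //.
    - by move=> x _; rewrite lee_fin; exact: hkh.2.
    - exact: nonneg_measurable_EFin hkh.
    - by apply: measurable_funeM; exact: emeasurable_funM.
    - move=> x _; rewrite mulrA EFinM.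
      apply: (@le_trans _ _ ((k x * r `^ (- N))%:E *
          ((c * r `^ (- dim))%:E * ball_int A x r))%E).
        apply: lee_wpmul2l; last exact: avg.
        by rewrite lee_fin mulr_ge0//; exact: lgu.1.2.
      rewrite !muleA -!EFinM /w.
      by rewrite (_ : k x * _ * _ = c * r `^ (- dim) * r `^ (- N) * k x)//; ring.
  rewrite (ball_int_tonelli bs r lgu.1 hA).
  apply: (@le_trans _ _ (w%:E * \int[m]_z (A z * Bk z)%:E)%E).
    apply: lee_wpmul2l; first by rewrite lee_fin.
    apply: ge0_le_integral => //.
    - by move=> x _; exact: mule_ge0.
    - exact: emeasurable_funM.
    - move=> x _; rewrite EFinM; apply: lee_wpmul2l => //.
      rewrite /Bk (ball_massE _ _ lgu); apply: (le_ball_int bs lgu.1).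
      by apply: (ball_mono bs); lra.
  pose w2 := K * (2 * r) `^ (- dim).
  have w20 : 0 <= w2 by rewrite mulr_ge0 ?powR_ge0// ltW.
  rewrite !muleA -!EFinM -!ge0_integralZl//; last 3 first.
  - by rewrite lee_fin !mulr_ge0 ?powR_ge0// ltW.
  - by rewrite lee_fin !mulr_ge0 ?powR_ge0// ltW.
  - by move=> x _; rewrite lee_fin; exact: hAB.2.
  rewrite -ge0_integralD//; last 4 first.
  - move=> x _; rewrite mule_ge0// lee_fin !mulr_ge0 ?powR_ge0//; exact: ltW.
  - exact: measurable_funeM.
  - move=> x _; rewrite mule_ge0// lee_fin !mulr_ge0 ?powR_ge0//; exact: ltW.
  - exact: measurable_funeM.
  apply: ge0_le_integral => //.
  - by move=> x _; rewrite mule_ge0// lee_fin; exact: hAB.2.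
  - exact: measurable_funeM.
  - by apply: emeasurable_funD; exact: measurable_funeM.
  move=> z _; rewrite -!EFinM -EFinD lee_fin.
  have S0 : 0 < ball_mass s z (2 * r) by exact: balanced_gt0 (balanced_sym bal) mu0 ls r20.
  have U0 : 0 < ball_mass u z (2 * r) by exact: balanced_gt0 bal lam0 lu r20.
  have [_ US] := hbal z _ r20.
  pose a1 := ball_mass s z (2 * r) `^ (- mu) * A z.
  pose b1 := ball_mass u z (2 * r) `^ (- lam) * Bk z.
  have a10 : 0 <= a1 by rewrite mulr_ge0 ?powR_ge0//; exact: hA.2.
  have b10 : 0 <= b1 by rewrite mulr_ge0 ?powR_ge0//; exact: hB.2.
  have yng := young_scaled st1 tt1 st_conj a10 b10 l0.
  rewrite /X /Y -/a1 -/b1.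
  have S1 : 0 < ball_mass s z (2 * r) `^ mu by exact: powR_gt0.
  have U1 : 0 < ball_mass u z (2 * r) `^ lam by exact: powR_gt0.
  have AB : A z * Bk z <= C * (2 * r) `^ N * (a1 * b1).
    apply: (le_trans _ (ler_wpM2r _ US)); last exact: mulr_ge0.
    rewrite /a1 /b1 !powRN.
    move: (_ `^ lam) (_ `^ mu) U1 S1 => e f e0 f0.
    by rewrite [leRHS](_ : _ = A z * Bk z)//; field; rewrite !gt_eqF.
  apply: (le_trans (ler_wpM2l w0 AB)).
  have e1 : w * (C * (2 * r) `^ N * (a1 * b1)) = w2 * (a1 * b1).
    rewrite /w /w2 /K !powRN !powRM; [|by []|exact: ltW|by []|exact: ltW].
    have := powR_gt0 N r0; have := powR_gt0 dim r0.
    have := powR_gt0 dim (ltr0n R 2).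
    move: (r `^ N) (r `^ dim) (2 `^ dim) => x1 x2 x3 x30 x20 x10.
    by move: (a1 * b1) => y1; field; rewrite !gt_eqF.
  rewrite e1; apply: (le_trans (ler_wpM2l w20 yng)).
  rewrite /w2 le_eqVlt; apply/orP; left; apply/eqP.
  by move: (a1 `^ _) (b1 `^ _) (l `^ st) (l `^ (- tt)) ((2 * r) `^ _) => *; ring.
have hpot := nonneg_measurable_dyadic_potential N rho M lFs.1.
have hterm j : nonneg_measurable
    (fun x => k x * ((2 ^+ j * rho) `^ (- N) * ball_mass h x (2 ^+ j * rho))).
  apply: (nonneg_measurableM lgu.1); apply: nonneg_measurableM.
    by apply: nonneg_measurable_cst; exact: powR_ge0.
  exact: (nonneg_measurable_ball_mass bs _ lFs.1).
rewrite (eq_integral (fun x => \sum_(j < M)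
    (k x * ((2 ^+ j * rho) `^ (- N) * ball_mass h x (2 ^+ j * rho)))%:E)%E); last first.
  by move=> x _; rewrite sumEFin -mulr_sumr.
rewrite (@ge0_integral_sum _ _ _ m setT measurableT _ (fun (j : 'I_M) x =>
    (k x * ((2 ^+ j * rho) `^ (- N) * ball_mass h x (2 ^+ j * rho)))%:E)); last 2 first.
- by move=> j; exact: nonneg_measurable_EFin.
- by move=> j x _; rewrite lee_fin; exact: (hterm j).2.
have rj0 (j : nat) : 0 < 2 ^+ j * rho by rewrite mulr_gt0// exprn_gt0.
have r20 : 0 < 2 * rho by rewrite mulr_gt0.
pose integral_at (f : R -> T -> R) (j : nat) : \bar R :=
  (((2 ^+ j * (2 * rho)) `^ (- dim))%:E *
    \int[m]_z (f (2 ^+ j * (2 * rho)) z)%:E)%E.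
have i0 f j : (forall r, nonneg_measurable (f r)) -> (0 <= integral_at f j)%E.
  move=> hf; rewrite mule_ge0// ?lee_fin ?powR_ge0//.
  by apply: integral_ge0 => z _; rewrite lee_fin; exact: (hf _).2.
have one' (j : nat) :
  (\int[m]_x (k x * ((2 ^+ j * rho) `^ (- N) * ball_mass h x (2 ^+ j * rho)))%:E <=
   (K * l `^ st)%:E * integral_at X j + (K * l `^ (- tt))%:E * integral_at Y j)%E.
  by rewrite /integral_at [2 ^+ j * (2 * rho)]mulrCA; exact: one.
have HX : (\sum_(j < M) integral_at X j <= (C1 * P `^ st)%:E)%E.
  exact: emb_s.
have HY : (\sum_(j < M) integral_at Y j <= (C2 * Q `^ tt)%:E)%E.
  exact: emb_u.
have X0' j := i0 X j hX; have Y0' j := i0 Y j hY.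
move: (integral_at X) (integral_at Y) one' HX HY X0' Y0' => iX iY one' HX HY X0' Y0'.
apply: (@le_trans _ _ (\sum_(j < M)
    ((K * l `^ st)%:E * iX j + (K * l `^ (- tt))%:E * iY j))%E).
  by apply: lee_sum => j _; exact: one'.
rewrite big_split/= -ge0_sume_distrr; last by move=> j _; exact: X0'.
rewrite -ge0_sume_distrr; last by move=> j _; exact: Y0'.
apply: (@le_trans _ _ ((K * l `^ st)%:E * (C1 * P `^ st)%:E +
    (K * l `^ (- tt))%:E * (C2 * Q `^ tt)%:E)%E).
  by apply: leeD; apply: lee_wpmul2l => //; rewrite lee_fin mulr_ge0 ?powR_ge0// ltW.
rewrite -!EFinM -EFinD lee_fin.
apply: (@le_trans _ _ (K * C' * (l `^ st * P `^ st + l `^ (- tt) * Q `^ tt))).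
  have := powR_ge0 l st; have := powR_ge0 l (- tt).
  have := powR_ge0 P st; have := powR_ge0 Q tt.
  move: (l `^ st) (l `^ (- tt)) (P `^ st) (Q `^ tt) => x1 x2 x3 x4 x40 x30 x20 x10.
  rewrite -subr_ge0 (_ : _ - _ = K * (C1 * (x2 * x4) + C2 * (x1 * x3))); last first.
    by rewrite /C'; ring.
  by rewrite mulr_ge0 ?(ltW K0)// addr_ge0// mulr_ge0 ?(ltW C10) ?(ltW C20)// mulr_ge0.
by rewrite lE le_eqVlt; apply/orP; left; apply/eqP; ring.
Qed.

Local Notation q := (lam^-1).

(** The bilinear estimate tested on [g], the power [q - 1] of the potential on
    [D], which is dual to the [q]-norm. The norm that is divided out has to be
    finite; it is since the potential, a finite sum, is bounded. *)
Lemma dyadic_potential_strong_type : exists2 C : R, 0 < C &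
  forall F (P rho : R) (M : nat) (D : set T), nonneg_measurable F ->
    0 < P -> 0 < rho -> measurable D ->
    (\int[m]_y (F y `^ p * s y)%:E <= (P `^ p)%:E)%E ->
    (\int[m]_y (F y * s y)%:E < +oo)%E -> (\int[m]_(x in D) (u x)%:E < +oo)%E ->
    (\int[m]_(x in D)
        (dyadic_potential N (fun y => F y * s y) rho M x `^ q * u x)%:E
      <= ((C * P) `^ q)%:E)%E.
Proof.
have [C C0 bil] := bilinear_estimate; exists C => // F P rho M D hF P0 rho0 mD FP Foo uoo.
have lam1 : lam < 1 by rewrite lamE gtrBl invr_gt0.
have q1 : 1 < q by rewrite -[ltLHS]invr1 ltf_pV2 ?posrE.
have q0 : 0 < q := lt_trans ltr01 q1.
have lFs := Lp_locally_integrable bs p1 P0 hF ls FP.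
set h := fun y => F y * s y in lFs *.
pose pot := dyadic_potential N h rho M.
have hpot : nonneg_measurable pot := nonneg_measurable_dyadic_potential N rho M lFs.1.
pose g x := pot x `^ (q - 1) * \1_D x.
have hg : nonneg_measurable g.
  apply: nonneg_measurableM; first exact: nonneg_measurable_powR.
  exact: nonneg_measurable_indic.
have p'E : (q - 1) * p' = q.
  have pV : p'^-1 = 1 - lam by rewrite lamE; ring.
  rewrite -[p']invrK pV; field.
  by rewrite gt_eqF//= gt_eqF// subr_gt0.
have gp' x : g x `^ p' * u x = pot x `^ q * u x * \1_D x.
  rewrite /g powRM ?powR_ge0// -powRrM p'E mulrAC; congr (_ * _).
  by rewrite indicE; case: (_ \in _); rewrite ?powR1x// powR0 ?gt_eqF.
have gpot x : g x * u x * pot x = pot x `^ q * u x * \1_D x.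
  by rewrite -(mulr_powRB1 (hpot.2 x) q0) /g; ring.
have hpq : nonneg_measurable (fun x => pot x `^ q * u x).
  by apply: nonneg_measurableM lu.1; exact: nonneg_measurable_powR.
have onD : (\int[m]_(x in D) (pot x `^ q * u x)%:E =
    \int[m]_x (pot x `^ q * u x * \1_D x)%:E)%E.
  rewrite integral_mkcond; apply: eq_integral => x _; rewrite patchE indicE.
  by case: ifPn => _; rewrite ?mulr1 ?mulr0.
have h_int x r : ball_mass h x r <= fine (\int[m]_y (h y)%:E).
  have hy0 y : (0 <= (h y)%:E)%E by rewrite lee_fin; exact: lFs.1.2.
  rewrite -lee_fin (ball_massE _ _ lFs) fineK; last first.
    by rewrite ge0_fin_numE// integral_ge0.
  rewrite ball_int.unlock; apply: ge0_subset_integral => //.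
    exact: (measurable_ball_space bs).
  exact: nonneg_measurable_EFin lFs.1.
pose L := \sum_(k < M) (2 ^+ k * rho) `^ (- N) * fine (\int[m]_y (h y)%:E).
have potL x : pot x <= L.
  by apply: ler_sum => k _; apply: ler_wpM2l; [exact: powR_ge0|exact: h_int].
have L0 : 0 <= L.
  apply: sumr_ge0 => k _; rewrite mulr_ge0 ?powR_ge0// fine_ge0// integral_ge0// => y _.
  by rewrite lee_fin; exact: lFs.1.2.
set X := (\int[m]_(x in D) _)%E.
have X0 : (0 <= X)%E by apply: integral_ge0 => x _; rewrite lee_fin; exact: hpq.2.
have Xoo : (X < +oo)%E.
  apply: (@le_lt_trans _ _ ((L `^ q)%:E * \int[m]_(x in D) (u x)%:E)%E); last first.
    by rewrite lte_mul_pinfty// ?lee_fin ?powR_ge0// ge0_fin_numE.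
  have mu_D : measurable_fun D (fun x => (u x)%:E).
    exact: nonneg_measurable_EFin lu.1.
  have u0 x : D x -> (0 <= (u x)%:E)%E by rewrite lee_fin => _; exact: lu.1.2.
  have Lq0 : (0 <= (L `^ q)%:E)%E by rewrite lee_fin powR_ge0.
  rewrite -(ge0_integralZl m mD mu_D u0 Lq0).
  apply: (ge0_le_integral m mD).
  - by move=> x _; rewrite lee_fin; exact: hpq.2.
  - exact: nonneg_measurable_EFin hpq.
  - by apply: measurable_funeM; exact: nonneg_measurable_EFin lu.1.
  - move=> x _; rewrite -EFinM lee_fin; apply: ler_wpM2r; first exact: lu.1.2.
    by apply: powR_le_lnonneg; [exact: ltW|exact: hpot.2|exact: potL].
have Xfin : X \is a fin_num by rewrite ge0_fin_numE.
rewrite -(fineK Xfin) lee_fin; set x := fine X.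
have [xle0|x0] := leP x 0; first by rewrite (le_trans xle0)// powR_ge0.
have gQ : (\int[m]_y (g y `^ p' * u y)%:E <= ((x `^ p'^-1) `^ p')%:E)%E.
  rewrite (powRV_K (ltW x0)) ?gt_eqF// (fineK Xfin).
  by rewrite /X onD; under eq_integral do rewrite gp'.
have Q0 : 0 < x `^ p'^-1 by exact: powR_gt0.
have := bil F g P _ rho M hF hg P0 Q0 rho0 FP gQ.
rewrite -/h -/pot; under eq_integral do rewrite gpot.
rewrite -onD -/X -(fineK Xfin) lee_fin -/x => xle.
have xlam : x `^ lam <= C * P.
  rewrite -(ler_pM2r Q0) -powRDg// (_ : lam + p'^-1 = 1) ?powRr1 ?(ltW x0)//.
  by rewrite lamE; ring.
have := powR_le_lnonneg (ltW q0) (powR_ge0 _ _) xlam.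
by rewrite powR_invK ?gt_eqF// ltW.
Qed.

End strong_type.

(** * Morrey bounds for dyadic potentials *)

Section morrey_growth.
Context {R : realType}.

(** The form of the growth condition used below; taking the constant at least
    one includes the case [a = b]. *)
Lemma Dkappa_growth (kappa : R) (theta : R -> R) : Dkappa kappa theta ->
  exists2 C : R, 1 <= C & forall a b : R, 0 < a -> a <= b ->
    theta b <= C * (b / a) `^ kappa * theta a.
Proof.
move=> [th0 _ [C C0 hC]]; exists (Num.max 1 C); first by rewrite le_max lexx.
move=> a b a0; rewrite le_eqVlt => /predU1P[<-|ab].
  rewrite mulfV ?gt_eqF// powR1x mulr1 ler_peMl//; first exact/ltW/th0.
  by rewrite le_max lexx.
have b0 := lt_trans a0 ab.
have := hC _ _ a0 ab.
rewrite ler_pdivrMr ?powR_gt0// => /le_trans; apply.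
rewrite powRM ?invr_ge0; [|exact: ltW|exact: ltW].
have iE : a^-1 `^ kappa = (a `^ kappa)^-1.
  by rewrite -powR_inv1 ?(ltW a0)// -powRrM mulN1r powRN.
rewrite iE.
have t0 := th0 _ a0; have bk := powR_gt0 kappa b0; have ak := powR_gt0 kappa a0.
rewrite (_ : C * _ * _ = C * (b `^ kappa / a `^ kappa * theta a)); last first.
  by move: (a `^ _) (b `^ _) (theta a) => x y z; ring.
rewrite -[leRHS]mulrA; apply: ler_wpM2r.
  by rewrite mulr_ge0 ?(ltW t0)// divr_ge0 ?ltW.
by rewrite le_max lexx orbT.
Qed.

Lemma powR_double_le (q z : R) : 1 <= q -> 0 <= z ->
  2 `^ q * (z `^ q + z `^ q) <= (4 * z) `^ q.
Proof.
move=> q1 z0.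
have -> : 4 * z = 2 * (2 * z) by ring.
rewrite (powRM _ (ler0n _ 2)) ?mulr_ge0// (powRM _ (ler0n _ 2) z0).
apply: ler_wpM2l; first exact: powR_ge0.
rewrite -mulr2n -[leLHS]mulr_natl; apply: ler_wpM2r; first exact: powR_ge0.
by apply: le1r_powR => //; rewrite ler1n.
Qed.

End morrey_growth.

Section morrey_dyadic.
Context d (T : measurableType d) (R : realType)
  (m : {sigma_finite_measure set T -> \bar R}) (dim : R) (B : T -> R -> set T).
Hypothesis bs : ball_space m dim B.
Implicit Types (F g h : T -> R) (x y z : T) (r : R).
Local Notation ball_int := (ball_int m B).
Local Notation ball_mass := (ball_mass m B).
Local Notation locally_integrable := (locally_integrable m B).

Lemma dyadic_potentialD N h rho (M M' : nat) x :
  dyadic_potential m B N h rho (M + M') x = dyadic_potential m B N h rho M x +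
    dyadic_potential m B N h (2 ^+ M * rho) M' x.
Proof.
rewrite /dyadic_potential big_split_ord/=; congr (_ + _).
by apply: eq_bigr => k _; rewrite mulrA -exprD addnC.
Qed.

Lemma ball_int_eq_fun f g x r : (forall y, B x r y -> f y = g y) ->
  ball_int f x r = ball_int g x r.
Proof.
move=> fg; rewrite !ball_int.unlock; apply: eq_integral => y.
by rewrite inE => /fg ->.
Qed.

Lemma integral_mul_indic f x r : nonneg_measurable f ->
  (\int[m]_y (f y * \1_(B x r) y)%:E)%E = ball_int f x r.
Proof.
move=> hf; rewrite ball_int.unlock [RHS]integral_mkcond.
apply: eq_integral => y _; rewrite patchE indicE.
by case: ifPn => _; rewrite ?mulr1 ?mulr0.
Qed.

Context (u s : T -> R) (lam mu p p' kappa : R) (theta : R -> R).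
Hypotheses (lu : locally_integrable u) (ls : locally_integrable s)
  (bal : balanced m dim B u s lam mu) (s_pos : forall x, 0 < s x).
Hypotheses (p1 : 1 < p) (p'1 : 1 < p') (muE : mu = 1 - p^-1)
  (lamE : lam = 1 - p'^-1) (lammu : lam + mu < 1).
Hypotheses (kappa0 : 0 <= kappa) (kappa1 : kappa < p * lam)
  (thetaD : Dkappa kappa theta).
Local Notation N := (dim * (lam + mu)).
Local Notation q := (lam^-1).

Let p0 : 0 < p. Proof. exact: lt_trans ltr01 p1. Qed.
Let mu0 : 0 < mu. Proof. by rewrite muE subr_gt0 invf_lt1. Qed.
Let lam0 : 0 < lam.
Proof. by rewrite lamE subr_gt0 invf_lt1 ?(lt_trans ltr01 p'1). Qed.

(** Where [s] is [w `^ (- p')], the integrand is [h `^ p * w `^ p]; writing it in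
    terms of [h / s] displays [h] as an element of [L^p] of the measure with
    density [s]. *)
Definition morrey_bound h (A : R) := forall x r, 0 < r ->
  (ball_int (fun y => (h y / s y) `^ p * s y)%R x r <=
    (A `^ p * theta (ball_mass u x r))%:E)%E.

Let restrict h x r y := h y / s y * \1_(B x r) y.

Let restrictE h x r y : restrict h x r y * s y = h y * \1_(B x r) y.
Proof. by rewrite /restrict mulrAC divfK ?gt_eqF. Qed.

Let nonneg_measurable_div h : nonneg_measurable h ->
  nonneg_measurable (fun y => h y / s y).
Proof.
move=> hh; have hs := nonneg_measurable_powR (-1) ls.1.
have := nonneg_measurableM hh hs.
by under eq_fun do rewrite powR_inv1 ?(ltW (s_pos _))//.
Qed.

Let nonneg_measurable_restrict h x r : nonneg_measurable h ->
  nonneg_measurable (restrict h x r).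
Proof.
move=> hh; apply: nonneg_measurableM; first exact: nonneg_measurable_div.
exact: nonneg_measurable_indic (measurable_ball_space bs x r).
Qed.

Let restrict_Lp h A x r : nonneg_measurable h -> 0 < A -> morrey_bound h A ->
  0 < r ->
  (\int[m]_y (restrict h x r y `^ p * s y)%:E <=
    ((A * theta (ball_mass u x r) `^ p^-1) `^ p)%:E)%E.
Proof.
move=> hh A0 hA r0; have [th0 _ _] := thetaD.
have u0 : 0 < ball_mass u x r by exact: balanced_gt0 bal lam0 lu r0.
have t0 := th0 _ u0.
rewrite powRM ?powR_ge0 ?(ltW A0)// (powRV_K (ltW t0)) ?gt_eqF//.
apply: le_trans (hA x r r0).
rewrite -integral_mul_indic; last first.
  apply: nonneg_measurableM ls.1; apply: nonneg_measurable_powR.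
  exact: nonneg_measurable_div.
rewrite le_eqVlt; apply/orP; left; apply/eqP; apply: eq_integral => y _.
rewrite /restrict indicE; case: (_ \in _); rewrite ?mulr1 ?mulr0//.
by rewrite powR0 ?gt_eqF ?mul0r.
Qed.

Lemma morrey_ball_int_le h A x r : nonneg_measurable h -> 0 < A ->
  morrey_bound h A -> 0 < r ->
  (ball_int h x r <= (A * theta (ball_mass u x r) `^ p^-1 *
    ball_mass s x r `^ mu)%:E)%E.
Proof.
move=> hh A0 hA r0; have [th0 _ _] := thetaD.
have u0 : 0 < ball_mass u x r by exact: balanced_gt0 bal lam0 lu r0.
have P0 : 0 < A * theta (ball_mass u x r) `^ p^-1.
  by rewrite mulr_gt0// powR_gt0// th0.
have hR := nonneg_measurable_restrict x r hh.
have := ball_int_le_Lp bs x r p1 P0 hR ls (restrict_Lp x hh A0 hA r0).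
rewrite -muE; apply: le_trans; rewrite le_eqVlt; apply/orP; left; apply/eqP.
apply: ball_int_eq_fun => y xy.
by rewrite restrictE indicE mem_set ?mulr1.
Qed.

Lemma morrey_locally_integrable h A : nonneg_measurable h -> 0 < A ->
  morrey_bound h A -> locally_integrable h.
Proof.
move=> hh A0 hA; split => // x r; have [r0|r0] := ltP 0 r.
  by rewrite (le_lt_trans (morrey_ball_int_le x hh A0 hA r0))// ltry.
have r1 : r <= 1 by lra.
apply: (@le_lt_trans _ _ (ball_int h x 1)).
  by apply: (le_ball_int bs hh); exact: (ball_mono bs).
by rewrite (le_lt_trans (morrey_ball_int_le x hh A0 hA ltr01))// ltry.
Qed.

(** At the scale [2 ^+ k * r] the Morrey bound, Hoelder's inequality and balance
    bound the term by [theta (v k) `^ p^-1 * v k `^ (- lam)], where [v k] is the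
    mass of the dilated ball. By the growth condition on [theta] this is a
    multiple of [v k `^ (kappa / p - lam)]; the exponent is negative because
    [kappa < p * lam], and [v] grows geometrically by reverse doubling, so the
    first scale dominates. *)
Lemma far_bound : exists2 C : R, 0 < C &
  forall h (A : R) x0 x r (M : nat), nonneg_measurable h -> 0 < A ->
    morrey_bound h A -> 0 < r -> B x0 r x ->
    dyadic_potential m B N h r M x <=
      C * A * theta (ball_mass u x0 r) `^ p^-1 * ball_mass u x0 r `^ (- lam).
Proof.
have [th0 _ _] := thetaD.
have [Ct Ct1 grow] := Dkappa_growth thetaD.
have Ct0 : 0 < Ct := lt_le_trans ltr01 Ct1.
have [C C0 hbal] := bal.
have [D D1 dbl] := balanced_doubling bs bal lam0 mu0 lu ls.
have u_pos x r : 0 < r -> 0 < ball_mass u x r.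
  by move=> r0; exact: balanced_gt0 bal lam0 lu r0.
have s_pos' x r : 0 < r -> 0 < ball_mass s x r.
  by move=> r0; exact: balanced_gt0 (balanced_sym bal) mu0 ls r0.
have [delta [d0 d1 rev]] := doubling_reverse bs lu D1 dbl u_pos.
pose g := lam - kappa / p.
have g0 : 0 < g by rewrite subr_gt0 ltr_pdivrMr// mulrC.
have dg1 : delta `^ g < 1 by exact: powR_lt1.
pose K := C * 2 `^ N * Ct `^ p^-1.
have K0 : 0 < K by rewrite !mulr_gt0 ?powR_gt0.
exists (K * (1 - delta `^ g)^-1).
  by rewrite mulr_gt0// invr_gt0 subr_gt0.
move=> h A x0 x r M hh A0 hA r0 x0x.
have lh := morrey_locally_integrable hh A0 hA.
set xi := ball_mass u x0 r; have xi0 : 0 < xi by exact: u_pos.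
have t0 : 0 < theta xi `^ p^-1 by rewrite powR_gt0// th0.
pose v k := ball_mass u x0 (2 * (2 ^+ k * r)).
have rk0 k : 0 < 2 ^+ k * r by rewrite mulr_gt0// exprn_gt0.
have r2k0 k : 0 < 2 * (2 ^+ k * r) by rewrite mulr_gt0.
have v0 k : 0 < v k by exact: u_pos.
have vS k : v k <= delta * v k.+1.
  rewrite /v (_ : 2 ^+ k.+1 * r = 2 * (2 ^+ k * r)); last by rewrite exprS mulrA.
  exact: rev.
have xiv k : xi <= v k.
  apply: (le_ball_mass bs lu); apply: (ball_mono bs).
  rewrite mulrA -exprS ler_peMl ?(ltW r0)//.
  by rewrite exprn_ege1// ler1n.
have term k : (2 ^+ k * r) `^ (- N) * ball_mass h x (2 ^+ k * r) <=
    K * A * theta xi `^ p^-1 * xi `^ (- (kappa / p)) * v k `^ (- g).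
  have incl : B x (2 ^+ k * r) `<=` B x0 (2 * (2 ^+ k * r)).
    apply: (subset_trans (ball_tri bs x0x)); apply: (ball_mono bs).
    rewrite (_ : 2 * _ = 2 ^+ k * r + 2 ^+ k * r); last by ring.
    by rewrite lerD2r ler_peMl ?(ltW r0)// exprn_ege1// ler1n.
  have h1 := le_ball_mass bs lh incl.
  have h2 : ball_mass h x0 (2 * (2 ^+ k * r)) <= A * theta (v k) `^ p^-1 *
      ball_mass s x0 (2 * (2 ^+ k * r)) `^ mu.
    rewrite -lee_fin (ball_massE _ _ lh).
    exact: (morrey_ball_int_le x0 hh A0 hA (r2k0 k)).
  have [_ h3] := hbal x0 _ (r2k0 k); rewrite -/(v k) in h3.
  have h4 := grow _ _ xi0 (xiv k).
  have vl0 : 0 < v k `^ lam by exact: powR_gt0.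
  have h5 : ball_mass s x0 (2 * (2 ^+ k * r)) `^ mu <=
      C * (2 * (2 ^+ k * r)) `^ N * v k `^ (- lam).
    by rewrite powRN ler_pdivlMr// mulrC.
  have h6 : theta (v k) `^ p^-1 <=
      Ct `^ p^-1 * v k `^ (kappa / p) * xi `^ (- (kappa / p)) * theta xi `^ p^-1.
    have pV0 : 0 <= p^-1 by rewrite invr_ge0 ltW.
    apply: le_trans (powR_le_lnonneg pV0 (ltW (th0 _ (v0 k))) h4) _.
    have xiV0 : 0 <= xi^-1 by rewrite invr_ge0 ltW.
    have vk0 := ltW (v0 k).
    have vx0 : 0 <= v k / xi by rewrite divr_ge0// ltW.
    rewrite !powRM ?mulr_ge0 ?powR_ge0 ?(ltW Ct0) ?(ltW (th0 _ xi0))//.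
    rewrite -!powRrM -[xi^-1]powR_inv1 ?(ltW xi0)// -powRrM mulN1r.
    by rewrite -!mulrA.
  have e : (2 * (2 ^+ k * r)) `^ N = 2 `^ N * (2 ^+ k * r) `^ N.
    by rewrite powRM// ltW.
  have rN0 := powR_gt0 N (rk0 k).
  apply: (@le_trans _ _ ((2 ^+ k * r) `^ (- N) * (A *
    (Ct `^ p^-1 * v k `^ (kappa / p) * xi `^ (- (kappa / p)) * theta xi `^ p^-1) *
    (C * (2 `^ N * (2 ^+ k * r) `^ N) * v k `^ (- lam))))).
    apply: ler_wpM2l; first exact: powR_ge0.
    apply: (le_trans h1); apply: (le_trans h2); rewrite -e.
    apply: ler_pM => //; rewrite ?mulr_ge0 ?powR_ge0 ?(ltW A0)//.
    by apply: ler_wpM2l => //; exact: ltW.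
  have -> : v k `^ (- g) = v k `^ (kappa / p) * v k `^ (- lam).
    by rewrite -powRDg//; congr (_ `^ _); rewrite /g; ring.
  rewrite powRN le_eqVlt; apply/orP; left; apply/eqP; rewrite /K.
  move: ((2 ^+ k * r) `^ N) rN0 (v k `^ (- lam)) (v k `^ (kappa / p)) => a a0 b c.
  move: (xi `^ (- _)) (theta xi `^ _) (Ct `^ _) (2 `^ N) => e1 e2 e3 e4.
  by field; rewrite gt_eqF.
apply: (@le_trans _ _ (\sum_(k < M)
    K * A * theta xi `^ p^-1 * xi `^ (- (kappa / p)) * v k `^ (- g))).
  by apply: ler_sum => k _; exact: term.
rewrite -mulr_sumr.
have c0 : 0 <= K * A * theta xi `^ p^-1 * xi `^ (- (kappa / p)).
  by rewrite !mulr_ge0 ?powR_ge0// ltW.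
apply: (le_trans (ler_wpM2l c0 (sum_geometric_inv M d0 d1 g0 v0 vS))).
have v0x : v 0%N `^ (- g) <= xi `^ (- g).
  by apply: powR_le_lneg; rewrite ?oppr_le0 ?(ltW g0).
have i0 : 0 <= (1 - delta `^ g)^-1 by rewrite invr_ge0 subr_ge0 ltW.
apply: (le_trans (ler_wpM2l c0 (ler_wpM2l i0 v0x))).
have -> : xi `^ (- lam) = xi `^ (- (kappa / p)) * xi `^ (- g).
  by rewrite -powRDg//; congr (_ `^ _); rewrite /g; ring.
rewrite le_eqVlt; apply/orP; left; apply/eqP.
by move: (xi `^ _) (xi `^ _) (theta xi `^ _) ((1 - _)^-1) => *; ring.
Qed.

(** Only balls inside the doubled ball occur, so [h] may be restricted to it; the
    restriction is in [L^p] by the Morrey bound, and the strong-type estimate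
    applies. *)
Lemma near_bound : exists2 C : R, 0 < C &
  forall h (A : R) x0 r rho (M : nat), nonneg_measurable h -> 0 < A ->
    morrey_bound h A -> 0 < r -> 0 < rho -> 2 ^+ M * rho <= r ->
    (\int[m]_(x in B x0 r)
        (dyadic_potential m B N h rho M x `^ q * u x)%:E
      <= ((C * A * theta (ball_mass u x0 r) `^ p^-1) `^ q)%:E)%E.
Proof.
have [th0 _ _] := thetaD.
have [Ct Ct1 grow] := Dkappa_growth thetaD.
have Ct0 : 0 < Ct := lt_le_trans ltr01 Ct1.
have [D D1 dbl] := balanced_doubling bs bal lam0 mu0 lu ls.
have D0 : 0 < D := lt_le_trans ltr01 D1.
have u_pos x r : 0 < r -> 0 < ball_mass u x r.
  by move=> r0; exact: balanced_gt0 bal lam0 lu r0.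
have [C C0 strong] := dyadic_potential_strong_type bs lu ls bal p1 p'1 muE lamE lammu.
pose K := (Ct * D `^ kappa) `^ p^-1.
have K0 : 0 < K by rewrite powR_gt0// mulr_gt0// powR_gt0.
exists (C * K); first exact: mulr_gt0.
move=> h A x0 r rho M hh A0 hA r0 rho0 Mr.
have lh := morrey_locally_integrable hh A0 hA.
have r20 : 0 < 2 * r by rewrite mulr_gt0.
have xi0 := u_pos x0 _ r0; have xi20 := u_pos x0 _ r20.
have hF := nonneg_measurable_restrict x0 (2 * r) hh.
pose P := A * theta (ball_mass u x0 (2 * r)) `^ p^-1.
have P0 : 0 < P by rewrite mulr_gt0// powR_gt0// th0.
have FP := restrict_Lp x0 hh A0 hA r20.
have Foo : (\int[m]_y (restrict h x0 (2 * r) y * s y)%:E < +oo)%E.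
  under eq_integral do rewrite restrictE.
  by rewrite integral_mul_indic//; exact: lh.2.
have uoo : (\int[m]_(x in B x0 r) (u x)%:E < +oo)%E.
  by have := lu.2 x0 r; rewrite ball_int.unlock.
have mB := measurable_ball_space bs x0 r.
have := strong _ P rho M _ hF P0 rho0 mB FP Foo uoo.
have xi12 : ball_mass u x0 r <= ball_mass u x0 (2 * r).
  by apply: (le_ball_mass bs lu); apply: (ball_mono bs); lra.
have PK : P <= K * A * theta (ball_mass u x0 r) `^ p^-1.
  have th2 : theta (ball_mass u x0 (2 * r)) <=
      Ct * D `^ kappa * theta (ball_mass u x0 r).
    apply: le_trans (grow _ _ xi0 xi12) _.
    apply: ler_wpM2r; first exact/ltW/th0.
    apply: ler_wpM2l; first exact: ltW.
    apply: powR_le_lnonneg => //; first by rewrite divr_ge0// ltW.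
    by rewrite ler_pdivrMr//; exact: dbl.
  have pV0 : 0 <= p^-1 by rewrite invr_ge0 ltW.
  have := powR_le_lnonneg pV0 (ltW (th0 _ xi20)) th2.
  have c0 : 0 <= Ct * D `^ kappa by rewrite mulr_ge0 ?powR_ge0// ltW.
  rewrite powRM ?(ltW (th0 _ xi0))// -/K => h1.
  rewrite /P mulrAC [leRHS]mulrC; apply: ler_wpM2l; first exact: ltW.
  by rewrite mulrC in h1 *.
move=> H.
apply: le_trans (_ : _ <= ((C * P) `^ q)%:E)%E _; last first.
  rewrite lee_fin; apply: powR_le_lnonneg; first by rewrite invr_ge0 ltW.
    by rewrite mulr_ge0 ?ltW.
  by rewrite -!mulrA ler_pM2l// mulrA.
apply: le_trans H; rewrite le_eqVlt; apply/orP; left; apply/eqP.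
apply: eq_integral => x; rewrite inE => x0x; congr ((_ `^ _) * _)%:E.
apply: eq_bigr => k _; congr (_ * _).
rewrite !ball_mass.unlock; congr fine; apply: ball_int_eq_fun => y xy.
rewrite restrictE indicE mem_set ?mulr1//.
have : B x (2 ^+ k * rho) `<=` B x0 (2 * r).
  apply: (subset_trans (ball_tri bs x0x)); apply: (ball_mono bs).
  rewrite (_ : 2 * r = r + r); last by ring.
  rewrite lerD2l; apply: le_trans Mr; apply: ler_wpM2r; first exact: ltW.
  by apply: ler_weXn2l; [rewrite ler1n|exact: ltnW].
exact.
Qed.

(** The radii run from [2 ^- n * r] to [2 ^+ n * r]; the first [n] of them, below
    [r], form the near part and the others the far part. *)
Lemma dyadic_morrey_bound : exists2 C : R, 0 < C &
  forall h (A : R) x0 r (n : nat), nonneg_measurable h -> 0 < A ->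
    morrey_bound h A -> 0 < r ->
    (\int[m]_(x in B x0 r)
        (dyadic_potential m B N h (2 ^- n * r) (n + n) x `^ q * u x)%:E
      <= ((C * A * theta (ball_mass u x0 r) `^ p^-1) `^ q)%:E)%E.
Proof.
have [th0 _ _] := thetaD.
have [C1 C10 near] := near_bound; have [C2 C20 far] := far_bound.
pose C3 := C1 + C2; have C30 : 0 < C3 by rewrite addr_gt0.
have lam1 : lam < 1 by rewrite lamE gtrBl invr_gt0 (lt_trans ltr01 p'1).
have q1 : 1 < q by rewrite -[ltLHS]invr1 ltf_pV2 ?posrE.
have q0 : 0 < q := lt_trans ltr01 q1.
exists (4 * C3); first by rewrite mulr_gt0.
move=> h A x0 r n hh A0 hA r0.
have lh := morrey_locally_integrable hh A0 hA.
have xi0 : 0 < ball_mass u x0 r by exact: balanced_gt0 bal lam0 lu r0.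
set xi := ball_mass u x0 r in xi0 *.
set th := theta xi `^ p^-1.
have t0 : 0 < th by rewrite powR_gt0// th0.
have rho0 : 0 < 2 ^- n * r by rewrite mulr_gt0// invr_gt0 exprn_gt0.
have rhoE : 2 ^+ n * (2 ^- n * r) = r.
  by rewrite mulrA mulfV ?mul1r// gt_eqF// exprn_gt0.
have nearn := near h A x0 r _ n hh A0 hA r0 rho0.
rewrite rhoE lexx in nearn; have {}nearn := nearn isT.
pose near_part := dyadic_potential m B N h (2 ^- n * r) n.
have hnear : nonneg_measurable near_part.
  exact: nonneg_measurable_dyadic_potential bs _ _ _ _ hh.
pose L := C2 * A * th * xi `^ (- lam).
have L0 : 0 <= L by rewrite !mulr_ge0 ?powR_ge0// ltW.
have hpot := nonneg_measurable_dyadic_potential bs N (2 ^- n * r) (n + n) hh.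
have le2 x : B x0 r x ->
  dyadic_potential m B N h (2 ^- n * r) (n + n) x `^ q * u x <=
    2 `^ q * (near_part x `^ q * u x) + 2 `^ q * L `^ q * u x.
  move=> x0x; rewrite dyadic_potentialD rhoE.
  have := far h A x0 x r n hh A0 hA r0 x0x.
  have := (nonneg_measurable_dyadic_potential bs N r n hh).2 x.
  rewrite -/th -/L -/xi -/(near_part x).
  move: (dyadic_potential m B N h r n x) (near_part x) (hnear.2 x) => b a a0 b0 bL.
  rewrite mulrA -mulrDl; apply: ler_wpM2r; first exact: lu.1.2.
  rewrite -!powRM//; have [ab|ba] := leP a L.
    rewrite -[leLHS]add0r; apply: lerD; first exact: powR_ge0.
    apply: powR_le_lnonneg; [exact: ltW|exact: addr_ge0|].
    by rewrite mulr2n mulrDl mul1r; exact: lerD.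
  rewrite -[leLHS]addr0; apply: lerD; last exact: powR_ge0.
  apply: powR_le_lnonneg; [exact: ltW|exact: addr_ge0|].
  by rewrite mulr2n mulrDl mul1r lerD2l (le_trans bL)// ltW.
have mB := measurable_ball_space bs x0 r.
have h1 : nonneg_measurable (fun x => near_part x `^ q * u x).
  by apply: nonneg_measurableM lu.1; exact: nonneg_measurable_powR.
have h0 : nonneg_measurable
    (fun x => dyadic_potential m B N h (2 ^- n * r) (n + n) x `^ q * u x).
  by apply: nonneg_measurableM lu.1; exact: nonneg_measurable_powR.
have h2 : nonneg_measurable (fun x => 2 `^ q * (near_part x `^ q * u x)).
  by apply: nonneg_measurableM h1; exact: nonneg_measurable_cst (powR_ge0 _ _).
have c0 : 0 <= 2 `^ q * L `^ q by rewrite mulr_ge0 ?powR_ge0.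
have h3 : nonneg_measurable (fun x => 2 `^ q * L `^ q * u x).
  by apply: nonneg_measurableM lu.1; exact: nonneg_measurable_cst.
have h23 : nonneg_measurable (fun x =>
    2 `^ q * (near_part x `^ q * u x) + 2 `^ q * L `^ q * u x).
  by split; [exact: measurable_funD h2.1 h3.1|move=> x; rewrite addr_ge0 ?h2.2 ?h3.2].
have := le_ball_int_fun bs h0 h23 le2.
rewrite (ball_int_add bs _ _ h2 h3) (ball_intZ bs _ _ h1 (powR_ge0 _ _)).
rewrite (ball_intZ bs _ _ lu.1 c0) -(ball_massE _ _ lu) -/xi !ball_int.unlock.
move=> /le_trans; apply; rewrite -EFinM.
apply: (@le_trans _ _ ((2 `^ q)%:E * ((C1 * A * th) `^ q)%:E +
    (2 `^ q * L `^ q * xi)%:E)%E).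
  by apply: leeD => //; apply: lee_wpmul2l => //; rewrite lee_fin powR_ge0.
rewrite -EFinM -EFinD lee_fin.
have LE : L `^ q * xi = (C2 * A * th) `^ q.
  have C2At : 0 <= C2 * A * th by rewrite !mulr_ge0 ?ltW.
  rewrite /L powRM ?powR_ge0// -mulrA -powRrM mulNr mulfV ?gt_eqF//.
  by rewrite powR_inv1 ?(ltW xi0)// mulVf ?mulr1// gt_eqF.
rewrite -[_ * L `^ q * xi]mulrA LE -mulrDr.
have At : 0 < A * th by rewrite mulr_gt0.
have le3 (c : R) : 0 < c -> c <= C3 ->
    (c * A * th) `^ q <= (C3 * A * th) `^ q.
  move=> cc0 cC; apply: powR_le_lnonneg; first exact: ltW.
    by rewrite -mulrA mulr_ge0 ?ltW.
  by rewrite -!mulrA; apply: ler_wpM2r => //; exact: ltW.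
have l1 := le3 C1 C10 (_ : C1 <= C3); have l2 := le3 C2 C20 (_ : C2 <= C3).
apply: (@le_trans _ _ (2 `^ q * ((C3 * A * th) `^ q + (C3 * A * th) `^ q))).
  apply: ler_wpM2l; first exact: powR_ge0.
  by apply: lerD; [apply: l1|apply: l2]; rewrite /C3 ?lerDl ?lerDr ltW.
have C3At : 0 <= C3 * A * th by rewrite !mulr_ge0 ?ltW.
have -> : 4 * C3 * A * th = 4 * (C3 * A * th) by ring.
exact: powR_double_le (ltW q1) C3At.
Qed.

End morrey_dyadic.

Section monotone_limit.
Context d (T : measurableType d) (R : realType).
Variable m : {measure set T -> \bar R}.
Local Open Scope ereal_scope.

(** Monotone convergence when only an upper bound by the limit is known. *)
Lemma integral_le_sup (D : set T) (f : T -> \bar R) (a : nat -> T -> \bar R)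
    (C : \bar R) : measurable D -> measurable_fun D f ->
  (forall x, D x -> 0 <= f x) -> (forall n, measurable_fun D (a n)) ->
  (forall n x, D x -> 0 <= a n x) ->
  (forall x, D x -> nondecreasing_seq (a ^~ x)) ->
  (forall x, D x -> f x <= ereal_sup (range (a ^~ x))) ->
  (forall n, \int[m]_(x in D) a n x <= C) -> \int[m]_(x in D) f x <= C.
Proof.
move=> mD mf f0 ma a0 nda fa aC.
have limE x : D x -> limn (a ^~ x) = ereal_sup (range (a ^~ x)).
  by move=> Dx; apply/cvg_lim => //; apply: ereal_nondecreasing_cvgn; exact: nda.
have mlim : measurable_fun D (fun x => limn (a ^~ x)).
  apply: (emeasurable_fun_cvg a) => // x Dx.
  exact: ereal_nondecreasing_is_cvgn (nda x Dx).
apply: (@le_trans _ _ (\int[m]_(x in D) limn (a ^~ x))).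
  by apply: ge0_le_integral => // x Dx; rewrite limE// fa.
rewrite monotone_convergence//.
apply: lime_le; last by apply: nearW => n; exact: aC.
apply: ereal_nondecreasing_is_cvgn => k l kl.
apply: ge0_le_integral => //; first by move=> x Dx; exact: a0.
by move=> x Dx; exact: nda.
Qed.

Lemma poweR_ereal_sup_le (b : nat -> R) (q v : R) (z : \bar R) : (0 < q)%R ->
  (0 <= v)%R -> (forall n, 0 <= b n)%R -> 0 <= z ->
  z <= ereal_sup (range (fun n => (b n)%:E)) ->
  z `^ q * v%:E <= ereal_sup (range (fun n => (b n `^ q * v)%:E)).
Proof.
move=> q0 v0 b0 z0 zb.
have S0 : 0 <= ereal_sup (range (fun n => (b n `^ q * v)%:E)).
  apply: (@le_trans _ _ (b 0%N `^ q * v)%:E); first by rewrite lee_fin mulr_ge0 ?powR_ge0.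
  by apply: ereal_sup_ubound; exists 0%N.
move: v0 S0; rewrite le_eqVlt => /predU1P[<-|v0 S0]; first by rewrite mule0.
have ub n : (b n `^ q * v)%:E <= ereal_sup (range (fun n => (b n `^ q * v)%:E)).
  by apply: ereal_sup_ubound; exists n.
move: (ereal_sup (range (fun n => (b n `^ q * v)%:E))) S0 ub => [S| |]//; last first.
  by move=> _ _; rewrite leey.
rewrite lee_fin => S0 ub.
have Sv0 : (0 <= S / v)%R by rewrite divr_ge0// ltW.
have zS : z <= ((S / v) `^ q^-1)%:E.
  apply: (le_trans zb); apply: ge_ereal_sup => _ [n _ <-]; rewrite lee_fin.
  rewrite -[leLHS](powR_invK (b0 n) (lt0r_neq0 q0)).
  apply: powR_le_lnonneg; [by rewrite invr_ge0 ltW|exact: powR_ge0|].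
  by rewrite ler_pdivlMr// -lee_fin.
have : z `^ q <= (S / v)%:E.
  rewrite -[leRHS](_ : ((S / v) `^ q^-1)%:E `^ q = _); last first.
    by rewrite poweR_EFin powRV_K// gt_eqF.
  apply: gt0_ler_poweR => //; first exact: ltW.
    by rewrite in_itv/= z0 leey.
  by rewrite in_itv/= leey andbT lee_fin powR_ge0.
move=> h; apply: (@le_trans _ _ ((S / v)%:E * v%:E)).
  by apply: lee_wpmul2r => //; rewrite lee_fin ltW.
by rewrite -EFinM divfK// gt_eqF.
Qed.

End monotone_limit.

(** * From dyadic potentials to kernels *)

Section dyadic_sums.
Context {R : realType}.
Implicit Types (phi : R -> R) (r N : R).

(** Going from [n] to [n + 1] adds one radius at each end of the range. *)
Lemma dyadic_sum_nondecreasing phi N r : (forall t, 0 <= phi t) ->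
  nondecreasing_seq (fun n => \sum_(k < n + n)
    (2 ^+ k * (2 ^- n * r)) `^ (- N) * phi (2 ^+ k * (2 ^- n * r))).
Proof.
move=> phi0; apply/nondecreasing_seqP => n.
rewrite addSn addnS big_ord_recl big_ord_recr/=.
set S := \sum_(k < n + n) _; set S' := \sum_(k < n + n) _.
have -> : S = S'.
  apply: eq_bigr => k _; rewrite /bump/= add1n.
  have -> // : 2 ^+ k.+1 * (2 ^- n.+1 * r) = 2 ^+ k * (2 ^- n * r).
  by rewrite !exprS; field; rewrite expf_neq0.
have t0 t : 0 <= t `^ (- N) * phi t by rewrite mulr_ge0 ?powR_ge0.
by rewrite -[leLHS]add0r lerD// lerDl.
Qed.

Lemma exists_exp2_gt (x : R) : exists n, x < 2 ^+ n.
Proof.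
exists (Num.truncn x).+1; apply: (lt_le_trans (truncnS_gt x)).
by rewrite -natrX ler_nat ltnW// ltn_expl.
Qed.

End dyadic_sums.

Section kernel.
Context d (T : measurableType d) (R : realType)
  (m : {sigma_finite_measure set T -> \bar R}) (dim : R) (B : T -> R -> set T).
Hypothesis bs : ball_space m dim B.
Implicit Types (F g h : T -> R) (x y z : T) (r : R).
Local Notation ball_int := (ball_int m B).
Local Notation ball_mass := (ball_mass m B).
Local Notation locally_integrable := (locally_integrable m B).
Context (K : T -> T -> R) (N : R).
Hypotheses (K0 : forall x y, 0 <= K x y)
  (mK : measurable_fun setT (fun z : T * T => K z.1 z.2))
  (K_far : forall x y r, 0 < r -> ~ B x r y -> K x y <= r `^ (- N))
  (K_diag : forall x y, 0 < K x y -> exists2 r : R, 0 < r & ~ B x r y)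
  (K_bounded : forall x y, exists2 r : R, 0 < r & B x r y).

Let dyadic_kernel r (n : nat) x y : R := \sum_(k < n + n)
  (2 ^+ k * (2 ^- n * r)) `^ (- N) * \1_(B x (2 ^+ k * (2 ^- n * r))) y.

(* The smallest of the dyadic balls that contains [y] gives the bound. For [n]
   large there is one, as [y] lies in some ball about [x], and it is not the
   first, as [y] lies outside some ball about [x]. *)
Let kernel_le_dyadic r x y : 0 < r ->
  exists n, K x y <= 2 `^ N * dyadic_kernel r n x y.
Proof.
move=> r0; have [Kle0|Kgt0] := leP (K x y) 0.
  by exists 0%N; rewrite /dyadic_kernel big_ord0 mulr0.
have [r1 r10 nB] := K_diag Kgt0; have [r2 r20 yB] := K_bounded x y.
have [n hn] := exists_exp2_gt (Num.max (r / r1) (2 * r2 / r)).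
move: hn; rewrite gt_max => /andP[hn1 hn2].
pose rho := 2 ^- n * r.
have en0 : 0 < 2 ^+ n :> R by rewrite exprn_gt0.
have rho0 : 0 < rho by rewrite mulr_gt0// invr_gt0.
have rho1 : rho <= r1.
  by rewrite /rho ler_pdivrMl// ltW// -ltr_pdivrMr.
have h2 : 2 * r2 < 2 ^+ n * r by rewrite -ltr_pdivrMr.
have n0 : (0 < n)%N.
  rewrite lt0n; apply/eqP => n0; apply: nB.
  move: hn1 h2; rewrite n0 expr0 ltr_pdivrMr// => a1 a2.
  by apply: (ball_mono bs) yB; lra.
have topB : B x (2 ^+ (n + n).-1 * rho) y.
  apply: (ball_mono bs) yB; rewrite /rho; case: (n) n0 h2 => // n' _.
  rewrite addSn/= exprS => h2.
  have -> : 2 ^+ (n' + n'.+1) * ((2 * 2 ^+ n')^-1 * r) = 2 ^+ n' * r.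
    by rewrite exprD exprS; field; rewrite expf_neq0.
  by move: h2; rewrite -mulrA; lra.
case: (ex_minnP (P := fun k => `[< B x (2 ^+ k * rho) y >]) _).
  by exists (n + n).-1; apply/asboolP.
move=> k /asboolP kB kmin.
have kn : (k < n + n)%N.
  rewrite -(@prednK (n + n)) ?addn_gt0 ?n0// ltnS; apply: kmin.
  exact/asboolP.
case: k => [|k] in kB kmin kn *.
  by case: nB; apply: (ball_mono bs) kB; rewrite expr0 mul1r.
have nkB : ~ B x (2 ^+ k * rho) y.
  by move=> /asboolP /kmin; rewrite ltnn.
have rk0 : 0 < 2 ^+ k * rho by rewrite mulr_gt0// exprn_gt0.
exists n; apply: (le_trans (K_far rk0 nkB)).
have -> : (2 ^+ k * rho) `^ (- N) = 2 `^ N * (2 ^+ k.+1 * rho) `^ (- N).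
  rewrite exprS -mulrA [(2 * _) `^ _]powRM//; last exact: ltW.
  by rewrite mulrA -powRDg// subrr powRr0 mul1r.
apply: ler_wpM2l; first exact: powR_ge0.
rewrite /dyadic_kernel (bigD1 (Ordinal kn))//= indicE mem_set// mulr1 lerDl.
by apply: sumr_ge0 => i _; rewrite mulr_ge0 ?powR_ge0.
Qed.

Let nonneg_measurable_kernel_mul h x : nonneg_measurable h ->
  nonneg_measurable (fun y => h y * K x y).
Proof.
move=> hh; apply: (nonneg_measurableM hh); split; last by move=> y; exact: K0.
exact: (measurableT_comp mK (measurable_pair1 x)).
Qed.

Lemma measurable_kernel_int h : nonneg_measurable h ->
  measurable_fun setT (fun x => \int[m]_y (h y * K x y)%:E)%E.
Proof.
move=> hh.
have mf : measurable_fun setT (fun z : T * T => (h z.2 * K z.1 z.2)%:E).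
  apply/measurable_EFinP; apply: measurable_funM mK.
  exact: (measurableT_comp hh.1 measurable_snd).
apply: (measurable_fun_fubini_tonelli_F _ mf) => z.
by rewrite lee_fin mulr_ge0 ?K0//; exact: hh.2.
Qed.

Lemma kernel_int_le_dyadic h r x : locally_integrable h -> 0 < r ->
  (\int[m]_y (h y * K x y)%:E <= ereal_sup (range (fun n =>
    (2 `^ N * dyadic_potential m B N h (2 ^- n * r) (n + n) x)%:E)))%E.
Proof.
move=> lh r0; have hh := lh.1.
have hk n : nonneg_measurable (dyadic_kernel r n x).
  split.
    apply: measurable_sum => k; apply: measurable_funM => //.
    exact: measurable_indic (measurable_ball_space bs _ _).
  by move=> y; apply: sumr_ge0 => k _; rewrite mulr_ge0 ?powR_ge0.
have hN : nonneg_measurable (fun _ : T => 2 `^ N : R).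
  exact: nonneg_measurable_cst (powR_ge0 _ _).
have ha n := nonneg_measurableM hN (nonneg_measurableM hh (hk n)).
apply: (integral_le_sup (m := m)
  (a := fun n y => (2 `^ N * (h y * dyadic_kernel r n x y))%:E)) => //.
- exact: nonneg_measurable_EFin (nonneg_measurable_kernel_mul x hh).
- by move=> y _; rewrite lee_fin; exact: (nonneg_measurable_kernel_mul x hh).2.
- by move=> n; exact: nonneg_measurable_EFin (ha n).
- by move=> n y _; rewrite lee_fin; exact: (ha n).2.
- move=> y _ n n' nn'; rewrite lee_fin; apply: ler_wpM2l; first exact: powR_ge0.
  apply: ler_wpM2l; first exact: hh.2.
  have := @dyadic_sum_nondecreasing R (fun t => \1_(B x t) y) N r.
  by apply.
- move=> y _; have [n hn] := kernel_le_dyadic x y r0.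
  apply: (@le_trans _ _ (2 `^ N * (h y * dyadic_kernel r n x y))%:E%E).
    rewrite lee_fin mulrCA; apply: ler_wpM2l => //; exact: hh.2.
  by apply: ereal_sup_ubound; exists n.
move=> n; apply: le_trans (ereal_sup_ubound (ex_intro2 _ _ n I erefl)).
under eq_integral do rewrite EFinM.
rewrite ge0_integralZl//; last 2 first.
- exact: nonneg_measurable_EFin (nonneg_measurableM hh (hk n)).
- by move=> y _; rewrite lee_fin; exact: (nonneg_measurableM hh (hk n)).2.
rewrite EFinM; apply: lee_wpmul2l; first by rewrite lee_fin powR_ge0.
pose t k := 2 ^+ k * (2 ^- n * r).
have ht k : nonneg_measurable (fun y => t k `^ (- N) * (h y * \1_(B x (t k)) y)).
  apply: nonneg_measurableM; first exact: nonneg_measurable_cst (powR_ge0 _ _).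
  apply: (nonneg_measurableM hh).
  exact: nonneg_measurable_indic (measurable_ball_space bs _ _).
rewrite (eq_integral (fun y => \sum_(k < n + n)
    (t k `^ (- N) * (h y * \1_(B x (t k)) y))%:E)%E); last first.
  move=> y _; rewrite sumEFin; congr EFin; rewrite mulr_sumr.
  by apply: eq_bigr => k _; rewrite mulrCA.
rewrite (@ge0_integral_sum _ _ _ m setT measurableT _ (fun (k : 'I_(n + n)) y =>
    (t k `^ (- N) * (h y * \1_(B x (t k)) y))%:E)); last 2 first.
- by move=> k; exact: nonneg_measurable_EFin (ht k).
- by move=> k y _; rewrite lee_fin; exact: (ht k).2.
rewrite /dyadic_potential -sumEFin; apply: lee_sum => k _.
have hhB : nonneg_measurable (fun y => h y * \1_(B x (t k)) y).
  apply: (nonneg_measurableM hh).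
  exact: nonneg_measurable_indic (measurable_ball_space bs _ _).
under eq_integral do rewrite EFinM.
have mhB := nonneg_measurable_EFin (D := setT) hhB.
rewrite (ge0_integralZl m measurableT mhB); last 2 first.
- by move=> y _; rewrite lee_fin; exact: hhB.2.
- by rewrite lee_fin powR_ge0.
by rewrite (integral_mul_indic m B)// EFinM (ball_massE _ _ lh).
Qed.

End kernel.

Section kernel_morrey.
Context d (T : measurableType d) (R : realType)
  (m : {sigma_finite_measure set T -> \bar R}) (dim : R) (B : T -> R -> set T).
Hypothesis bs : ball_space m dim B.
Local Notation ball_mass := (ball_mass m B).
Local Notation locally_integrable := (locally_integrable m B).
Context (u s : T -> R) (lam mu p p' kappa : R) (theta : R -> R).
Hypotheses (lu : locally_integrable u) (ls : locally_integrable s)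
  (bal : balanced m dim B u s lam mu) (s_pos : forall x, 0 < s x).
Hypotheses (p1 : 1 < p) (p'1 : 1 < p') (muE : mu = 1 - p^-1)
  (lamE : lam = 1 - p'^-1) (lammu : lam + mu < 1).
Hypotheses (kappa0 : 0 <= kappa) (kappa1 : kappa < p * lam)
  (thetaD : Dkappa kappa theta).
Local Notation N := (dim * (lam + mu)).
Local Notation q := (lam^-1).
Context (K : T -> T -> R).
Hypotheses (K0 : forall x y, 0 <= K x y)
  (mK : measurable_fun setT (fun z : T * T => K z.1 z.2))
  (K_far : forall x y (r : R), 0 < r -> ~ B x r y -> K x y <= r `^ (- N))
  (K_diag : forall x y, 0 < K x y -> exists2 r : R, 0 < r & ~ B x r y)
  (K_bounded : forall x y, exists2 r : R, 0 < r & B x r y).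

(** The dyadic bound holds uniformly in the number of scales, and monotone
    convergence carries it to the supremum, which dominates the kernel. *)
Lemma kernel_morrey_bound : exists2 C : R, 0 < C &
  forall h (A : R) x0 r, nonneg_measurable h -> 0 < A ->
    morrey_bound m B u s p theta h A -> 0 < r ->
    (\int[m]_(x in B x0 r)
        ((\int[m]_y (h y * K x y)%:E) `^ q * (u x)%:E)
      <= ((C * A * theta (ball_mass u x0 r) `^ p^-1) `^ q)%:E)%E.
Proof.
have [th0 _ _] := thetaD.
have [C C0 dyadic] :=
  dyadic_morrey_bound bs lu ls bal s_pos p1 p'1 muE lamE lammu kappa0 kappa1 thetaD.
have lam0 : 0 < lam by rewrite lamE subr_gt0 invf_lt1 ?(lt_trans ltr01 p'1).
have q0 : 0 < q by rewrite invr_gt0.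
have N20 : 0 < 2 `^ N :> R by exact: powR_gt0.
exists (2 `^ N * C); first exact: mulr_gt0.
move=> h A x0 r hh A0 hA r0.
have lh := morrey_locally_integrable bs lu ls bal s_pos p1 p'1 muE lamE thetaD hh A0 hA.
have mB := measurable_ball_space bs x0 r.
pose pot n := dyadic_potential m B N h (2 ^- n * r) (n + n).
have hpot n : nonneg_measurable (pot n).
  exact: nonneg_measurable_dyadic_potential bs _ _ _ _ hh.
pose b x n := 2 `^ N * pot n x.
have b0 x n : 0 <= b x n by rewrite mulr_ge0 ?powR_ge0//; exact: (hpot n).2.
have hb n : nonneg_measurable (fun x => b x n).
  by apply: nonneg_measurableM (hpot n); exact: nonneg_measurable_cst (powR_ge0 _ _).
have hbu n : nonneg_measurable (fun x => b x n `^ q * u x).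
  by apply: nonneg_measurableM lu.1; exact: nonneg_measurable_powR.
have u0 := lu.1.2.
have I0 x : (0 <= \int[m]_y (h y * K x y)%:E)%E.
  by apply: integral_ge0 => y _; rewrite lee_fin mulr_ge0 ?K0//; exact: hh.2.
apply: (integral_le_sup (m := m) (a := fun n x => (b x n `^ q * u x)%:E)) => //.
- apply: emeasurable_funM; last exact: nonneg_measurable_EFin lu.1.
  apply: measurable_funTS.
  exact: (measurableT_comp (measurable_poweR q) (measurable_kernel_int m K0 mK hh)).
- by move=> x _; rewrite mule_ge0 ?poweR_ge0// lee_fin.
- by move=> n; exact: nonneg_measurable_EFin (hbu n).
- by move=> n x _; rewrite lee_fin; exact: (hbu n).2.
- move=> x _ n n' nn'; rewrite lee_fin; apply: ler_wpM2r => //.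
  apply: powR_le_lnonneg => //; first exact: ltW.
  apply: ler_wpM2l; first exact: ltW.
  have := @dyadic_sum_nondecreasing R (ball_mass h x) N r.
  by apply=> // t; exact: ball_mass_ge0.
- move=> x _; apply: poweR_ereal_sup_le => //.
  exact: (kernel_int_le_dyadic bs K0 mK K_far K_diag K_bounded x lh r0).
move=> n; have := dyadic h A x0 r n hh A0 hA r0; rewrite -/(pot n) => H.
under eq_integral do rewrite /b powRM ?powR_ge0 ?(hpot n).2// -mulrA EFinM.
have hpu : nonneg_measurable (fun x => pot n x `^ q * u x).
  by apply: nonneg_measurableM lu.1; exact: nonneg_measurable_powR.
rewrite (ge0_integralZl m mB); last 3 first.
- exact: nonneg_measurable_EFin hpu.
- by move=> x _; rewrite lee_fin; exact: hpu.2.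
- by rewrite lee_fin powR_ge0.
have Ct : 0 <= C * A * theta (ball_mass u x0 r) `^ p^-1.
  by rewrite !mulr_ge0 ?powR_ge0// ltW.
rewrite (_ : 2 `^ N * C * A * _ = 2 `^ N * (C * A * theta (ball_mass u x0 r) `^ p^-1)); last by rewrite !mulrA.
rewrite [leRHS](_ : _ = ((2 `^ N) `^ q)%:E *
  ((C * A * theta (ball_mass u x0 r) `^ p^-1) `^ q)%:E)%E; last first.
  by rewrite -EFinM powRM// ltW.
by apply: lee_wpmul2l => //; rewrite lee_fin powR_ge0.
Qed.

End kernel_morrey.

(** * Weights *)

Section integral_monotone.
Context d (T : measurableType d) (R : realType).
Variable m : {measure set T -> \bar R}.
Local Open Scope ereal_scope.

(** The integral of a nonnegative function is a supremum over the simple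
    functions below it, whence monotonicity even for nonmeasurable functions. *)
Lemma ge0_integral_mono (D D' : set T) (f g : T -> \bar R) : D `<=` D' ->
  (forall x, D x -> 0 <= f x) -> (forall x, D' x -> 0 <= g x) ->
  (forall x, D x -> f x <= g x) ->
  \int[m]_(x in D) f x <= \int[m]_(x in D') g x.
Proof.
move=> DD' f0 g0 fg; rewrite !ge0_integralE//.
apply: ereal_sup_le => _ [h hf <-]; exists h => // x.
apply: (le_trans (hf x)); rewrite !patchE.
case: ifPn; rewrite ?inE => Dx.
  by rewrite mem_set; [exact: fg|exact: DD'].
by case: ifPn => //; rewrite inE => D'x; exact: g0.
Qed.

End integral_monotone.

Section weights.
Context d (T : measurableType d) (R : realType)
  (m : {sigma_finite_measure set T -> \bar R}) (dim : R) (B : T -> R -> set T).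
Hypothesis bs : ball_space m dim B.
Hypothesis bounded : forall x y, exists2 r : R, 0 < r & B x r y.
Local Notation ball_int := (ball_int m B).
Local Notation ball_mass := (ball_mass m B).
Local Notation locally_integrable := (locally_integrable m B).
Context (w : T -> R) (p' q C : R).
Hypotheses (hw : nonneg_measurable w) (q0 : 0 < q) (p'0 : 0 < p').
Hypothesis Apq_bound : forall x (r : R), 0 < r ->
  (((m (B x r))^-1 * \int[m]_(y in B x r) (w y `^ q)%:E) `^ q^-1 *
   ((m (B x r))^-1 * \int[m]_(y in B x r) ((w y `^ p')%:E)^-1) `^ p'^-1
   <= C%:E)%E.

Let vol x (r : R) : 0 < r -> exists b : R, [/\ m (B x r) = b%:E & 0 < b].
Proof.
move=> r0; have [c c0 /(_ x r r0)/andP[v1 v2]] := ball_volume bs.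
have cr : 0 < c^-1 * r `^ dim by rewrite mulr_gt0 ?invr_gt0 ?powR_gt0.
move: (m (B x r)) v1 v2 => [b| |]//; rewrite !lee_fin => v1 v2.
by exists b; split => //; exact: lt_le_trans v1.
Qed.

Let finite_dual x (r : R) : 0 < r -> (\int[m]_(y in B x r) (w y `^ q)%:E != 0)%E ->
  (\int[m]_(y in B x r) ((w y `^ p')%:E)^-1 < +oo)%E.
Proof.
move=> r0 U0; have [b [mb b0]] := vol x r0; have := Apq_bound x r0.
rewrite mb inver gt_eqF//.
have Uge0 : (0 <= \int[m]_(y in B x r) (w y `^ q)%:E)%E.
  by apply: integral_ge0 => y _; rewrite lee_fin powR_ge0.
have {U0}U0 : (0 < \int[m]_(y in B x r) (w y `^ q)%:E)%E by rewrite lt_def U0.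
have V0 : (0 < (b^-1%:E * \int[m]_(y in B x r) (w y `^ q)%:E) `^ q^-1)%E.
  by apply: poweR_gt0; rewrite mule_gt0// lte_fin invr_gt0.
rewrite ltNge leye_eq => h; apply/negP => /eqP S.
move: h; rewrite S gt0_muley ?lte_fin ?invr_gt0//.
by rewrite poweRyr ?gt_eqF ?invr_gt0// gt0_muley.
Qed.

Let zero_null x (r : R) : 0 < r ->
  (\int[m]_(y in B x r) ((w y `^ p')%:E)^-1 < +oo)%E ->
  m.-negligible (B x r `&` [set y | w y = 0]).
Proof.
move=> r0 Soo; set Z := [set y | w y = 0].
have mB := measurable_ball_space bs x r.
have mZ : measurable Z.
  rewrite (_ : Z = setT `&` w @^-1` [set 0]); last by rewrite setTI.
  exact: hw.1.
have mBZ : measurable (B x r `&` Z) by exact: measurableI.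
apply/negligibleP => //; apply/eqP/negPn/negP => n0.
move: Soo; rewrite ltNge => /negP; apply.
apply: (@le_trans _ _ (\int[m]_(y in B x r `&` Z) cst +oo y)%E).
  by rewrite integral_cst// gt0_mulye// lt_def n0 measure_ge0.
apply: ge0_integral_mono.
- by move=> y [].
- by move=> y _; rewrite leey.
- by move=> y _; rewrite inve_ge0 lee_fin powR_ge0.
move=> y [_ wy]; by rewrite wy powR0 ?gt_eqF// inve0.
Qed.

(** If [w `^ q] has mass in some ball, it has mass in every larger one, where the
    [A_{p,q}] condition makes the integral of [w `^ (- p')] finite. As that power
    is infinite at the zeros of [w], they form a null set. *)
Lemma weight_dichotomy :
  (forall x r, \int[m]_(y in B x r) (w y `^ q)%:E = 0)%E \/
  {ae m, forall x, 0 < w x}.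
Proof.
have [h|] := pselect (forall x r, \int[m]_(y in B x r) (w y `^ q)%:E = 0)%E; first by left.
move=> /existsNP[x0 /existsNP[r0 /eqP U0]]; right.
have hu := nonneg_measurable_powR q hw.
pose r n := Num.max r0 1 + n%:R.
have rn0 n : 0 < r n by rewrite ltr_wpDr// lt_max ltr01 orbT.
have Un n : (\int[m]_(y in B x0 (r n)) (w y `^ q)%:E != 0)%E.
  have := le_ball_int bs hu (ball_mono bs (_ : r0 <= r n)) .
  move=> /(_ x0); rewrite !ball_int.unlock => h.
  have Uge0 : (0 <= \int[m]_(y in B x0 r0) (w y `^ q)%:E)%E.
    by apply: integral_ge0 => y _; rewrite lee_fin powR_ge0.
  rewrite gt_eqF//; apply: lt_le_trans (h _); first by rewrite lt_def U0.
  by rewrite /r ler_wpDr// le_max lexx.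
have neg n : m.-negligible (B x0 (r n) `&` [set y | w y = 0]).
  exact/zero_null/finite_dual.
apply: negligibleS (negligible_bigcup neg) => y /= /negP.
rewrite -leNgt => wy.
have [t t0 xty] := bounded x0 y.
exists (Num.truncn t).+1 => //; split.
  apply: (ball_mono bs) xty; apply/ltW/(lt_le_trans (truncnS_gt t)).
  by rewrite /r lerDr le_max ler01 orbT.
by apply/eqP; rewrite eq_le wy hw.2.
Qed.

Hypothesis w_pos : {ae m, forall x, 0 < w x}.

(** A representative of the weight without zeros, for which real powers with a
    negative exponent agree with the extended ones. *)
Definition positive_weight x := if w x == 0 then 1 else w x.
Local Notation w1 := positive_weight.

Lemma positive_weight_gt0 x : 0 < w1 x.
Proof.
rewrite /positive_weight; case: eqVneq => // wx.
by rewrite lt_def wx hw.2.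
Qed.

Lemma positive_weight_ae : {ae m, forall x, w1 x = w x}.
Proof.
apply: filterS w_pos => x wx.
by rewrite /positive_weight gt_eqF.
Qed.

Lemma nonneg_measurable_positive_weight : nonneg_measurable w1.
Proof.
split; last by move=> x; exact/ltW/positive_weight_gt0.
apply: measurable_fun_ifT => //; last exact: hw.1.
by apply: measurable_fun_eqr => //; exact: hw.1.
Qed.

Lemma ball_int_positive_weight x r (f g : T -> R) : nonneg_measurable f ->
  nonneg_measurable g -> {ae m, forall y, f y = g y} ->
  ball_int f x r = ball_int g x r.
Proof.
move=> hf hg fg; rewrite !ball_int.unlock; apply: ge0_ae_eq_integral.
- exact: (measurable_ball_space bs).
- exact: nonneg_measurable_EFin.
- exact: nonneg_measurable_EFin.
- by move=> y _; rewrite lee_fin; exact: hf.2.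
- by move=> y _; rewrite lee_fin; exact: hg.2.
- by apply: filterS fg => y fgy _; rewrite fgy.
Qed.

Let u1 := (fun x => w1 x `^ q).
Let s1 := (fun x => w1 x `^ (- p')).

Let hu1 : nonneg_measurable u1.
Proof. exact/nonneg_measurable_powR/nonneg_measurable_positive_weight. Qed.
Let hs1 : nonneg_measurable s1.
Proof. exact/nonneg_measurable_powR/nonneg_measurable_positive_weight. Qed.

Lemma ball_int_weight x r : ball_int (fun x => w1 x `^ q) x r =
  (\int[m]_(y in B x r) (w y `^ q)%:E)%E.
Proof.
have hu := nonneg_measurable_powR q hw.
transitivity (ball_int (fun y => w y `^ q) x r); last by rewrite ball_int.unlock.
apply: ball_int_positive_weight => //.
by apply: filterS positive_weight_ae => y ->.
Qed.

Let ball_int_gt0 f x (r : R) : nonneg_measurable f -> (forall y, 0 < f y) ->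
  0 < r -> (0 < ball_int f x r)%E.
Proof.
move=> hf f0 r0; have [b [mb b0]] := vol x r0.
have mB := measurable_ball_space bs x r.
rewrite lt_def ball_int_ge0// andbT ball_int.unlock; apply/eqP => I0.
have mf := nonneg_measurable_EFin (D := B x r) hf.
have : (\int[m]_(y in B x r) `|(f y)%:E| = 0)%E.
  rewrite -[RHS]I0; apply: eq_integral => y _.
  by rewrite gee0_abs// lee_fin; exact: hf.2.
move/(ae_eq_integral_abs m mB mf).1 => fae.
have : m.-negligible (B x r).
  apply: negligibleS fae => y By /= /(_ By)/eqP.
  by rewrite eqe gt_eqF.
move=> /(measure_negligible mB) mB0.
by move: mb; rewrite mB0 => -[] b00; move: b0; rewrite -b00 ltxx.
Qed.

Let u1_gt0 y : 0 < u1 y.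
Proof. by apply: powR_gt0; exact: positive_weight_gt0. Qed.
Let s1_gt0 y : 0 < s1 y.
Proof. by apply: powR_gt0; exact: positive_weight_gt0. Qed.

Let s1_le x (r : R) :
  (ball_int s1 x r <= \int[m]_(y in B x r) ((w y `^ p')%:E)^-1)%E.
Proof.
have mZ : measurable [set y | w y != 0].
  rewrite (_ : mkset _ = setT `&` w @^-1` [set~ 0]).
    by apply: hw.1 => //; exact: measurableC.
  by rewrite setTI; apply/seteqP; split => y /= /eqP.
have hg := nonneg_measurableM hs1 (nonneg_measurable_indic (R := R) mZ).
rewrite (ball_int_positive_weight x r hs1 hg); last first.
  apply: filterS w_pos => y wy.
  by rewrite indicE mem_set ?mulr1//= gt_eqF.
rewrite ball_int.unlock; apply: ge0_integral_mono => //.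
- by move=> y _; rewrite lee_fin; exact: hg.2.
- by move=> y _; rewrite inve_ge0 lee_fin powR_ge0.
move=> y _; rewrite indicE; case: (boolP (y \in _)); last first.
  by move=> _; rewrite mulr0 inve_ge0 lee_fin powR_ge0.
rewrite inE/= => wy; rewrite mulr1.
have wp : 0 < w y `^ p' by rewrite powR_gt0// lt_def wy hw.2.
by rewrite inver gt_eqF// lee_fin /s1 /positive_weight (negbTE wy) powRN.
Qed.

Let U_neq0 x (r : R) : 0 < r -> (\int[m]_(y in B x r) (w y `^ q)%:E != 0)%E.
Proof. by move=> r0; rewrite -ball_int_weight gt_eqF// ball_int_gt0. Qed.

Let U_finite x (r : R) : 0 < r -> (ball_int u1 x r < +oo)%E.
Proof.
move=> r0; have [b [mb b0]] := vol x r0; have := Apq_bound x r0.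
rewrite mb inver gt_eqF// -ball_int_weight.
have S0 : (0 < \int[m]_(y in B x r) ((w y `^ p')%:E)^-1)%E.
  by apply: lt_le_trans (s1_le x r); exact: ball_int_gt0.
have V0 : (0 < (b^-1%:E * \int[m]_(y in B x r) ((w y `^ p')%:E)^-1) `^ p'^-1)%E.
  by apply: poweR_gt0; rewrite mule_gt0// lte_fin invr_gt0.
rewrite ltNge leye_eq => h; apply/negP => /eqP U.
move: h; rewrite U gt0_muley ?lte_fin ?invr_gt0//.
by rewrite poweRyr ?gt_eqF ?invr_gt0// gt0_mulye.
Qed.

Let loc f : nonneg_measurable f ->
  (forall x (r : R), 0 < r -> (ball_int f x r < +oo)%E) -> locally_integrable f.
Proof.
move=> hf foo; split=> // x r; have [r0|r0] := ltP 0 r; first exact: foo.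
apply: le_lt_trans (foo x 1 ltr01).
by apply: (le_ball_int bs hf); apply: (ball_mono bs); rewrite (le_trans r0).
Qed.

Lemma locally_integrable_weight : locally_integrable (fun x => w1 x `^ q).
Proof. by apply: loc => // x r r0; exact: U_finite. Qed.

Lemma locally_integrable_dual_weight :
  locally_integrable (fun x => w1 x `^ (- p')).
Proof.
apply: loc => // x r r0; apply: le_lt_trans (s1_le x r) _.
exact: finite_dual (U_neq0 x r0).
Qed.

Lemma weight_mass_gt0 x (r : R) : 0 < r ->
  0 < fine (\int[m]_(y in B x r) (w y `^ q)%:E)%E.
Proof.
move=> r0; apply: fine_gt0.
by rewrite -ball_int_weight ball_int_gt0//=; exact: U_finite.
Qed.

(** The averages in the [A_{p,q}] condition become masses once multiplied by the
    power [lam + mu] of the volume. The lower bound is Hoelder's inequality with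
    the exponents [lam / (lam + mu)] and [mu / (lam + mu)], for which the product
    of the powers of the two densities is one. *)
Lemma balanced_weights : 0 < C ->
  balanced m dim B (fun x => w1 x `^ q) (fun x => w1 x `^ (- p')) q^-1 p'^-1.
Proof.
move=> C0; have [c c0 hvol] := ball_volume bs.
have lu := locally_integrable_weight; have ls := locally_integrable_dual_weight.
set lam := q^-1; set mu := p'^-1.
have lam0 : 0 < lam by rewrite invr_gt0.
have mu0 : 0 < mu by rewrite invr_gt0.
have lm0 : 0 < lam + mu by exact: addr_gt0.
pose k := c `^ (lam + mu); have k0 : 0 < k by exact: powR_gt0.
exists (k * Num.max 1 C); first by rewrite mulr_gt0// lt_max ltr01.
move=> x r r0; have [b [mb b0]] := vol x r0.
have := hvol x r r0; rewrite mb !lee_fin => /andP[v1 v2].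
have rN0 : 0 < r `^ (dim * (lam + mu)) by exact: powR_gt0.
have rd0 : 0 < r `^ dim by exact: powR_gt0.
have blow : k^-1 * r `^ (dim * (lam + mu)) <= b `^ (lam + mu).
  apply: le_trans (powR_le_lnonneg (ltW lm0) _ v1); last first.
    by rewrite mulr_ge0// ?invr_ge0 ltW.
  rewrite powRM ?invr_ge0 ?(ltW c0) ?(ltW rd0)// -powRrM.
  by rewrite -[c^-1]powR_inv1 ?(ltW c0)// -powRrM mulN1r powRN.
have bup : b `^ (lam + mu) <= k * r `^ (dim * (lam + mu)).
  apply: le_trans (powR_le_lnonneg (ltW lm0) (ltW b0) v2) _.
  by rewrite powRM ?(ltW c0) ?(ltW rd0)// -powRrM.
have m1 : 1 <= Num.max 1 C by rewrite le_max lexx.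
have mC : C <= Num.max 1 C by rewrite le_max lexx orbT.
set M := Num.max 1 C in m1 mC *.
have M0 : 0 < M := lt_le_trans ltr01 m1.
set U := ball_mass _ x r; set S := ball_mass (fun x => w1 x `^ (- p')) x r.
have UE : U%:E = ball_int u1 x r by exact: ball_massE.
have SE : S%:E = ball_int s1 x r by exact: ball_massE.
clearbody U S.
have U0 : 0 < U by rewrite -lte_fin UE ball_int_gt0.
have S0 : 0 < S by rewrite -lte_fin SE ball_int_gt0.
split.
  apply: (@le_trans _ _ (b `^ (lam + mu))).
    apply: le_trans blow; apply: ler_wpM2r; first exact: ltW.
    by rewrite lef_pV2 ?posrE ?mulr_gt0// ler_peMr// ltW.
  have mB := measurable_ball_space bs x r.
  pose e1 := lam / (lam + mu); pose e2 := mu / (lam + mu).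
  have e10 : 0 < e1 by rewrite divr_gt0.
  have e20 : 0 < e2 by rewrite divr_gt0.
  have e12 : e1 + e2 = 1 by rewrite -mulrDl mulfV// gt_eqF.
  have := hoelder_geometric m mB hu1.1 hs1.1 hu1.2 hs1.2 e10 e20 e12.
  rewrite (eq_integral (cst 1%E)); last first.
    move=> y _; congr EFin; rewrite /u1 /s1 -!powRrM.
    rewrite -powRDg; last exact: positive_weight_gt0.
    rewrite (_ : _ + _ = 0) ?powRr0// /e1 /e2 /lam /mu.
    by rewrite mulNr !mulVKf ?gt_eqF// subrr.
  have -> : (\int[m]_(y in B x r) cst 1 y = b%:E)%E.
    by have := ball_int1 bs x r; rewrite mb ball_int.unlock.
  have -> : (\int[m]_(y in B x r) (u1 y)%:E = U%:E)%E by rewrite UE ball_int.unlock.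
  have -> : (\int[m]_(y in B x r) (s1 y)%:E = S%:E)%E by rewrite SE ball_int.unlock.
  rewrite !poweR_EFin -EFinM lee_fin => h.
  have := powR_le_lnonneg (ltW lm0) (ltW b0) h.
  rewrite powRM; [|exact: powR_ge0|exact: powR_ge0].
  have e1K : e1 * (lam + mu) = lam by rewrite /e1 divfK ?gt_eqF.
  have e2K : e2 * (lam + mu) = mu by rewrite /e2 divfK ?gt_eqF.
  by rewrite -!powRrM e1K e2K.
apply: (@le_trans _ _ (C * b `^ (lam + mu))); last first.
  rewrite mulrAC; apply: (@le_trans _ _ (M * (k * r `^ (dim * (lam + mu))))).
    by apply: ler_pM => //; [exact: ltW|exact: powR_ge0].
  by rewrite mulrC.
have := Apq_bound x r0; rewrite mb inver gt_eqF// -ball_int_weight -UE => h.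
have : (((b^-1)%:E * U%:E) `^ lam * ((b^-1)%:E * S%:E) `^ mu <= C%:E)%E.
  apply: le_trans h; apply: lee_wpmul2l; first exact: poweR_ge0.
  have bV0 : (0 <= (b^-1)%:E :> \bar R)%E by rewrite lee_fin invr_ge0 ltW.
  have le_S : (S%:E <= \int[m]_(y in B x r) ((w y `^ p')%:E)^-1)%E.
    by rewrite SE; exact: s1_le.
  have S0' : (0 <= S%:E :> \bar R)%E by rewrite lee_fin ltW.
  apply: gt0_ler_poweR; first exact: ltW.
  - by rewrite in_itv/= leey andbT mule_ge0.
  - by rewrite in_itv/= leey andbT mule_ge0// (le_trans S0').
  - exact: lee_wpmul2l.
rewrite -[X in (X <= _)%E]/((b^-1 * U) `^ lam * (b^-1 * S) `^ mu)%:E lee_fin.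
have bV : 0 <= b^-1 by rewrite invr_ge0 ltW.
rewrite !powRM ?(ltW U0) ?(ltW S0)// (powRDg _ _ b0).
rewrite -[b^-1]powR_inv1 ?(ltW b0)// -!powRrM !mulN1r !powRN.
have := powR_gt0 lam b0; have := powR_gt0 mu b0.
move: (b `^ lam) (b `^ mu) (U `^ lam) (S `^ mu) => b1 b2 x1 x2 b20 b10.
rewrite (_ : _ * _ * _ = (x1 * x2) / (b1 * b2)); last by field; rewrite !gt_eqF.
by rewrite ler_pdivrMr// mulr_gt0.
Qed.

End weights.

(** * Weighted Morrey bounds for kernels *)

Section kernel_weight.
Context d (T : measurableType d) (R : realType)
  (m : {sigma_finite_measure set T -> \bar R}) (dim : R) (B : T -> R -> set T).
Hypothesis bs : ball_space m dim B.
Hypothesis bounded : forall x y, exists2 r : R, 0 < r & B x r y.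
Context (w : T -> R) (p q kappa C : R) (theta : R -> R).
Local Notation p' := (conj_exp p).
Hypotheses (hw : nonneg_measurable w) (C0 : 0 < C) (p1 : 1 < p) (q0 : 0 < q)
  (q1 : q^-1 < p^-1).
Hypothesis Apq_bound : forall x (r : R), 0 < r ->
  (((m (B x r))^-1 * \int[m]_(y in B x r) (w y `^ q)%:E) `^ q^-1 *
   ((m (B x r))^-1 * \int[m]_(y in B x r) ((w y `^ p')%:E)^-1) `^ p'^-1
   <= C%:E)%E.
Hypothesis w_pos : {ae m, forall x, 0 < w x}.
Hypotheses (kappa0 : 0 <= kappa) (kappa1 : kappa < p / q)
  (thetaD : Dkappa kappa theta).
Local Notation N := (dim * (q^-1 + (1 - p^-1))).
Context (K : T -> T -> R).
Hypotheses (K0 : forall x y, 0 <= K x y)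
  (mK : measurable_fun setT (fun z : T * T => K z.1 z.2))
  (K_far : forall x y (r : R), 0 < r -> ~ B x r y -> K x y <= r `^ (- N))
  (K_diag : forall x y, 0 < K x y -> exists2 r : R, 0 < r & ~ B x r y).

Let p0 : 0 < p. Proof. exact: lt_trans ltr01 p1. Qed.

(* Where [f] is infinite and [w] positive, the integrand is infinite. *)
Let ae_fin_num (f : T -> \bar R) (x0 : T) : measurable_fun setT f ->
  (forall r : R, (0 < r)%R ->
    \int[m]_(y in B x0 r) (`|f y| `^ p * (w y `^ p)%:E) < +oo)%E ->
  {ae m, forall y, (`|f y| \is a fin_num)%E}.
Proof.
move=> mf foo; have hwp := nonneg_measurable_powR p hw.
pose g y := (`|f y| `^ p * (w y `^ p)%:E)%E.
have g0 y : (0 <= g y)%E by rewrite mule_ge0 ?poweR_ge0// lee_fin powR_ge0.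
have mg : measurable_fun setT g.
  apply: emeasurable_funM; last exact: nonneg_measurable_EFin.
  apply: (measurableT_comp (measurable_poweR p)).
  exact: measurableT_comp.
have ae_n (n : nat) : {ae m, forall y, B x0 n.+1%:R y -> g y \is a fin_num}.
  have mB := measurable_ball_space bs x0 n.+1%:R.
  apply: (integrable_ae mB); apply/integrableP; split.
    exact: measurable_funTS.
  under eq_integral do rewrite gee0_abs//.
  by apply: foo; rewrite ltr0n.
have := ae_foralln ae_n; move=> ae_all.
apply: filterS2 w_pos ae_all => y wy gy.
have [r r0 xry] := bounded x0 y.
have : g y \is a fin_num.
  apply: (gy (Num.truncn r)); apply: (ball_mono bs) xry.
  exact/ltW/truncnS_gt.
rewrite /g; have := abse_ge0 (f y); case: (`|f y|)%E => [t| |]// _.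
by rewrite poweRyr ?gt_eqF// gt0_mulye// lte_fin powR_gt0.
Qed.

(** [kernel_morrey_bound] for the densities of a weight that is positive almost
    everywhere. The function [f], finite almost everywhere, is replaced by a real
    one and [w] by its positive representative, which changes no integral. *)
Lemma kernel_weight_bound : exists2 C' : R, 0 < C' &
  forall (f : T -> \bar R) (A : R), measurable_fun setT f -> 0 < A ->
    (forall x (r : R), (0 < r)%R ->
      \int[m]_(y in B x r) (`|f y| `^ p * (w y `^ p)%:E) <=
      (A `^ p * theta (fine (\int[m]_(y in B x r) (w y `^ q)%:E)))%:E)%E ->
    forall x0 (r : R), 0 < r ->
      (\int[m]_(x in B x0 r)
        ((\int[m]_y (`|f y| * (K x y)%:E)) `^ q * (w x `^ q)%:E) <=
      ((C' * A * theta (fine (\int[m]_(y in B x0 r) (w y `^ q)%:E)) `^ p^-1)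
        `^ q)%:E)%E.
Proof.
have pV1 : p^-1 < 1 by rewrite invf_lt1.
have pV0 : 0 < p^-1 by rewrite invr_gt0.
have qV0 : 0 < q^-1 by rewrite invr_gt0.
have mu0 : 0 < 1 - p^-1 by rewrite subr_gt0.
have p'0 : 0 < p' by rewrite invr_gt0.
have p'V : p'^-1 = 1 - p^-1 by rewrite /conj_exp invrK.
have lu := locally_integrable_weight bs hw q0 Apq_bound w_pos.
have ls := locally_integrable_dual_weight bs hw p'0 Apq_bound w_pos.
have bal := balanced_weights bs hw q0 p'0 Apq_bound w_pos C0.
rewrite p'V in bal.
pose r' := (1 - q^-1)^-1.
have qV1 : 0 < 1 - q^-1 by rewrite subr_gt0 (lt_trans q1).
have r'1 : 1 < r' by rewrite -[ltLHS]invr1 ltf_pV2 ?posrE// gtrBl.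
have lamE : q^-1 = 1 - r'^-1 by rewrite invrK; ring.
have lammu : q^-1 + (1 - p^-1) < 1 by have h := q1; lra.
have s_pos x : 0 < positive_weight w x `^ (- p').
  by apply: powR_gt0; exact: positive_weight_gt0.
have K_bounded := bounded.
have [C1 C10 main] := kernel_morrey_bound bs lu ls bal s_pos p1 r'1 erefl lamE
  lammu kappa0 kappa1 thetaD K0 mK K_far K_diag K_bounded.
exists C1 => // f A mf A0 hf x0 r r0.
have foo x (t : R) : (0 < t)%R ->
    (\int[m]_(y in B x t) (`|f y| `^ p * (w y `^ p)%:E) < +oo)%E.
  by move=> t0; apply: le_lt_trans (hf x t t0) _; rewrite ltry.
have ffin := ae_fin_num mf (foo x0).
pose h y := fine `|f y|%E.
have mabs : measurable_fun setT (fun y => `|f y|)%E by exact: measurableT_comp.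
have hh : nonneg_measurable h.
  by split; [exact: measurableT_comp|move=> y; exact: fine_ge0].
have w1_0 := positive_weight_gt0 hw.
have hw1 := nonneg_measurable_positive_weight hw.
have w1E := positive_weight_ae w_pos.
have hA : morrey_bound m B (fun x => positive_weight w x `^ q)
    (fun x => positive_weight w x `^ (- p')) p theta h A.
  move=> x t t0.
  have -> : ball_mass m B (fun x => positive_weight w x `^ q) x t =
      fine (\int[m]_(y in B x t) (w y `^ q)%:E).
    by rewrite ball_mass.unlock (ball_int_weight bs q hw w_pos).
  apply: le_trans (hf x t t0); rewrite le_eqVlt; apply/orP; left; apply/eqP.
  have mB := measurable_ball_space bs x t.
  have hE y : (h y / positive_weight w y `^ (- p')) `^ p *
      positive_weight w y `^ (- p') = h y `^ p * positive_weight w y `^ p.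
    rewrite -powRN opprK powRM ?powR_ge0//; last exact: hh.2.
    rewrite -mulrA -powRrM -powRDg//; congr (_ * _ `^ _).
    rewrite /conj_exp; field; rewrite gt_eqF//=.
    by rewrite gt_eqF// subr_gt0.
  rewrite (_ : ball_int _ _ _ _ _ =
      ball_int m B (fun y => h y `^ p * positive_weight w y `^ p) x t); last first.
    by apply: ball_int_eq_fun => y _; exact: hE.
  have hg := nonneg_measurableM (nonneg_measurable_powR p hh)
    (nonneg_measurable_powR p hw1).
  rewrite ball_int.unlock; apply: ge0_ae_eq_integral => //.
  - exact: nonneg_measurable_EFin hg.
  - apply: measurable_funTS; apply: emeasurable_funM.
      exact: (measurableT_comp (measurable_poweR p) mabs).
    exact: nonneg_measurable_EFin (nonneg_measurable_powR p hw).
  - by move=> y _; rewrite lee_fin; exact: hg.2.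
  - by move=> y _; rewrite mule_ge0 ?poweR_ge0// lee_fin powR_ge0.
  apply: filterS2 ffin w1E => y fy -> _; rewrite EFinM /h.
  by rewrite -{2}(fineK fy) poweR_EFin.
have := main h A x0 r hh A0 hA r0.
have -> : ball_mass m B (fun x => positive_weight w x `^ q) x0 r =
    fine (\int[m]_(y in B x0 r) (w y `^ q)%:E).
  by rewrite ball_mass.unlock (ball_int_weight bs q hw w_pos).
rewrite invrK; apply: le_trans; rewrite le_eqVlt; apply/orP; left; apply/eqP.
have hK x : nonneg_measurable (fun y => h y * K x y).
  apply: (nonneg_measurableM hh); split; last by move=> y; exact: K0.
  exact: (measurableT_comp mK (measurable_pair1 x)).
have IE x : (\int[m]_y (`|f y| * (K x y)%:E) = \int[m]_y (h y * K x y)%:E)%E.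
  apply: ge0_ae_eq_integral => //.
  - apply: emeasurable_funM => //; apply/measurable_EFinP.
    exact: (measurableT_comp mK (measurable_pair1 x)).
  - exact: nonneg_measurable_EFin (hK x).
  - by move=> y _; rewrite mule_ge0// lee_fin.
  - by move=> y _; rewrite lee_fin; exact: (hK x).2.
  by apply: filterS ffin => y fy _; rewrite EFinM fineK.
under eq_integral do rewrite IE.
have mI := measurable_kernel_int m K0 mK hh.
have mIq : measurable_fun setT (fun x => (\int[m]_y (h y * K x y)%:E) `^ q)%E.
  exact: (measurableT_comp (measurable_poweR q) mI).
apply: ge0_ae_eq_integral => //.
- exact: (measurable_ball_space bs).
- apply: measurable_funTS; apply: emeasurable_funM => //.
  exact: nonneg_measurable_EFin (nonneg_measurable_powR q hw).
- apply: measurable_funTS; apply: emeasurable_funM => //.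
  exact: nonneg_measurable_EFin (nonneg_measurable_powR q hw1).
- by move=> x _; rewrite mule_ge0 ?poweR_ge0// lee_fin powR_ge0.
- by move=> x _; rewrite mule_ge0 ?poweR_ge0// lee_fin powR_ge0.
by apply: filterS w1E => x -> _.
Qed.

End kernel_weight.

(** * The Riesz potential *)

Lemma measurable_integral_section d (T : measurableType d) (R : realType)
    (m : {sigma_finite_measure set T -> \bar R}) (G : T * T -> \bar R) :
  measurable_fun setT G ->
  measurable_fun setT (fun x => \int[m]_y G (x, y))%E.
Proof.
move=> mG; rewrite (_ : (fun x => _) =
    (fun x => fubini_F m G^\+ x - fubini_F m G^\- x)%E).
  apply: emeasurable_funB.
  - by apply: measurable_fun_fubini_tonelli_F => //; exact: measurable_funepos.
  - by apply: measurable_fun_fubini_tonelli_F => //; exact: measurable_funeneg.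
apply/funext => x; rewrite /fubini_F [LHS]integralE.
by congr (_ - _)%E; apply: eq_integral => y _; rewrite ?funeposE ?funenegE.
Qed.

Definition leb_measure (R : realType) (n : nat) :
  {sigma_finite_measure set (euclid R n) -> \bar R} := @leb R n.

Section euclid_ball_space.
Context {R : realType} {n : nat}.
Hypothesis n0 : (0 < n)%N.
Local Notation E := (euclid R n).

Lemma eball_annulus (x : E) (r : R) : 0 < r -> exists y : E,
  [/\ eball y (r / 2) `<=` eball x (2 * r), eball x r `&` eball y (r / 2) = set0
    & eball x (2 * r) `<=` eball y (4 * r)].
Proof.
move=> r0; pose i0 := Ordinal n0.
(* at distance [3 / 2 * r] along the first axis, which exists as [0 < n] *)
pose y : 'rV[R]_n :=
  \row_i ((x : 'rV[R]_n) ord0 i + (i == i0)%:R * (3 / 2 * r)).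
have dxy : eucl_dist x y = 3 / 2 * r.
  rewrite /eucl_dist (bigD1 i0)//= big1 ?addr0 => [|i /negbTE ii0].
    rewrite mxE eqxx mul1r opprD addNKr sqrrN sqrtr_sqr ger0_norm//.
    by rewrite mulr_ge0 ?ltW.
  by rewrite mxE ii0 mul0r addr0 subrr expr0n.
exists y; split.
- by apply: sub_eball; rewrite dxy; lra.
- apply/seteqP; split => // z [xz yz].
  have := eucl_dist_triangle z x y; rewrite dxy (eucl_distC z y).
  by move: xz yz; rewrite /eball/=; lra.
- by apply: sub_eball; rewrite eucl_distC dxy; lra.
Qed.

Lemma euclid_ball_space :
  ball_space (leb_measure R n) n%:R (@eball R n).
Proof.
split.
- by move=> x y r; rewrite eballC.
- move=> x y r s xy; apply: sub_eball; rewrite lerD2r; exact: ltW.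
- by move=> x r s rs; apply: sub_eball; rewrite eucl_distxx add0r.
- exact: eball_annulus.
- exact: measurable_eball_rel.
have nn0 : 0 < n%:R :> R by rewrite ltr0n.
exists (2 ^+ n + n%:R ^+ n); first by rewrite addr_gt0 ?exprn_gt0.
move=> x r r0; rewrite (powR_mulrn _ (ltW r0)); apply/andP; split.
  apply: le_trans (leb_eball_ge x n0 r0); rewrite lee_fin ler_pM2r ?exprn_gt0//.
  rewrite exprVn lef_pV2 ?posrE ?addr_gt0 ?exprn_gt0// lerDr.
  by rewrite exprn_ge0.
apply: le_trans (leb_eball_le x r0) _; rewrite lee_fin ler_pM2r ?exprn_gt0//.
by rewrite lerDl exprn_ge0// (ltW nn0).
Qed.

Lemma eball_bounded (x y : E) : exists2 r : R, 0 < r & eball x r y.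
Proof.
exists (eucl_dist x y + 1); first by rewrite ltr_wpDl ?eucl_dist_ge0.
by rewrite /eball/= ltrDl.
Qed.

(** The topology is that of the sup norm, for which compact sets are bounded. *)
Lemma compact_sub_eball (K : set E) : compact K ->
  exists2 M : R, 0 < M & K `<=` eball (0 : 'rV[R]_n) M.
Proof.
move=> cK; have [M0 [_ hM]] := compact_bounded (cK : compact (K : set 'rV[R]_n)).
pose M := `|M0| + 1; have M0M : M0 < M by rewrite ltr_pwDr// ler_norm.
have Mgt0 : 0 < M by rewrite ltr_wpDl.
exists (n%:R * M + 1); first by rewrite ltr_wpDl// mulr_ge0// (ltW Mgt0).
move=> x Kx; rewrite /eball/=.
apply: (@le_lt_trans _ _ (n%:R * M)); last by rewrite ltrDl.
apply: eucl_dist_le_coord; first exact: ltW.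
move=> i; rewrite mxE sub0r normrN; apply: le_trans (hM M M0M x Kx).
rewrite -[`|x|]/(mx_norm (x : 'rV[R]_n)) mx_normrE.
exact: (le_bigmax _ (fun ij => `|(x : 'rV[R]_n) ij.1 ij.2|) (ord0, i)).
Qed.

End euclid_ball_space.

Section riesz_potential.
Context {R : realType} {n : nat}.
Local Notation E := (euclid R n).
Implicit Types (a : R) (f : E -> \bar R).

Definition riesz_kernel a (x y : E) : R := (eucl_dist x y `^ (n%:R - a))^-1.

Lemma riesz_kernel_ge0 a x y : 0 <= riesz_kernel a x y.
Proof. by rewrite invr_ge0 powR_ge0. Qed.

Lemma measurable_riesz_kernel a :
  measurable_fun setT (fun z : E * E => riesz_kernel a z.1 z.2).
Proof.
rewrite (_ : (fun z => _) =
    (fun z : E * E => eucl_dist z.1 z.2 `^ (- (n%:R - a)))); last first.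
  by apply/funext => z; rewrite powRN.
apply: (measurableT_comp (measurable_powR _)).
exact: (measurable_eucl_dist measurable_fst measurable_snd).
Qed.

Lemma riesz_kernel_far a x y (r : R) : a < n%:R -> 0 < r -> ~ eball x r y ->
  riesz_kernel a x y <= r `^ (- (n%:R - a)).
Proof.
move=> an r0 /negP; rewrite -leNgt => rxy; rewrite powRN /riesz_kernel.
rewrite lef_pV2 ?posrE ?powR_gt0//; last exact: lt_le_trans rxy.
by apply: ge0_ler_powR; rewrite ?nnegrE ?subr_ge0 ?eucl_dist_ge0// ltW.
Qed.

(** The real power of [0] and the inverse of [0] are both [0], so the kernel
    vanishes on the diagonal. *)
Lemma riesz_kernel_diag a x y : a < n%:R -> 0 < riesz_kernel a x y ->
  exists2 r : R, 0 < r & ~ eball x r y.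
Proof.
move=> an; have [d0|dn0] := eqVneq (eucl_dist x y) 0.
  by rewrite /riesz_kernel d0 powR0 ?invr0 ?ltxx// gt_eqF// subr_gt0.
exists (eucl_dist x y); first by rewrite lt_def dn0 eucl_dist_ge0.
by rewrite /eball/= ltxx.
Qed.

(** The integrand is a measurable function of both variables; where the positive
    and negative parts of the integral are both infinite, their difference still
    depends measurably on the point. *)
Lemma measurable_riesz a f : measurable_fun setT f ->
  measurable_fun setT (riesz a f).
Proof.
move=> mf; apply: emeasurable_funM; first exact: measurable_cst.
pose G (z : E * E) := (f z.2 * (riesz_kernel a z.1 z.2)%:E)%E.
have mG : measurable_fun setT G.
  apply: emeasurable_funM; first exact: (measurableT_comp mf measurable_snd).
  by apply/measurable_EFinP; exact: measurable_riesz_kernel.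
exact: (measurable_integral_section (leb_measure R n) mG).
Qed.

Lemma abse_riesz_le a f x : measurable_fun setT f ->
  (`|riesz a f x| <=
   `|(riesz_const n a)^-1|%:E * \int[leb]_y (`|f y| * (riesz_kernel a x y)%:E))%E.
Proof.
move=> mf; rewrite /riesz abseM; apply: lee_wpmul2l => //.
rewrite (_ : integral _ _ (fun y => `|f y| * _)%E =
    \int[leb]_y `|f y * (riesz_kernel a x y)%:E|)%E; last first.
  apply: eq_integral => y _; rewrite abseM/= ger0_norm//.
  exact: riesz_kernel_ge0.
have mg : measurable_fun setT (fun y => f y * (riesz_kernel a x y)%:E)%E.
  apply: emeasurable_funM; [exact: mf|apply/measurable_EFinP].
  exact: (measurableT_comp (measurable_riesz_kernel a) (measurable_pair1 x)).
exact: (le_abse_integral (leb_measure R n) measurableT mg).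
Qed.

End riesz_potential.

Section normalized_power.
Context {R : realType}.
Implicit Types (x : \bar R) (c t A : R).

Lemma le_of_poweR_scaled_le x c t A : 0 < c -> 0 < t -> 0 <= A -> (0 <= x)%E ->
  (((c^-1)%:E * x) `^ t^-1 <= A%:E)%E -> (x <= (A `^ t * c)%:E)%E.
Proof.
move=> c0 t0 A0; case: x => [x| |]// x0.
  rewrite lee_fin in x0; rewrite poweR_EFin !lee_fin => h; rewrite -ler_pdivrMr// mulrC.
  have y0 : 0 <= c^-1 * x by rewrite mulr_ge0 ?invr_ge0// (ltW c0).
  have := powR_le_lnonneg (ltW t0) (powR_ge0 _ _) h.
  by rewrite -powRrM mulVf ?gt_eqF// powRr1.
by rewrite gt0_muley ?lte_fin ?invr_gt0// poweRyr ?gt_eqF ?invr_gt0.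
Qed.

(** For [c = 0] the normalising factor [c^-1] is [0]; this may occur for a
    weight that vanishes almost everywhere, where [theta] is evaluated at [0]. *)
Lemma poweR_scaled_le x c t A : 0 <= c -> 0 < t -> 0 <= A -> (0 <= x)%E ->
  (x <= (A `^ t * c)%:E)%E -> (((c^-1)%:E * x) `^ t^-1 <= A%:E)%E.
Proof.
rewrite le_eqVlt => /predU1P[<-|c0] t0 A0.
  by move=> _ _; rewrite invr0 mul0e poweR0r ?gt_eqF ?invr_gt0// lee_fin.
case: x => [x| |]// x0.
rewrite lee_fin in x0; rewrite poweR_EFin !lee_fin => h.
rewrite -[leRHS]powRr1// -[1](@mulfV _ t) ?gt_eqF// powRrM.
apply: powR_le_lnonneg; first by rewrite invr_ge0 (ltW t0).
  by rewrite mulr_ge0 ?invr_ge0// (ltW c0).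
by rewrite mulrC ler_pdivrMr.
Qed.

End normalized_power.

Section riesz_morrey.
Context (R : realType) (n : nat) (a p q kappa : R) (theta : R -> R)
  (w : euclid R n -> R).
Hypotheses (a0 : 0 < a) (an : a < n%:R) (p1 : 1 < p) (pna : p < n%:R / a)
  (qE : q^-1 = p^-1 - a / n%:R) (wA : Apq p q w) (kappa0 : 0 <= kappa)
  (kappapq : kappa < p / q) (thetaD : Dkappa kappa theta).
Local Notation E := (euclid R n).
Local Notation leb := (leb_measure R n).
Local Notation theta_q := (fun xi => theta xi `^ (q / p)).
Local Notation mass x r := (fine (wmeas (wpow w q) (eball x r))).

Let nR0 : 0 < n%:R :> R. Proof. exact: lt_trans an. Qed.
Let n0 : (0 < n)%N. Proof. by rewrite -(ltr0n R). Qed.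
Let p0 : 0 < p. Proof. exact: lt_trans p1. Qed.
Let qV0 : 0 < q^-1.
Proof.
rewrite qE subr_gt0 -[ltLHS]invrK ltf_pV2 ?posrE ?invr_gt0 ?divr_gt0//.
by rewrite invf_div.
Qed.
Let q0 : 0 < q. Proof. by rewrite -invr_gt0. Qed.
Let q1 : q^-1 < p^-1.
Proof. by rewrite qE gtrBl divr_gt0. Qed.
Let p'0 : 0 < conj_exp p.
Proof. by rewrite invr_gt0 subr_gt0 invf_lt1. Qed.
Let hw : nonneg_measurable w.
Proof. by case: wA => -[]. Qed.
Let bs := euclid_ball_space (R := R) n0.

(* The exponent of the kernel is the one dictated by balance: this is where the
   relation [q^-1 = p^-1 - a / n] enters. *)
Let dim_exponent : n%:R * (q^-1 + (1 - p^-1)) = n%:R - a.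
Proof. by rewrite qE; field; rewrite !gt_eqF. Qed.

(** If the weight vanishes almost everywhere, both sides of the conclusion are
    trivial. Otherwise the normalising constant of the potential, whatever its
    value, is absorbed into [C], and [kernel_weight_bound] applies. *)
Lemma riesz_weighted_bound : exists2 C : R, 0 < C &
  forall (f : E -> \bar R) (A : R), measurable_fun setT f -> 0 < A ->
    (morrey_norm p theta (wpow w p) (wpow w q) f <= A%:E)%E ->
    forall x0 (r : R), 0 < r ->
      (\int[leb]_(x in eball x0 r) (`|riesz a f x| `^ q * (w x `^ q)%:E) <=
      ((C * A) `^ q * theta_q (mass x0 r))%:E)%E.
Proof.
have [theta0 _ _] := thetaD.
have [_ [C0 C00 hA]] := wA.
have [zero|w_pos] := weight_dichotomy bs (@eball_bounded R n) hw p'0 hA.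
  exists 1 => // f A mf A0 _ x0 r r0.
  have mB := measurable_ball_space bs x0 r.
  have mwq := nonneg_measurable_EFin (D := eball x0 r)
    (nonneg_measurable_powR q hw).
  have wq_ae : ae_eq leb (eball x0 r) (fun x => (w x `^ q)%:E) (cst 0%E).
    apply/(ae_eq_integral_abs leb mB mwq); rewrite -[RHS](zero x0 r).
    by apply: eq_integral => x _; rewrite gee0_abs// lee_fin powR_ge0.
  rewrite (_ : integral _ _ _ = 0%E).
    by rewrite lee_fin mulr_ge0 ?powR_ge0.
  transitivity (\int[leb]_(x in eball x0 r) (cst 0%E x : \bar R))%E; last exact: integral0.
  apply: ge0_ae_eq_integral.
  - exact: mB.
  - apply: emeasurable_funM; last exact: mwq.
    apply: measurable_funTS.
    pose g x := `|riesz a f x|%E.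
    have mg : measurable_fun setT g.
      exact: (measurableT_comp (@abse_measurable R setT) (measurable_riesz a mf)).
    exact: (measurableT_comp (measurable_poweR q) mg).
  - exact: measurable_cst.
  - by move=> x _; rewrite mule_ge0 ?poweR_ge0// lee_fin powR_ge0.
  - by [].
  by apply: filterS wq_ae => x h /h ->; rewrite mule0.
have mass0 x (r : R) : 0 < r -> 0 < mass x r.
  exact: (weight_mass_gt0 bs hw q0 hA w_pos).
have [C C_gt0 main] := kernel_weight_bound bs (@eball_bounded R n) hw C00 p1 q0 q1
  hA w_pos kappa0 kappapq thetaD (@riesz_kernel_ge0 R n a)
  (measurable_riesz_kernel a)
  (fun x y r r0 h => eq_ind_r (fun t => _ <= _ `^ (- t))
     (riesz_kernel_far an r0 h) dim_exponent)
  (fun x y => @riesz_kernel_diag R n a x y an).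
set c := `|(riesz_const n a)^-1|.
have c0 : 0 <= c by exact: normr_ge0.
exists (c * C + 1); first by rewrite ltr_wpDl// mulr_ge0// ltW.
move=> f A mf A0 fA x0 r r0.
have hf x (t : R) : (0 < t)%R ->
    (\int[leb]_(y in eball x t) (`|f y| `^ p * (w y `^ p)%:E) <=
     (A `^ p * theta (mass x t))%:E)%E.
  move=> t0; apply: le_of_poweR_scaled_le => //.
  - exact/theta0/mass0.
  - exact: ltW.
  - by apply: integral_ge0 => y _; rewrite mule_ge0 ?poweR_ge0// lee_fin powR_ge0.
  apply: le_trans fA; apply: ereal_sup_ubound.
  by exists x, t; split.
have thetaqE : theta_q (mass x0 r) = (theta (mass x0 r) `^ p^-1) `^ q.
  by rewrite -powRrM mulrC.
have th0 : 0 <= theta (mass x0 r) `^ p^-1 by exact: powR_ge0.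
rewrite thetaqE -powRM ?mulr_ge0// ?addr_ge0 ?mulr_ge0// ?(ltW A0) ?(ltW C_gt0)//.
have := main f A mf A0 hf x0 r r0.
move=> hJ.
pose I x := (\int[leb]_y (`|f y| * (riesz_kernel a x y)%:E))%E.
have I0 x : (0 <= I x)%E.
  by apply: integral_ge0 => y _; rewrite mule_ge0// lee_fin riesz_kernel_ge0.
have mI : measurable_fun setT I.
  apply: (@measurable_integral_section _ _ _ leb
    (fun z => `|f z.2| * (riesz_kernel a z.1 z.2)%:E)%E).
  apply: emeasurable_funM; last first.
    by apply/measurable_EFinP; exact: measurable_riesz_kernel.
  exact: (measurableT_comp (measurableT_comp (@abse_measurable R setT) mf) measurable_snd).
pose J x := (I x `^ q * (w x `^ q)%:E)%E.
have J0 x : (0 <= J x)%E by rewrite mule_ge0 ?poweR_ge0// lee_fin powR_ge0.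
have mJ : measurable_fun (eball x0 r) J.
  apply: measurable_funTS; apply: emeasurable_funM.
    exact: (measurableT_comp (measurable_poweR q) mI).
  exact: nonneg_measurable_EFin (nonneg_measurable_powR q hw).
have cq0 : (0 <= (c `^ q)%:E)%E by rewrite lee_fin powR_ge0.
apply: (@le_trans _ _
    (\int[leb]_(x in eball x0 r) ((c `^ q)%:E * J x))%E).
  apply: ge0_integral_mono => //.
  - by move=> x _; rewrite mule_ge0 ?poweR_ge0// lee_fin powR_ge0.
  - by move=> x _; rewrite mule_ge0.
  move=> x _; rewrite /J muleA; apply: lee_wpmul2r.
    by rewrite lee_fin powR_ge0.
  rewrite -poweR_EFin -poweRM//.
  apply: gt0_ler_poweR; first exact: ltW.
  - by rewrite in_itv/= abse_ge0 leey.
  - by rewrite in_itv/= leey andbT mule_ge0.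
  - exact: (abse_riesz_le a x mf).
have mB := measurable_ball_space bs x0 r.
rewrite (ge0_integralZl leb mB mJ (fun x _ => J0 x) cq0).
apply: (le_trans (lee_wpmul2l cq0 hJ)).
rewrite -EFinM lee_fin -powRM//; last first.
  by rewrite !mulr_ge0// ltW.
have A0' := ltW A0; have C0' := ltW C_gt0.
apply: powR_le_lnonneg; first exact: ltW.
  by rewrite !mulr_ge0.
rewrite !mulrA; apply: ler_wpM2r => //; apply: ler_wpM2r => //.
by rewrite lerDl.
Qed.

(** The bound on balls is available for positive [A] only, so the norm of [f],
    which may vanish, is approached by [fine Nf + e]. *)
Lemma riesz_norm_bound : exists2 C : R, 0 < C &
  forall (f : E -> \bar R),
    morrey p theta (wpow w p) (wpow w q) f ->
    morrey q theta_q (wpow w q) (wpow w q) (riesz a f) /\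
    (morrey_norm q theta_q (wpow w q) (wpow w q) (riesz a f)
       <= C%:E * morrey_norm p theta (wpow w p) (wpow w q) f)%E.
Proof.
have [C C0 main] := riesz_weighted_bound; exists C; first exact: C0.
move=> f [[mf _] foo].
set Nf := morrey_norm p _ _ _ f in foo *.
have Nf0 : (0 <= Nf)%E.
  pose x0 : E := (0 : 'rV[R]_n).
  pose b := (((theta (mass x0 1))^-1%:E *
    \int[leb]_(y in eball x0 1) (`|f y| `^ p * (w y `^ p)%:E)) `^ p^-1)%E.
  have b0 : (0 <= b)%E by exact: poweR_ge0.
  apply: (le_trans b0); apply: ereal_sup_ubound.
  by exists x0, 1; split; first exact: ltr01.
have NfE : Nf = (fine Nf)%:E by rewrite fineK// ge0_fin_numE.
have fNf0 : 0 <= fine Nf by exact: fine_ge0.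
have bound e : 0 < e -> forall x0 (r : R), 0 < r ->
    (\int[leb]_(x in eball x0 r) (`|riesz a f x| `^ q * (w x `^ q)%:E) <=
    ((C * (fine Nf + e)) `^ q * theta_q (mass x0 r))%:E)%E.
  move=> e0 x0 r r0; apply: main => //; first by rewrite ltr_wpDl.
  by rewrite -/Nf {1}NfE lee_fin lerDl ltW.
have norm_le : (morrey_norm q theta_q (wpow w q) (wpow w q) (riesz a f)
    <= C%:E * Nf)%E.
  apply/lee_addgt0Pr => e e0; apply: ge_ereal_sup => _ [x0 [r [r0 ->]]].
  have eC0 : 0 < e / C by exact: divr_gt0.
  have -> : (C%:E * Nf + e%:E = (C * (fine Nf + e / C))%:E)%E.
    by rewrite {1}NfE -EFinM -EFinD mulrDr mulrCA mulfV ?gt_eqF// mulr1.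
  apply: poweR_scaled_le; last exact: bound.
  - exact: powR_ge0.
  - exact: q0.
  - by rewrite mulr_ge0 ?addr_ge0// ltW.
  by apply: integral_ge0 => y _; rewrite mule_ge0 ?poweR_ge0// lee_fin powR_ge0.
split; last exact: norm_le.
split; last by apply: le_lt_trans norm_le _; rewrite NfE -EFinM ltry.
split; first exact: (measurable_riesz a mf).
move=> K cK; have [M M0 KM] := compact_sub_eball cK.
pose x0 : E := (0 : 'rV[R]_n).
have hM := le_lt_trans (bound 1 ltr01 x0 M M0) (ltry _).
apply: le_lt_trans hM.
by apply: ge0_integral_mono => // x _;
  rewrite mule_ge0 ?poweR_ge0// lee_fin powR_ge0.
Qed.

End riesz_morrey.

Theorem theorem2p1 (R : realType) (n : nat) (a p q kappa : R)
    (theta : R -> R) (w : euclid R n -> R)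
    (a0 : 0 < a) (an : a < n%:R)
    (p1 : 1 < p) (pna : p < n%:R / a)
    (qE : q^-1 = p^-1 - a / n%:R)
    (wA : Apq p q w)
    (kappa0 : 0 <= kappa) (kappapq : kappa < p / q)
    (thetaD : Dkappa kappa theta) :
  exists2 C : R, 0 < C &
    forall f : euclid R n -> \bar R,
      morrey p theta (wpow w p) (wpow w q) f ->
      morrey q (fun xi => theta xi `^ (q / p)) (wpow w q) (wpow w q)
        (riesz a f) /\
      (morrey_norm q (fun xi => (theta xi `^ (q / p))%R)
           (wpow w q) (wpow w q) (riesz a f)
       <= C%:E * morrey_norm p theta (wpow w p) (wpow w q) f)%E.
Proof.
exact: (riesz_norm_bound a0 an p1 pna qE wA kappa0 kappapq thetaD).
Qed.
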